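(* Let $p$ be a prime, let $\Lambda$ be a ring isomorphic to $\mathbb{Z}_p[[T]]$, and let $G$ be a finite $p$-group. Let $C$ be a perfect complex over the group ring $\Lambda[G]$ and put $\overline{C} = \Lambda \otimes^{\mathsf{L}}_{\Lambda[G]} C$, a perfect complex over $\Lambda$ (where $\Lambda$ is a $\Lambda[G]$-module via the augmentation $G \to 1$). Then every cohomology group of $C$ satisfies $\mu = 0$ if and only if every cohomology group of $\overline{C}$ satisfies $\mu=0$. If these equivalent conditions hold, then $\lambda(C) = (\# G)\, \lambda(\overline{C})$.
   Context: For a finitely generated $\Lambda$-module $M$ (a finitely generated $\Lambda[G]$-module is regarded as a $\Lambda$-module by forgetting the $G$-action): $\mu(M)=0$ means $M$ is finitely generated as a $\mathbb{Z}_p$-module (which includes $M$ being $\Lambda$-torsion), and $\lambda(M) = \dim_{\mathbb{Q}_p}(\mathbb{Q}_p\otimes_{\mathbb{Z}_p} M)$ (which is $+\infty$ if $M$ is not torsion). For a perfect complex $D$ whose cohomology groups are all torsion, $\lambda(D) := \sum_{i\in\mathbb{Z}}(-1)^i \lambda(H^i(D))$. *)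

(* Defs.v *)
From HB Require Import structures.
From mathcomp Require Import all_boot all_order all_algebra all_fingroup all_solvable.
From mathcomp.multinomials Require Import -(notations,coercions) monalg.
From mathcomp Require Import boolp classical_sets functions fsbigop constructive_ereal.
Set Implicit Arguments. Unset Strict Implicit. Unset Printing Implicit Defensive.
Import GRing.Theory.
Local Open Scope ring_scope.
Local Open Scope quotient_scope.

(* Z_p is the inverse limit of the Z/p^(n+1), n >= 0. The limit starts at
   exponent 1 because 'Z_1 denotes Z/2. *)

Definition padic_compat (p : nat) (x : forall n, 'Z_(p ^ n.+1)) : bool :=
  `[< forall n, (x n.+1 : nat)%:R = x n >].

Record padic_int (p : nat) (p_pr : prime p) := PadicInt {
  padic_val : forall n, 'Z_(p ^ n.+1);
  _ : padic_compat padic_val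
}.

HB.instance Definition _ p (p_pr : prime p) :=
  [isSub for @padic_val p p_pr].
HB.instance Definition _ p (p_pr : prime p) :=
  [Choice of padic_int p_pr by <:].

Section PadicRing.
Variables (p : nat) (p_pr : prime p).
Local Notation Zp := (padic_int p_pr).
Local Notation v := (@padic_val p p_pr).

Lemma padic_pow_gt1 n : (1 < p ^ n.+1)%N.
Proof. by rewrite -(exp1n n.+1) ltn_exp2r // prime_gt1. Qed.

Definition padic_red n (a : 'Z_(p ^ n.+2)) : 'Z_(p ^ n.+1) := (a : nat)%:R.

Lemma padic_red_nat n k : padic_red (k%:R : 'Z_(p ^ n.+2)) = k%:R.
Proof.
rewrite /padic_red val_Zp_nat ?padic_pow_gt1 //.
rewrite -[RHS]Zp_nat_mod ?padic_pow_gt1 // -[LHS]Zp_nat_mod ?padic_pow_gt1 //.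
by rewrite modn_dvdm // dvdn_exp2l.
Qed.

Lemma padic_redD n a b : @padic_red n (a + b) = padic_red a + padic_red b.
Proof. by rewrite -[a]natr_Zp -[b]natr_Zp -natrD !padic_red_nat natrD. Qed.

Lemma padic_redM n a b : @padic_red n (a * b) = padic_red a * padic_red b.
Proof. by rewrite -[a]natr_Zp -[b]natr_Zp -natrM !padic_red_nat natrM. Qed.

Lemma padic_valS (x : Zp) n : padic_red (v x n.+1) = v x n.
Proof. by case: x => x /= /asboolP/(_ n). Qed.

Lemma padic_zero_compat : padic_compat (fun n => 0 : 'Z_(p ^ n.+1)).
Proof. by apply/asboolP. Qed.

Lemma padic_one_compat : padic_compat (fun n => 1 : 'Z_(p ^ n.+1)).
Proof. by apply/asboolP => n; apply: (padic_red_nat n 1). Qed.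

Lemma padic_opp_compat (x : Zp) : padic_compat (fun n => - v x n).
Proof.
apply/asboolP => n; rewrite -/(padic_red _); apply/eqP.
by rewrite -addr_eq0 -(padic_valS x n) -padic_redD addNr (padic_red_nat n 0).
Qed.

Lemma padic_add_compat (x y : Zp) : padic_compat (fun n => v x n + v y n).
Proof. by apply/asboolP => n; rewrite -/(padic_red _) padic_redD !padic_valS. Qed.

Lemma padic_mul_compat (x y : Zp) : padic_compat (fun n => v x n * v y n).
Proof. by apply/asboolP => n; rewrite -/(padic_red _) padic_redM !padic_valS. Qed.

Definition padic_zero : Zp := PadicInt p_pr padic_zero_compat.
Definition padic_one : Zp := PadicInt p_pr padic_one_compat.
Definition padic_opp x : Zp := PadicInt p_pr (padic_opp_compat x).
Definition padic_add x y : Zp := PadicInt p_pr (padic_add_compat x y).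
Definition padic_mul x y : Zp := PadicInt p_pr (padic_mul_compat x y).

Lemma padicP (x y : Zp) : (forall n, v x n = v y n) -> x = y.
Proof. by move=> xy; apply/val_inj/functional_extensionality_dep. Qed.

Fact padic_addA : associative padic_add.
Proof. by move=> x y z; apply: padicP => n /=; rewrite addrA. Qed.
Fact padic_addC : commutative padic_add.
Proof. by move=> x y; apply: padicP => n /=; rewrite addrC. Qed.
Fact padic_add0 : left_id padic_zero padic_add.
Proof. by move=> x; apply: padicP => n /=; rewrite add0r. Qed.
Fact padic_addN : left_inverse padic_zero padic_opp padic_add.
Proof. by move=> x; apply: padicP => n /=; rewrite addNr. Qed.
HB.instance Definition _ :=
  GRing.isZmodule.Build Zp padic_addA padic_addC padic_add0 padic_addN.

Fact padic_mulA : associative padic_mul.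
Proof. by move=> x y z; apply: padicP => n /=; rewrite mulrA. Qed.
Fact padic_mulC : commutative padic_mul.
Proof. by move=> x y; apply: padicP => n /=; rewrite mulrC. Qed.
Fact padic_mul1 : left_id padic_one padic_mul.
Proof. by move=> x; apply: padicP => n /=; rewrite mul1r. Qed.
Fact padic_mulD : left_distributive padic_mul +%R.
Proof. by move=> x y z; apply: padicP => n /=; rewrite mulrDl. Qed.
Fact padic_one_neq0 : padic_one != 0.
Proof.
by apply/eqP => /(congr1 (fun x : Zp => v x 0%N)) /eqP /=; rewrite oner_eq0.
Qed.
HB.instance Definition _ := GRing.Zmodule_isComNzRing.Build Zp
  padic_mulA padic_mulC padic_mul1 padic_mulD padic_one_neq0.

Definition padic_unit : pred Zp := fun x => `[< exists y, y * x = 1 >].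
Definition padic_inv (x : Zp) : Zp :=
  if pselect (exists y, y * x = 1) is left h then projT1 (cid h) else x.

Fact padic_mulVx : {in padic_unit, left_inverse 1 padic_inv *%R}.
Proof.
move=> x /asboolP xU; rewrite /padic_inv.
by case: pselect => // h; apply: (projT2 (cid h)).
Qed.
Fact padic_unitPl (x y : Zp) : y * x = 1 -> padic_unit x.
Proof. by move=> yx; apply/asboolP; exists y. Qed.
Fact padic_inv_out : {in [predC padic_unit], padic_inv =1 id}.
Proof. by move=> x /asboolPn xU; rewrite /padic_inv; case: pselect. Qed.
HB.instance Definition _ := GRing.ComNzRing_hasMulInverse.Build Zp
  padic_mulVx padic_unitPl padic_inv_out.

Lemma padic_val_mod (x : Zp) n k :
  ((v x (n + k)%N : nat) %% p ^ n.+1 = v x n)%N.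
Proof.
have lt_v m : (v x m < p ^ m.+1)%N.
  by have := ltn_ord (v x m); rewrite [X in (_ < X)%N -> _]Zp_cast ?padic_pow_gt1.
elim: k => [|k IHk]; first by rewrite addn0 modn_small.
rewrite -{}IHk addnS -(padic_valS x (n + k)) /padic_red val_Zp_nat ?padic_pow_gt1 //.
by rewrite modn_dvdm // dvdn_exp2l // ltnS leq_addr.
Qed.

Fact padic_idomain (x y : Zp) : x * y = 0 -> (x == 0) || (y == 0).
Proof.
have nz (z : Zp) : z != 0 -> exists n, v z n != 0.
  move=> z0; apply: contrapT => h; case/eqP: z0; apply: padicP => n.
  by apply/eqP/negPn/negP => zn; apply: h; exists n.
have ndvd (z : Zp) n k : v z n != 0 -> (~~ (p ^ n.+1 %| v z (n + k)%N))%N.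
  by rewrite /dvdn padic_val_mod.
apply: contra_eqT; rewrite negb_or => /andP[/nz[n xn] /nz[m ym]].
apply/eqP => /(congr1 (fun z : Zp => v z (n + m).+1)) /=.
set a := v x _; set b := v y _ => ab0.
have := ndvd x n m.+1 xn; rewrite addnS -/a => a_n.
have := ndvd y m n.+1 ym; rewrite addnS addnC -/b => b_m.
have a_gt0 : (0 < a)%N by rewrite lt0n; apply: contraNneq a_n => ->.
have b_gt0 : (0 < b)%N by rewrite lt0n; apply: contraNneq b_m => ->.
have /(congr1 val)/= : (a * b)%N%:R = 0 :> 'Z_(p ^ (n + m).+2).
  by rewrite natrM !natr_Zp.
rewrite val_Zp_nat ?padic_pow_gt1 // => /eqP; rewrite -/(dvdn _ _).
rewrite pfactor_dvdn ?muln_gt0 ?a_gt0 // lognM //.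
rewrite leqNgt; case/negP.
move: a_n; rewrite pfactor_dvdn // -ltnNge ltnS => la.
move: b_m; rewrite pfactor_dvdn // -ltnNge ltnS => lb.
by rewrite ltnS ltnW // ltnS leq_add.
Qed.
HB.instance Definition _ := GRing.ComUnitRing_isIntegral.Build Zp padic_idomain.

End PadicRing.

(* R[[T]] as a wrapper around nat -> R, which already carries a pointwise ring
   structure. *)
Record powser (R : Type) := PowSer { pcoef : nat -> R }.
HB.instance Definition _ (R : Type) := [isNew for @pcoef R].
HB.instance Definition _ (R : choiceType) := [Choice of powser R by <:].

Section PowSerRing.
Variable R : comNzRingType.
Local Notation PS := (powser R).
Implicit Types f g h : PS.

Lemma powserP f g : (forall n, pcoef f n = pcoef g n) -> f = g.
Proof. by move=> fg; apply/val_inj/funext. Qed.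

Definition ps_zero : PS := PowSer (fun=> 0).
Definition ps_opp f : PS := PowSer (fun n => - pcoef f n).
Definition ps_add f g : PS := PowSer (fun n => pcoef f n + pcoef g n).
Definition ps_const (c : R) : PS := PowSer (fun n => if n == 0%N then c else 0).
Definition ps_mul f g : PS :=
  PowSer (fun n => \sum_(i < n.+1) pcoef f i * pcoef g (n - i)).

Fact ps_addA : associative ps_add.
Proof. by move=> x y z; apply: powserP => n /=; rewrite addrA. Qed.
Fact ps_addC : commutative ps_add.
Proof. by move=> x y; apply: powserP => n /=; rewrite addrC. Qed.
Fact ps_add0 : left_id ps_zero ps_add.
Proof. by move=> x; apply: powserP => n /=; rewrite add0r. Qed.
Fact ps_addN : left_inverse ps_zero ps_opp ps_add.
Proof. by move=> x; apply: powserP => n /=; rewrite addNr. Qed.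
HB.instance Definition _ :=
  GRing.isZmodule.Build PS ps_addA ps_addC ps_add0 ps_addN.

Definition ps_trunc N f : {poly R} := \poly_(i < N) pcoef f i.

Lemma coef_ps_trunc N f i : (i < N)%N -> (ps_trunc N f)`_i = pcoef f i.
Proof. by move=> iN; rewrite coef_poly iN. Qed.

Lemma ps_mul_coef N f g n (p q : {poly R}) : (n < N)%N ->
  (forall i, (i < N)%N -> p`_i = pcoef f i) ->
  (forall i, (i < N)%N -> q`_i = pcoef g i) ->
  pcoef (ps_mul f g) n = (p * q)`_n.
Proof.
move=> nN pf qg; rewrite coefM /=; apply: eq_bigr => i _.
by rewrite pf ?qg // (leq_ltn_trans _ nN) ?leq_subr // -ltnS.
Qed.

Fact ps_mulA : associative ps_mul.
Proof.
move=> f g h; apply: powserP => n.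
pose t := coef_ps_trunc (N := n.+1).
have tm a b i : (i < n.+1)%N ->
    (ps_trunc n.+1 a * ps_trunc n.+1 b)`_i = pcoef (ps_mul a b) i.
  by move=> lti; rewrite -(ps_mul_coef (N := n.+1) (f := a) (g := b)) //;
     move=> j; apply: t.
rewrite (ps_mul_coef (ltnSn n) (p := ps_trunc n.+1 f)
           (q := ps_trunc n.+1 g * ps_trunc n.+1 h)) //; last 2 first.
- by move=> i; apply: t.
- by move=> i; apply: tm.
rewrite mulrA; apply/esym/(ps_mul_coef (ltnSn n)).
- by move=> i; apply: tm.
- by move=> i; apply: t.
Qed.
Fact ps_mulC : commutative ps_mul.
Proof.
move=> f g; apply: powserP => n.
have t := coef_ps_trunc (N := n.+1).
rewrite (ps_mul_coef (ltnSn n) (t f) (t g)) mulrC.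
by apply/esym/(ps_mul_coef (ltnSn n) (t g) (t f)).
Qed.
Fact ps_mul1 : left_id (ps_const 1) ps_mul.
Proof.
move=> f; apply: powserP => n /=.
rewrite big_ord_recl /= subn0 mul1r big1 ?addr0 // => i _.
by rewrite mul0r.
Qed.
Fact ps_mulD : left_distributive ps_mul +%R.
Proof.
move=> f g h; apply: powserP => n /=; rewrite -big_split /=.
by apply: eq_bigr => i _; rewrite mulrDl.
Qed.
Fact ps_one_neq0 : ps_const 1 != 0.
Proof.
by apply/eqP => /(congr1 (fun x : PS => pcoef x 0%N)) /eqP /=; rewrite oner_eq0.
Qed.
HB.instance Definition _ := GRing.Zmodule_isComNzRing.Build PS
  ps_mulA ps_mulC ps_mul1 ps_mulD ps_one_neq0.

Lemma pcoefM f g n :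
  pcoef (f * g) n = \sum_(i < n.+1) pcoef f i * pcoef g (n - i).
Proof. by []. Qed.

Fact ps_const_zmod : zmod_morphism ps_const.
Proof. by move=> a b; apply: powserP => -[|n] //=; rewrite subr0. Qed.
Fact ps_const_monoid : monoid_morphism ps_const.
Proof.
split=> // a b; apply: powserP => n; rewrite pcoefM big_ord_recl /= subn0.
rewrite big1 => [|i _]; last by rewrite mul0r.
by rewrite addr0; case: eqP; rewrite ?mulr0.
Qed.
HB.instance Definition _ := GRing.isZmodMorphism.Build R PS ps_const ps_const_zmod.
HB.instance Definition _ := GRing.isMonoidMorphism.Build R PS ps_const ps_const_monoid.

End PowSerRing.

(* R[G] with G the whole finGroupType; wrapped because {ffun G -> R} carries the
   pointwise operations. *)
Record group_ring (R : Type) (G : finGroupType) :=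
  GroupRing { gcoef : {ffun G -> R} }.
HB.instance Definition _ (R : Type) G := [isNew for @gcoef R G].
HB.instance Definition _ (R : choiceType) G := [Choice of group_ring R G by <:].

Section GroupRingTheory.
Variables (R : nzRingType) (G : finGroupType).
Local Notation RG := (group_ring R G).
Implicit Types a b c : RG.

Lemma group_ringP a b : (forall g, gcoef a g = gcoef b g) -> a = b.
Proof. by move=> ab; apply/val_inj/ffunP. Qed.

Definition gr_zero : RG := GroupRing [ffun=> 0].
Definition gr_opp a : RG := GroupRing [ffun g => - gcoef a g].
Definition gr_add a b : RG := GroupRing [ffun g => gcoef a g + gcoef b g].
Definition gr_const (r : R) : RG :=
  GroupRing [ffun g => if g == 1%g then r else 0].
Definition gr_mul a b : RG :=
  GroupRing [ffun g => \sum_(h : G) gcoef a h * gcoef b (h^-1 * g)%g].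

Fact gr_addA : associative gr_add.
Proof. by move=> x y z; apply: group_ringP => n; rewrite !ffunE addrA. Qed.
Fact gr_addC : commutative gr_add.
Proof. by move=> x y; apply: group_ringP => n; rewrite !ffunE addrC. Qed.
Fact gr_add0 : left_id gr_zero gr_add.
Proof. by move=> x; apply: group_ringP => n; rewrite !ffunE add0r. Qed.
Fact gr_addN : left_inverse gr_zero gr_opp gr_add.
Proof. by move=> x; apply: group_ringP => n; rewrite !ffunE addNr. Qed.
HB.instance Definition _ :=
  GRing.isZmodule.Build RG gr_addA gr_addC gr_add0 gr_addN.

Fact gr_mulA : associative gr_mul.
Proof.
move=> x y z; apply: group_ringP => g; rewrite !ffunE.
transitivity (\sum_(h : G) \sum_(k : G)
    gcoef x h * (gcoef y k * gcoef z (k^-1 * (h^-1 * g))%g)).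
  by apply: eq_bigr => h _; rewrite ffunE mulr_sumr.
under [RHS]eq_bigr => k _ do rewrite ffunE mulr_suml.
rewrite [RHS]exchange_big /=; apply: eq_bigr => h _.
rewrite (reindex_inj (mulgI h^-1%g)) /=; apply: eq_bigr => k _.
by rewrite mulrA invMg invgK !mulgA mulgK.
Qed.
Fact gr_mul1l : left_id (gr_const 1) gr_mul.
Proof.
move=> x; apply: group_ringP => g; rewrite ffunE (bigD1 1%g) //= big1.
  by rewrite ffunE eqxx mul1r invg1 mul1g addr0.
by move=> h /negPf h1; rewrite ffunE h1 mul0r.
Qed.
Fact gr_mul1r : right_id (gr_const 1) gr_mul.
Proof.
move=> x; apply: group_ringP => g; rewrite ffunE (bigD1 g) //= big1.
  by rewrite ffunE mulVg eqxx mulr1 addr0.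
move=> h hg; rewrite ffunE; case: eqP => [/eqP|_]; last by rewrite mulr0.
by rewrite -eq_invg_mul invgK => /eqP hg'; rewrite hg' eqxx in hg.
Qed.
Fact gr_mulDl : left_distributive gr_mul +%R.
Proof.
move=> x y z; apply: group_ringP => g; rewrite !ffunE -big_split /=.
by apply: eq_bigr => h _; rewrite ffunE mulrDl.
Qed.
Fact gr_mulDr : right_distributive gr_mul +%R.
Proof.
move=> x y z; apply: group_ringP => g; rewrite !ffunE -big_split /=.
by apply: eq_bigr => h _; rewrite ffunE mulrDr.
Qed.
Fact gr_one_neq0 : gr_const 1 != 0.
Proof.
apply/eqP => /(congr1 (fun x : RG => gcoef x 1%g)) /eqP.
by rewrite !ffunE eqxx oner_eq0.
Qed.
HB.instance Definition _ := GRing.Zmodule_isNzRing.Build RG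
  gr_mulA gr_mul1l gr_mul1r gr_mulDl gr_mulDr gr_one_neq0.

Fact gr_const_zmod : zmod_morphism gr_const.
Proof.
move=> a b; apply: group_ringP => g; rewrite !ffunE.
by case: eqP; rewrite ?subr0.
Qed.
Fact gr_const_monoid : monoid_morphism gr_const.
Proof.
split=> // a b; apply: group_ringP => g; rewrite !ffunE (bigD1 1%g) //= big1.
  by rewrite !ffunE eqxx invg1 mul1g addr0; case: eqP; rewrite ?mulr0.
by move=> h /negPf h1; rewrite ffunE h1 mul0r.
Qed.
HB.instance Definition _ := GRing.isZmodMorphism.Build R RG gr_const gr_const_zmod.
HB.instance Definition _ :=
  GRing.isMonoidMorphism.Build R RG gr_const gr_const_monoid.

Definition augmentation (a : RG) : R := \sum_(g : G) gcoef a g.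

Fact augmentation_zmod : zmod_morphism augmentation.
Proof.
move=> a b; rewrite /augmentation -sumrB.
by apply: eq_bigr => g _; rewrite !ffunE.
Qed.
Fact augmentation_monoid : monoid_morphism augmentation.
Proof.
split=> [|a b]; rewrite /augmentation.
  rewrite (bigD1 1%g) //= big1 ?ffunE ?eqxx ?addr0 //.
  by move=> g /negPf g1; rewrite ffunE g1.
under eq_bigr => g _ do rewrite ffunE.
rewrite exchange_big /= mulr_suml; apply: eq_bigr => h _.
rewrite -mulr_sumr; congr (_ * _).
by rewrite (reindex_inj (mulgI h)) /=; apply: eq_bigr => k _; rewrite mulKg.
Qed.
HB.instance Definition _ :=
  GRing.isZmodMorphism.Build RG R augmentation augmentation_zmod.
HB.instance Definition _ :=
  GRing.isMonoidMorphism.Build RG R augmentation augmentation_monoid.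

End GroupRingTheory.

Definition fin_gen (R : nzRingType) (M : lmodType R) : Prop :=
  exists (n : nat) (e : 'I_n -> M),
    forall x, exists c : 'I_n -> R, x = \sum_(i < n) c i *: e i.

Definition projective (R : nzRingType) (P : lmodType R) : Prop :=
  forall (M N : lmodType R) (g : {linear M -> N}) (h : {linear P -> N}),
    (forall y, exists x, g x = y) ->
    exists k : {linear P -> M}, forall x, g (k x) = h x.

Definition restr (R S : nzRingType) (f : {rmorphism R -> S}) (M : lmodType S)
  : Type := M.

Section Restriction.
Variables (R S : nzRingType) (f : {rmorphism R -> S}) (M : lmodType S).
HB.instance Definition _ := GRing.Zmodule.on (restr f M).

Definition restr_scale (r : R) (x : restr f M) : restr f M := f r *: (x : M).

Fact restr_scaleA a b x :
  restr_scale a (restr_scale b x) = restr_scale (a * b) x.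
Proof. by rewrite /restr_scale scalerA rmorphM. Qed.
Fact restr_scale1 : left_id 1 restr_scale.
Proof. by move=> x; rewrite /restr_scale rmorph1 scale1r. Qed.
Fact restr_scaleDr : right_distributive restr_scale +%R.
Proof. by move=> a x y; rewrite /restr_scale scalerDr. Qed.
Fact restr_scaleDl x : {morph restr_scale^~ x : a b / a + b}.
Proof. by move=> a b; rewrite /restr_scale rmorphD scalerDl. Qed.
HB.instance Definition _ := GRing.Zmodule_isLmodule.Build R (restr f M)
  restr_scaleA restr_scale1 restr_scaleDr restr_scaleDl.
End Restriction.

Section RestrictionMap.
Variables (R S : nzRingType) (f : {rmorphism R -> S}) (M N : lmodType S).
Variable u : {linear M -> N}.

Definition restr_map (x : restr f M) : restr f N := u x.

Fact restr_map_linear : linear restr_map.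
Proof. by move=> a x y; rewrite /restr_map raddfD /= linearZ. Qed.
HB.instance Definition _ := GRing.isLinear.Build R (restr f M) (restr f N) _
  restr_map restr_map_linear.
End RestrictionMap.
Arguments restr_map {R S} f {M N} u _.

Section QuotientModule.
Variables (R : nzRingType) (V : lmodType R) (S : submodClosed V).

Definition submod_pred : {pred V} := S.
HB.instance Definition _ := GRing.isZmodClosed.Build V submod_pred
  (GRing.submod_closedB (submodClosedP S)).

Definition quotmod : Type := Quotient.quot submod_pred.
HB.instance Definition _ := GRing.Zmodule.on quotmod.

Definition qmod_pi (x : V) : quotmod := \pi_(Quotient.quot submod_pred) x.
Definition qmod_repr (q : quotmod) : V := generic_quotient.repr (q : Quotient.quot submod_pred).
Definition qmod_scale (a : R) (q : quotmod) : quotmod :=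
  qmod_pi (a *: qmod_repr q).

Lemma qmod_reprK : cancel qmod_repr qmod_pi.
Proof. exact: reprK. Qed.

Lemma qmod_piP (x y : V) : qmod_pi x = qmod_pi y <-> x - y \in S.
Proof.
rewrite -[_ \in S]/(x - y \in submod_pred) Quotient.idealrBE.
by split=> /eqP.
Qed.

Lemma qmod_piB : {morph qmod_pi : x y / x - y}.
Proof. by move=> x y; rewrite /qmod_pi raddfB. Qed.
Lemma qmod_piD : {morph qmod_pi : x y / x + y}.
Proof. by move=> x y; rewrite /qmod_pi raddfD. Qed.

Lemma qmod_scaleE a x : qmod_scale a (qmod_pi x) = qmod_pi (a *: x).
Proof.
apply/qmod_piP; rewrite -scalerBr rpredZ //; apply/qmod_piP.
exact: qmod_reprK.
Qed.

Fact qmod_scaleA a b x : qmod_scale a (qmod_scale b x) = qmod_scale (a * b) x.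
Proof. by rewrite -[x]qmod_reprK !qmod_scaleE scalerA. Qed.
Fact qmod_scale1 : left_id 1 qmod_scale.
Proof. by move=> x; rewrite -[x]qmod_reprK !qmod_scaleE scale1r. Qed.
Fact qmod_scaleDr : right_distributive qmod_scale +%R.
Proof.
move=> a x y; rewrite -[x]qmod_reprK -[y]qmod_reprK -qmod_piD !qmod_scaleE.
by rewrite scalerDr qmod_piD.
Qed.
Fact qmod_scaleDl x : {morph qmod_scale^~ x : a b / a + b}.
Proof.
by move=> a b; rewrite -[x]qmod_reprK !qmod_scaleE scalerDl qmod_piD.
Qed.
HB.instance Definition _ := GRing.Zmodule_isLmodule.Build R quotmod
  qmod_scaleA qmod_scale1 qmod_scaleDr qmod_scaleDl.

Fact qmod_pi_linear : linear qmod_pi.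
Proof. by move=> a x y; rewrite qmod_piD -qmod_scaleE. Qed.
HB.instance Definition _ := GRing.isLinear.Build R V quotmod _ qmod_pi
  qmod_pi_linear.

Lemma qmod_piZ a : {morph qmod_pi : x / a *: x}.
Proof. by move=> x; rewrite linearZ. Qed.
End QuotientModule.

Section Generated.
Variables (R : nzRingType) (V : lmodType R) (A : V -> Prop).

Definition gen_sub : {pred V} := fun v =>
  `[< forall S : {pred V}, submod_closed S -> (forall a, A a -> a \in S) ->
      v \in S >].

Fact gen_sub_closed : submod_closed gen_sub.
Proof.
split=> [|a u v /asboolP uA /asboolP vA]; apply/asboolP => S Scl SA.
  by case: Scl.
by case: (Scl) => _; apply; [apply: uA | apply: vA].
Qed.
HB.instance Definition _ := GRing.isSubmodClosed.Build R V gen_sub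
  (GRing.submod_closed_semi gen_sub_closed).

Lemma gen_sub_mem a : A a -> a \in gen_sub.
Proof. by move=> Aa; apply/asboolP => S _; apply. Qed.
End Generated.

(* Extension of scalars S (x)_R M along f : R -> S, presented as the left
   S-module on the generators 1 (x) m, subject to additivity in m and
   1 (x) (r m) = f(r) (x) m. *)
Section BaseChange.
Variables (R S : nzRingType) (f : {rmorphism R -> S}) (M : lmodType R).

Definition bc_gen (m : M) : malg M S := mkmalgU m 1.

Inductive bc_rel : malg M S -> Prop :=
| BcAdd m m' : bc_rel (bc_gen (m + m') - bc_gen m - bc_gen m')
| BcScale r m : bc_rel (bc_gen (r *: m) - f r *: bc_gen m).

Definition base_change : Type := quotmod (gen_sub bc_rel).
HB.instance Definition _ := GRing.Lmodule.on base_change.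

Definition bc_tens (s : S) (m : M) : base_change := s *: qmod_pi _ (bc_gen m).

End BaseChange.

Section FreeLift.
Variables (S : nzRingType) (K : choiceType) (W : lmodType S) (g : K -> W).

Definition free_lift (v : malg K S) : W :=
  \sum_(k <- finmap.enum_fset (msupp v)) mcoeff k v *: g k.

Lemma free_liftEw (D : finmap.finSet K) (v : malg K S) :
  finmap.fsubset (msupp v) D ->
  free_lift v = \sum_(k <- finmap.enum_fset D) mcoeff k v *: g k.
Proof.
move=> sD; apply: finmap.big_fset_incl => // k _ /mcoeff_outdom ->.
by rewrite scale0r.
Qed.

Fact free_lift_linear : linear free_lift.
Proof.
move=> a u v; pose D := finmap.fsetU (msupp u) (msupp v).
rewrite (free_liftEw (v := u) (D := D)) ?finmap.fsubsetUl //.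
rewrite (free_liftEw (v := v) (D := D)) ?finmap.fsubsetUr //.
rewrite (free_liftEw (D := D)); last first.
  apply: finmap.fsubset_trans (msuppD_le _ _) _.
  by apply/finmap.fsetSU/msuppZ_le.
rewrite scaler_sumr -big_split /=; apply: eq_bigr => k _.
by rewrite mcoeffD mcoeffZ scalerDl scalerA.
Qed.
HB.instance Definition _ := GRing.isLinear.Build S (malg K S) W _ free_lift
  free_lift_linear.

Lemma free_liftU k c : free_lift (mkmalgU k c) = c *: g k.
Proof.
rewrite (free_liftEw (D := finmap.fset1 k)) ?msuppU_le //.
by rewrite finmap.big_seq_fset1 mcoeffUU.
Qed.
End FreeLift.

Section BaseChangeLift.
Variables (R S : nzRingType) (f : {rmorphism R -> S}) (M : lmodType R).
Variables (W : lmodType S) (g : M -> W).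

Definition bc_lift (x : base_change f M) : W := free_lift g (qmod_repr x).

Hypothesis gD : {morph g : x y / x + y}.
Hypothesis gZ : forall r, {morph g : x / r *: x >-> f r *: x}.

Lemma bc_lift_pi v : bc_lift (qmod_pi _ v) = free_lift g v.
Proof.
apply/eqP; rewrite -subr_eq0 -raddfB /=; apply/eqP.
have : qmod_repr (qmod_pi (gen_sub (bc_rel f (M := M))) v) - v \in
    gen_sub (bc_rel f (M := M)).
  by apply/qmod_piP; rewrite qmod_reprK.
set w := _ - v; move=> /asboolP/(_ [pred z | free_lift g z == 0]) h.
apply/eqP/h => [|_ [m m'|r m]]; rewrite ?inE.
- split; first by rewrite inE raddf0.
  move=> a x y; rewrite !inE linearP => /eqP x0 /eqP y0.
  by rewrite /= x0 y0 scaler0 addr0.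
- by rewrite !raddfB /= !free_liftU !scale1r gD addrAC addrK subrr.
- by rewrite raddfB /= linearZ /= !free_liftU !scale1r gZ subrr.
Qed.

Fact bc_lift_linear : linear bc_lift.
Proof.
move=> a x y; rewrite -[x]qmod_reprK -[y]qmod_reprK.
by rewrite -linearP !bc_lift_pi linearP.
Qed.

Lemma bc_liftE s m : bc_lift (bc_tens f s m) = s *: g m.
Proof. by rewrite /bc_tens -linearZ bc_lift_pi linearZ /= free_liftU scale1r. Qed.
End BaseChangeLift.

Section BaseChangeTheory.
Variables (R S : nzRingType) (f : {rmorphism R -> S}) (M : lmodType R).

Lemma bc_tensDr s : {morph @bc_tens _ _ f M s : x y / x + y}.
Proof.
move=> x y; rewrite /bc_tens -scalerDr -qmod_piD; congr (_ *: _).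
by apply/qmod_piP; rewrite opprD addrA; apply/gen_sub_mem/BcAdd.
Qed.

Lemma bc_tensZr s r (x : M) : bc_tens f s (r *: x) = bc_tens f (s * f r) x.
Proof.
rewrite /bc_tens -scalerA -[f r *: _]qmod_piZ; congr (_ *: _).
by apply/qmod_piP/gen_sub_mem/BcScale.
Qed.

Lemma bc_tens0r s : bc_tens f s (0 : M) = 0.
Proof.
by rewrite -[0 in LHS](scale0r 0) bc_tensZr rmorph0 mulr0 /bc_tens scale0r.
Qed.
End BaseChangeTheory.

Section BaseChangeMap.
Variables (R S : nzRingType) (f : {rmorphism R -> S}) (M N : lmodType R).
Variable u : {linear M -> N}.

Definition bc_map : base_change f M -> base_change f N :=
  bc_lift (fun m => bc_tens f 1 (u m)).

Fact bc_map_add : {morph (fun m => bc_tens f 1 (u m)) : x y / x + y}.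
Proof. by move=> x y; rewrite raddfD bc_tensDr. Qed.
Fact bc_map_scale r :
  {morph (fun m => bc_tens f 1 (u m)) : x / r *: x >-> f r *: x}.
Proof. by move=> x; rewrite linearZ /= bc_tensZr mul1r /bc_tens scale1r. Qed.

HB.instance Definition _ := GRing.isLinear.Build S (base_change f M)
  (base_change f N) _ bc_map (bc_lift_linear bc_map_add bc_map_scale).

Lemma bc_mapE s m : bc_map (bc_tens f s m) = bc_tens f s (u m).
Proof.
by rewrite /bc_map (bc_liftE bc_map_add bc_map_scale) /bc_tens scalerA mulr1.
Qed.
End BaseChangeMap.
Arguments bc_map {R S} f {M N} u _.

Lemma base_change_ind (R S : nzRingType) (f : {rmorphism R -> S})
    (M : lmodType R) (P : base_change f M -> Prop) :
  (forall s m, P (bc_tens f s m)) -> (forall x y, P x -> P y -> P (x + y)) ->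
  forall x, P x.
Proof.
move=> Pt PD x; have P0 : P 0.
  by have := Pt 0 0; rewrite /bc_tens scale0r.
rewrite -[x]qmod_reprK [qmod_repr x]monalgE raddf_sum /=.
elim/big_rec: _ => // m y _ Py; apply: PD => //.
have -> : mkmalgU m (mcoeff m (qmod_repr x)) =
    mcoeff m (qmod_repr x) *: bc_gen S m.
  by apply/malgP => k; rewrite mcoeffZ !mcoeffU mulrnAr mulr1.
by rewrite linearZ; apply: Pt.
Qed.

(* Differentials are given between all pairs of degrees and vanish off
   j = i + 1; this avoids casts along (i - 1) + 1 = i. *)
Record complex (R : nzRingType) := Complex {
  cobj :> int -> lmodType R;
  cdiff : forall i j : int, {linear cobj i -> cobj j};
  cdiff_shape : forall i j, j != i + 1 -> forall x, cdiff i j x = 0;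
  cdiffK : forall i j k x, cdiff j k (cdiff i j x) = 0
}.

Section Cohomology.
Variables (R : nzRingType) (C : complex R) (i : int).

Definition is_cocycle : {pred C i} := fun x => cdiff C i (i + 1) x == 0.

Fact is_cocycle_closed : submod_closed is_cocycle.
Proof.
split=> [|a x y]; rewrite !unfold_in ?raddf0 // => /eqP x0 /eqP y0.
by rewrite linearP x0 y0 scaler0 addr0.
Qed.
HB.instance Definition _ := GRing.isSubmodClosed.Build R (C i) is_cocycle
  (GRing.submod_closed_semi is_cocycle_closed).

Record cocycle := Cocycle { cocycle_val : C i; _ : cocycle_val \in is_cocycle }.
HB.instance Definition _ := [isSub for cocycle_val].
HB.instance Definition _ := [Choice of cocycle by <:].
HB.instance Definition _ := [SubChoice_isSubLmodule of cocycle by <:].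

Definition is_coboundary : {pred cocycle} := fun z =>
  `[< exists y : C (i - 1), cdiff C (i - 1) i y = cocycle_val z >].

Fact is_coboundary_closed : submod_closed is_coboundary.
Proof.
split=> [|a x y /asboolP[u ux] /asboolP[v vy]]; apply/asboolP.
  by exists 0; rewrite !raddf0.
by exists (a *: u + v); rewrite linearP ux vy.
Qed.
HB.instance Definition _ := GRing.isSubmodClosed.Build R cocycle is_coboundary
  (GRing.submod_closed_semi is_coboundary_closed).

Definition cohomology : Type := quotmod is_coboundary.
HB.instance Definition _ := GRing.Lmodule.on cohomology.

Definition coh_class (z : cocycle) : cohomology := qmod_pi is_coboundary z.
Definition coh_repr (c : cohomology) : cocycle := qmod_repr c.
End Cohomology.

Record chain_map (R : nzRingType) (C D : complex R) := ChainMap {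
  cmap :> forall i, {linear C i -> D i};
  cmapP : forall i j x, cmap j (cdiff C i j x) = cdiff D i j (cmap i x)
}.

Section CohomologyMap.
Variables (R : nzRingType) (C D : complex R) (f : chain_map C D) (i : int).

Fact cocycle_map_subproof (z : cocycle C i) :
  f i (cocycle_val z) \in is_cocycle (C := D) (i := i).
Proof. by case: z => x /= /eqP x0; rewrite unfold_in -cmapP x0 raddf0. Qed.

Definition cocycle_map (z : cocycle C i) : cocycle D i :=
  Cocycle (cocycle_map_subproof z).

Definition cohomology_map (c : cohomology C i) : cohomology D i :=
  coh_class (cocycle_map (coh_repr c)).

Lemma cohomology_mapE z :
  cohomology_map (coh_class z) = coh_class (cocycle_map z).
Proof.
have /qmod_piP/asboolP[y yE] : coh_class (coh_repr (coh_class z)) = coh_class z.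
  exact: qmod_reprK.
apply/qmod_piP/asboolP; exists (f (i - 1) y).
by rewrite -cmapP yE raddfB.
Qed.
End CohomologyMap.

Definition quasi_iso (R : nzRingType) (C D : complex R) (f : chain_map C D) :=
  forall i, bijective (cohomology_map f (i := i)).

Definition strictly_perfect (R : nzRingType) (P : complex R) : Prop :=
  (forall i, fin_gen (P i) /\ projective (P i)) /\
  (exists n : nat, forall i : int, (n < `|i|)%N -> forall x : P i, x = 0).

(* Bounded complexes of projectives are K-projective, so an isomorphism from P
   to C in the derived category is given by a single quasi-isomorphism. *)
Definition perfect (R : nzRingType) (C : complex R) : Prop :=
  exists (P : complex R) (q : chain_map P C), strictly_perfect P /\ quasi_iso q.

Section BaseChangeComplex.
Variables (R S : nzRingType) (f : {rmorphism R -> S}) (C : complex R).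

Fact bc_complex_shape i j : j != i + 1 ->
  forall x, bc_map f (cdiff C i j) x = 0.
Proof.
move=> ij; elim/base_change_ind => [s m|x y x0 y0].
  by rewrite bc_mapE (cdiff_shape ij) bc_tens0r.
by rewrite raddfD /= x0 y0 addr0.
Qed.

Fact bc_complexK i j k (x : base_change f (C i)) :
  bc_map f (cdiff C j k) (bc_map f (cdiff C i j) x) = 0.
Proof.
elim/base_change_ind: x => [s m|x y x0 y0].
  by rewrite !bc_mapE cdiffK bc_tens0r.
by rewrite !raddfD /= x0 y0 addr0.
Qed.

Definition bc_complex : complex S :=
  Complex (cobj := fun i => base_change f (C i) : lmodType S)
    (cdiff := fun i j => bc_map f (cdiff C i j))
    bc_complex_shape bc_complexK.
End BaseChangeComplex.

Section RestrictionComplex.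
Variables (R S : nzRingType) (f : {rmorphism R -> S}) (C : complex S).

Fact restr_complex_shape i j : j != i + 1 ->
  forall x, restr_map f (cdiff C i j) x = 0.
Proof. by move=> ij x; apply: cdiff_shape. Qed.

Fact restr_complexK i j k (x : restr f (C i)) :
  restr_map f (cdiff C j k) (restr_map f (cdiff C i j) x) = 0.
Proof. exact: cdiffK. Qed.

Definition restr_complex : complex R :=
  Complex (cobj := fun i => restr f (C i) : lmodType R)
    (cdiff := fun i j => restr_map f (cdiff C i j))
    restr_complex_shape restr_complexK.
End RestrictionComplex.

Section StrictlyPerfectBaseChange.
Variables (R S : nzRingType) (f : {rmorphism R -> S}).

Lemma fin_gen_base_change (M : lmodType R) :
  fin_gen M -> fin_gen (base_change f M).
Proof.
move=> [n [e eP]]; exists n, (fun i => bc_tens f 1 (e i)).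
elim/base_change_ind => [s m|x y [c ->] [d ->]].
  have [c ->] := eP m; exists (fun i => s * f (c i)).
  have -> : bc_tens f s (\sum_(i < n) c i *: e i) =
      \sum_(i < n) bc_tens f s (c i *: e i).
    apply: (big_morph (bc_tens f s)); [exact: bc_tensDr | exact: bc_tens0r].
  by apply: eq_bigr => i _; rewrite bc_tensZr /bc_tens scale1r.
exists (fun i => c i + d i); rewrite -big_split /=.
by apply: eq_bigr => i _; rewrite scalerDl.
Qed.

Lemma projective_base_change (P : lmodType R) :
  projective P -> projective (base_change f P).
Proof.
move=> prP M N g h g_surj.
have h_lin : linear (fun x => h (bc_tens f 1 x) : restr f N).
  move=> a x y; rewrite bc_tensDr bc_tensZr mul1r raddfD /=.
  by rewrite /bc_tens !scale1r linearZ.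
pose h1 : {linear P -> restr f N} := HB.pack (fun x => h (bc_tens f 1 x) : restr f N)
  (GRing.isLinear.Build R P (restr f N) _ _ h_lin).
have [k kP] := prP (restr f M) (restr f N) (restr_map f g) h1 g_surj.
have kD : {morph (k : P -> M) : x y / x + y} by move=> x y; rewrite raddfD.
have kZ r : {morph (k : P -> M) : x / r *: x >-> f r *: x}.
  by move=> x; rewrite linearZ.
pose k1 : {linear base_change f P -> M} := HB.pack (bc_lift (f := f) (k : P -> M))
  (GRing.isLinear.Build S (base_change f P) M _ _ (bc_lift_linear kD kZ)).
exists k1; elim/base_change_ind => [s m|x y xE yE].
  rewrite /= (bc_liftE kD kZ) linearZ /=; have -> : g (k m) = h (bc_tens f 1 m) := kP m.
  by rewrite -linearZ /bc_tens scale1r.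
by rewrite !raddfD /= xE yE.
Qed.

Lemma strictly_perfect_bc_complex (P : complex R) :
  strictly_perfect P -> strictly_perfect (bc_complex f P).
Proof.
move=> [Pi [n Pn]]; split=> [i|]; last first.
  exists n => i ni; elim/base_change_ind => [s m|x y -> ->]; last exact: addr0.
  by rewrite (Pn i ni m) bc_tens0r.
by have [? ?] := Pi i; split; [apply: fin_gen_base_change | apply: projective_base_change].
Qed.
End StrictlyPerfectBaseChange.

(* D represents S (x)^L_R C, computed on a strictly perfect representative P
   of C. *)
Definition derived_base_change (R S : nzRingType) (f : {rmorphism R -> S})
    (C : complex R) (D : complex S) : Prop :=
  exists (P : complex R) (q : chain_map P C) (r : chain_map (bc_complex f P) D),
    [/\ strictly_perfect P, quasi_iso q & quasi_iso r].

Lemma derived_base_change_perfect (R S : nzRingType) (f : {rmorphism R -> S})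
    (C : complex R) (D : complex S) : derived_base_change f C D -> perfect D.
Proof.
move=> [P [q [r [sP _ qr]]]]; exists (bc_complex f P), r; split=> //.
exact: strictly_perfect_bc_complex.
Qed.

Definition is_basis (K : fieldType) (V : lmodType K) n (b : 'I_n -> V) : Prop :=
  forall v, exists! c : {ffun 'I_n -> K}, v = \sum_(i < n) c i *: b i.

Definition vdim (K : fieldType) (V : lmodType K) : \bar int :=
  if pselect (exists n, exists b : 'I_n -> V, is_basis b) is left h
  then (projT1 (cid h) : int)%:E else +oo%E.

Section Iwasawa.
Variables (p : nat) (p_pr : prime p) (L : nzRingType).
Variable psi : {rmorphism powser (padic_int p_pr) -> L}.

(* The Z_p-algebra structure of L. It does not depend on psi: a ring morphism
   from Z_p to Z_p[[T]] is unique. *)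
Definition padic_to_Lambda : {rmorphism padic_int p_pr -> L} :=
  psi \o @ps_const (padic_int p_pr).

Definition padic_module (M : lmodType L) : lmodType (padic_int p_pr) :=
  restr padic_to_Lambda M.

Definition mu_zero (M : lmodType L) : Prop := fin_gen (padic_module M).

Definition lambda (M : lmodType L) : \bar int :=
  vdim (base_change (@tofrac (padic_int p_pr)) (padic_module M)).

(* The support of the sum is finite for a perfect complex. *)
Definition lambda_complex (D : complex L) : \bar int :=
  (\big[adde/0]_(i \in [set: int]) (((-1) ^ i)%:E * lambda (cohomology D i)))%E.
End Iwasawa.

(* Main.v *)
(** Put S = Zp[[T]]. The cohomology of a bounded complex P of finitely generated
    projective modules has mu = 0 if and only if some g in S, not divisible by p,
    kills it, that is, if and only if some power of g is null-homotopic on P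
    (Weierstrass division and Cayley-Hamilton give the two directions). A homotopy
    descends to the coinvariants. Conversely, a homotopy from f to 0 on the
    coinvariants lifts to P up to an error with image in I P; since G is a p-group,
    I is nilpotent modulo p, so a power of f is homotopic to a multiple of p, and
    the characteristic polynomial of the quotient yields a new g.

    For lambda, choose the homotopy h with h^2 = 0 and fold the complex, so that
    D = d + h satisfies D^2 = g. By Nakayama's lemma, coker D has Zp-rank at most
    #G times that of its coinvariants; the two halves of D add up to coker g, for
    which equality holds by the same argument on a complementary summand of a free
    module. Hence equality holds for coker D, whose rank is the Euler
    characteristic plus the rank of ker d / g ker d; replacing (h, g) by
    (g h, g^2) doubles the second term only. *)
Require Import Defs.
From HB Require Import structures.
From mathcomp Require Import all_boot all_order all_algebra all_fingroup all_solvable.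
From mathcomp Require Import zify.
From mathcomp Require Import boolp classical_sets functions fsbigop constructive_ereal.
Set Implicit Arguments. Unset Strict Implicit. Unset Printing Implicit Defensive.
Import GRing.Theory.
Local Open Scope ring_scope.

(** * Ranks of subquotients over a domain *)

(** The obstacle for lambda is p-torsion. Nakayama's lemma compares numbers of generators, and over
    [Zp] such a number is a rank only for torsion-free modules, which cohomology groups need not be.
    The square root D of g repairs this: g is injective modulo p on a projective module, so coker D
    on the coinvariants is torsion-free. The price is the extra term [rk (ker d / g ker d)], which
    is eliminated rather than computed. The bound itself gives one inequality only. It turns into an
    equality because it is always applied to two pieces whose total is known: a projective module
    and its complement, or the two parities. Squaring d + h gives d h + h d only if h squares to
    zero, and d + h respects no grading finer than the one modulo 2; hence the condition on h and
    the folding. *)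

Definition linear_pack (R : nzRingType) (M N : lmodType R) (f : M -> N)
    (f_lin : linear f) : {linear M -> N} :=
  HB.pack f (GRing.isLinear.Build R M N _ f f_lin).

Definition submodule (A : nzRingType) (M : lmodType A) (Y : M -> Prop) : Prop :=
  Y 0 /\ forall a x y, Y x -> Y y -> Y (a *: x + y).

Section Submodule.
Variables (A : nzRingType) (M : lmodType A) (Y : M -> Prop).
Hypothesis sY : submodule Y.

Lemma submod0 : Y 0. Proof. by case: sY. Qed.
Lemma submodD x y : Y x -> Y y -> Y (x + y).
Proof. by move=> Yx Yy; rewrite -[x]scale1r; apply: (proj2 sY). Qed.
Lemma submodZ a x : Y x -> Y (a *: x).
Proof. by move=> Yx; rewrite -[_ *: _]addr0; apply: (proj2 sY) => //; apply: submod0. Qed.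
Lemma submodN x : Y x -> Y (- x).
Proof. by rewrite -scaleN1r; apply: submodZ. Qed.
Lemma submodB x y : Y x -> Y y -> Y (x - y).
Proof. by move=> Yx Yy; apply: submodD => //; apply: submodN. Qed.
Lemma submod_sum (T : Type) (s : seq T) (P : pred T) (e : T -> M) :
  (forall i, P i -> Y (e i)) -> Y (\sum_(i <- s | P i) e i).
Proof. by move=> Ye; apply: (big_ind Y) => //; [apply: submod0 | apply: submodD]. Qed.
Lemma submod_trans x y : Y (x - y) -> Y y -> Y x.
Proof. by move=> Yxy Yy; rewrite -(subrK y x); apply: submodD. Qed.
Lemma submod_subC x y : Y (x - y) -> Y (y - x).
Proof. by rewrite -[y - x]opprB; apply: submodN. Qed.
Lemma submod_sub_trans y x z : Y (x - y) -> Y (y - z) -> Y (x - z).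
Proof. by move=> xy yz; rewrite -(subrKA y x (- z)) ; apply: submodD. Qed.
End Submodule.

Lemma submodule_sum (A : nzRingType) (M : lmodType A) (X Y : M -> Prop) :
  submodule X -> submodule Y ->
  submodule (fun x => exists u v, [/\ X u, Y v & x = u + v]).
Proof.
move=> sX sY; split=> [|a _ _ [u [v [Xu Yv ->]]] [u' [v' [Xu' Yv' ->]]]].
  by exists 0, 0; rewrite addr0; split=> //; apply: submod0.
exists (a *: u + u'), (a *: v + v'); split; [exact: (proj2 sX)|exact: (proj2 sY)|].
by rewrite scalerDr addrACA.
Qed.

Lemma submodule_image (A : nzRingType) (M N : lmodType A) (f : {linear M -> N})
    (X : M -> Prop) :
  submodule X -> submodule (fun y => exists2 x, X x & y = f x).
Proof.
move=> sX; split=> [|a _ _ [x Xx ->] [x' Xx' ->]].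
  by exists 0; rewrite ?raddf0 //; apply: submod0.
by exists (a *: x + x'); [exact: (proj2 sX)|rewrite linearP].
Qed.

Section Rank.
Variable A : idomainType.
Implicit Types M : lmodType A.

(** The pair [X], [Y] stands for the subquotient [X] modulo [Y], without a quotient type: the
    filtrations used later are chains of predicates on one ambient module. *)
Definition indep M (X Y : M -> Prop) (T : finType) (e : T -> M) : Prop :=
  (forall i, X (e i)) /\
  (forall c : T -> A, Y (\sum_i c i *: e i) -> forall i, c i = 0).

(** Spanning up to torsion. Together with [indep] this makes [has_rank] the dimension over the
    fraction field, without forming that field. *)
Definition tspan M (X Y : M -> Prop) (T : finType) (e : T -> M) : Prop :=
  forall x, X x -> exists a (c : T -> A), a != 0 /\ Y (a *: x - \sum_i c i *: e i).

Definition has_rank M (X Y : M -> Prop) (r : nat) : Prop :=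
  exists (T : finType) (e : T -> M), [/\ #|T| = r, indep X Y e & tspan X Y e].

(** Fraction-free Gaussian elimination by induction on the columns. A zero last column is dropped;
    otherwise a row [i0] with nonzero last entry is the pivot, and [C1] clears that column from the
    other rows by cross-multiplication instead of division. *)
Lemma row_relation m n (C : 'M[A]_(m, n)) : (n < m)%N ->
  exists2 v : 'rV[A]_m, v != 0 & v *m C = 0.
Proof.
elim: n m C => [|n IHn] m C ltnm.
  case: m C ltnm => // m C _; exists (const_mx 1).
    by apply/eqP => /rowP/(_ 0) /eqP; rewrite !mxE oner_eq0.
  by apply/matrixP => i [].
case: m C ltnm => // m C ltnm.
have [C0|[i0 Ci0]] : (forall i, C i ord_max = 0) \/ exists i0, C i0 ord_max != 0.
  case: (pselect (exists i0, C i0 ord_max != 0)) => [|h]; [by right|left=> i].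
  by apply/eqP/negPn/negP => Ci; apply: h; exists i.
- have [v v0 vC] := IHn m.+1 (col' ord_max C) (ltnW ltnm).
  exists v => //; apply/rowP => j; rewrite !mxE.
  have [k ->|->] := unliftP ord_max j.
    have /rowP/(_ k) := vC; rewrite !mxE => vCk.
    by rewrite -[RHS]vCk; apply: eq_bigr => i _; rewrite !mxE.
  by rewrite big1 // => i _; rewrite C0 mulr0.
- pose C1 : 'M_(m, n) := \matrix_(i, j) (C i0 ord_max * C (lift i0 i) (lift ord_max j)
      - C (lift i0 i) ord_max * C i0 (lift ord_max j)).
  have [v v0 vC] := IHn m C1 ltnm.
  (* [w] is [v] transported back through the row operations; its entry at the pivot is the one that
     cancels the last column. *)
  pose w : 'rV_m.+1 := \row_i if unlift i0 i is Some k then C i0 ord_max * v 0 k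
      else - \sum_k v 0 k * C (lift i0 k) ord_max.
  have wC j : (w *m C) 0 j = \sum_k v 0 k * (C i0 ord_max * C (lift i0 k) j -
      C (lift i0 k) ord_max * C i0 j).
    rewrite !mxE (bigD1 i0) //= mxE unlift_none mulNr mulr_suml.
    rewrite (reindex_omap (lift i0) (unlift i0)) /=; last first.
      by move=> i; case: unliftP => [k ->|->] //=; rewrite eqxx.
    under [RHS]eq_bigr do rewrite mulrBr; rewrite sumrB addrC; congr (_ - _).
      apply: eq_big => [k|k _]; first by rewrite liftK eqxx eq_sym neq_lift.
      by rewrite mxE liftK mulrCA mulrA.
    by apply: eq_bigr => k _; rewrite mulrA.
  exists w.
    apply: contraNneq v0 => w0; apply/eqP/rowP => k; apply/eqP.
    have /rowP/(_ (lift i0 k)) := w0; rewrite !mxE liftK => /eqP.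
    by rewrite mulf_eq0 (negPf Ci0).
  apply/rowP => j; rewrite wC mxE.
  have [k ->|->] := unliftP ord_max j; last first.
    by rewrite big1 // => k _; rewrite [_ * C i0 _]mulrC subrr mulr0.
  have /rowP/(_ k) := vC; rewrite !mxE => vCk; rewrite -[RHS]vCk.
  by apply: eq_bigr => i _; rewrite !mxE.
Qed.

(** If [f] were longer than [e], the coefficient rows of the [f j] would satisfy a relation; the
    denominators [(ac j).1] are nonzero, so it would be a nontrivial relation between the [f j]. *)
Lemma steinitz M (X Y : M -> Prop) (T T' : finType) (e : T -> M) (f : T' -> M) :
  submodule Y -> tspan X Y e -> indep X Y f -> (#|T'| <= #|T|)%N.
Proof.
move=> sY te [fX fI]; rewrite leqNgt; apply/negP => ltT.
have /choice[ac acP] j : exists ac : A * (T -> A),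
    ac.1 != 0 /\ Y (ac.1 *: f j - \sum_i ac.2 i *: e i).
  by have [a [c ?]] := te _ (fX j); exists (a, c).
pose C : 'M_(#|T'|, #|T|) := \matrix_(j, i) (ac (enum_val j)).2 (enum_val i).
have [v v0 vC] := row_relation C ltT.
have fv : Y (\sum_j (v 0 (enum_rank j) * (ac j).1) *: f j).
  apply: (submod_trans sY (y := \sum_j v 0 (enum_rank j) *: \sum_i (ac j).2 i *: e i)).
    rewrite -sumrB; apply: submod_sum => // j _.
    by rewrite -scalerA -scalerBr; apply: submodZ => //; apply: (acP j).2.
  rewrite (_ : \sum_j _ = 0); first exact: submod0.
  under eq_bigr do rewrite scaler_sumr.
  rewrite exchange_big big1 //= => i _.
  under eq_bigr do rewrite scalerA.
  rewrite -scaler_suml (_ : \sum_j _ = 0) ?scale0r //.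
  have /rowP/(_ (enum_rank i)) := vC; rewrite !mxE => vCi; rewrite -[RHS]vCi.
  rewrite [RHS](reindex_onto enum_rank enum_val) /=; last by move=> j _; rewrite enum_valK.
  apply: eq_big => [j|j _]; first by rewrite enum_rankK eqxx.
  by rewrite mxE !enum_rankK.
case/eqP: v0; apply/rowP => j; rewrite mxE; apply/eqP.
have /eqP := fI _ fv (enum_val j).
by rewrite enum_valK mulf_eq0 (negPf (acP _).1) orbF.
Qed.

Lemma has_rank_uniq M (X Y : M -> Prop) r s :
  submodule Y -> has_rank X Y r -> has_rank X Y s -> r = s.
Proof.
move=> sY [T [e [<- eI eS]]] [T' [e' [<- eI' eS']]]; apply/eqP.
by rewrite eqn_leq (steinitz sY eS' eI) (steinitz sY eS eI').
Qed.

Lemma indep_le_rank M (X Y : M -> Prop) r (T : finType) (e : T -> M) :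
  submodule Y -> has_rank X Y r -> indep X Y e -> (#|T| <= r)%N.
Proof. by move=> sY [T' [e' [<- _ eS']]]; apply: (steinitz sY eS'). Qed.

Lemma rank_le_tspan M (X Y : M -> Prop) r (T : finType) (e : T -> M) :
  submodule Y -> has_rank X Y r -> tspan X Y e -> (r <= #|T|)%N.
Proof. by move=> sY [T' [e' [<- eI _]]] te; apply: (steinitz sY te eI). Qed.

Lemma indep_extend M (X Y : M -> Prop) (T : finType) (e : T -> M) x :
  submodule Y -> indep X Y e -> X x ->
  ~ (exists a (c : T -> A), a != 0 /\ Y (a *: x - \sum_i c i *: e i)) ->
  indep X Y (oapp e x).
Proof.
move=> sY [eX eI] Xx nx; split=> [[i|]|c] //=.
have -> : \sum_i c i *: oapp e x i = c None *: x + \sum_i c (Some i) *: e i.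
  rewrite (bigD1 None) //=; congr (_ + _).
  rewrite (reindex_omap Some id) => [|[i|]] //=.
  by apply: eq_bigl => i; rewrite eqxx.
move=> Yc.
have c0 : c None = 0.
  apply/eqP/negPn/negP => c0; apply: nx; exists (c None), (fun i => - c (Some i)).
  split=> //; rewrite -sumrN; under eq_bigr do rewrite scaleNr opprK; exact: Yc.
rewrite c0 scale0r add0r in Yc.
by case=> [i|//]; apply: (eI (fun i => c (Some i)) Yc).
Qed.

(** A longest independent family spans up to torsion, since an element violating [tspan] would
    extend it. *)
Lemma has_rank_bounded M (X Y : M -> Prop) n : submodule Y ->
  (forall (T : finType) (e : T -> M), indep X Y e -> (#|T| <= n)%N) ->
  exists2 r, (r <= n)%N & has_rank X Y r.
Proof.
move=> sY bnd.
pose P m := `[< exists (T : finType) (e : T -> M), #|T| = m /\ indep X Y e >].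
have P0 : exists m, P m.
  exists 0%N; apply/asboolP; exists 'I_0, (fun=> 0); rewrite card_ord.
  by split=> //; split=> [[]|c _ []].
have Pn m : P m -> (m <= n)%N by move=> /asboolP[T [e [<-]]]; apply: bnd.
case: (ex_maxnP P0 Pn) => r /asboolP[T [e [Tr eI]]] rmax.
exists r; first by rewrite -Tr; apply: bnd eI.
exists T, e; split=> // x Xx; apply: contrapT => nx.
have /rmax : P r.+1.
  apply/asboolP; exists (option T), (oapp e x); rewrite card_option Tr.
  by split=> //; apply: indep_extend.
by rewrite ltnn.
Qed.

Lemma has_rank_sub M (X Y X' Y' : M -> Prop) r :
  submodule Y -> submodule Y' -> has_rank X Y r ->
  (forall x, X' x -> X x) -> (forall x, Y x -> Y' x) ->
  exists2 r', (r' <= r)%N & has_rank X' Y' r'.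
Proof.
move=> sY sY' rX X'X YY'; apply: has_rank_bounded => // T e [eX eI].
apply: (indep_le_rank sY rX); split=> [i|c Yc]; first exact: X'X.
by apply: eI; apply: YY'.
Qed.

Lemma has_rank_add M (X Y W : M -> Prop) r s :
  submodule W -> (forall x, Y x -> X x) -> (forall x, W x -> Y x) -> submodule Y ->
  has_rank X Y r -> has_rank Y W s -> has_rank X W (r + s).
Proof.
move=> sW YX WY sY [T [e [<- [eX eI] eS]]] [T' [f [<- [fY fI] fS]]].
pose g (i : T + T') := match i with inl i => e i | inr j => f j end.
have gE (c : T + T' -> A) : \sum_i c i *: g i =
    \sum_i c (inl i) *: e i + \sum_i c (inr i) *: f i.
  by rewrite big_sumType.
exists (T + T')%type, g; rewrite card_sum; split=> //.
- split=> [[i|j]|c]; [exact: eX|exact/YX/fY|rewrite gE => Wc].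
  have cl : forall i, c (inl i) = 0.
    apply: eI.
    have Yf : Y (\sum_i c (inr i) *: f i).
      by apply: submod_sum => // j _; apply: submodZ.
    by have := submodB sY (WY _ Wc) Yf; rewrite addrK.
  rewrite big1 ?add0r in Wc; last by move=> i _; rewrite cl scale0r.
  by case=> [i|j]; [apply: cl|apply: (fI (fun j => c (inr j)) Wc)].
- move=> x /eS[a [c [a0 Yc]]]; have [b [d [b0 Wd]]] := fS _ Yc.
  exists (b * a), (fun i => match i with inl i => b * c i | inr j => d j end).
  split; first by rewrite mulf_neq0.
  rewrite gE opprD addrA -scalerA.
  suff -> : \sum_i (b * c i) *: e i = b *: \sum_i c i *: e i by rewrite -scalerBr.
  by rewrite scaler_sumr; apply: eq_bigr => i _; rewrite scalerA.
Qed.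

(** The three conditions on [phi] say that it induces an isomorphism from [X] modulo [Y] onto [X']
    modulo [Y']. Nearly every comparison of ranks below is an instance. *)
Lemma has_rank_iso M M' (phi : {linear M -> M'}) (X Y : M -> Prop) (X' Y' : M' -> Prop) r :
  submodule X -> submodule Y' ->
  (forall x, X x -> X' (phi x)) -> (forall x, X x -> Y' (phi x) <-> Y x) ->
  (forall x', X' x' -> exists2 x, X x & Y' (x' - phi x)) ->
  has_rank X Y r <-> has_rank X' Y' r.
Proof.
move=> sX sY' XX' YY' X'X.
have lin (T : finType) (c : T -> A) (e : T -> M) :
    phi (\sum_i c i *: e i) = \sum_i c i *: phi (e i).
  by rewrite linear_sum; apply: eq_bigr => i _; rewrite linearZ.
have Xsum (T : finType) (c : T -> A) (e : T -> M) : (forall i, X (e i)) ->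
    X (\sum_i c i *: e i).
  by move=> eX; apply: submod_sum => // i _; apply: submodZ.
split=> [[T [e [Tr [eX eI] eS]]]|[T [e' [Tr [eX' eI'] eS']]]].
- exists T, (phi \o e); split=> //.
    split=> [i|c Yc] /=; first exact: XX'.
    by apply: eI; apply/YY'; [apply: Xsum|rewrite lin].
  move=> x' /X'X[x Xx xx']; have [a [c [a0 Yc]]] := eS x Xx.
  exists a, c; split=> //; rewrite -lin.
  apply: (submod_sub_trans sY' (y := a *: phi x)).
    by rewrite -scalerBr; apply: submodZ.
  rewrite -linearZ -linearB; apply/YY' => //.
  by apply: submodB => //; [apply: submodZ|apply: Xsum].
- have /choice[e eP] i : exists x, X x /\ Y' (e' i - phi x).
    by have [x] := X'X _ (eX' i); exists x.
  have eX i : X (e i) by case: (eP i).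
  have ee' c : Y' (\sum_i c i *: e' i - phi (\sum_i c i *: e i)).
    rewrite lin -sumrB; apply: submod_sum => // i _; rewrite -scalerBr.
    by apply: submodZ => //; case: (eP i).
  exists T, e; split=> //.
    split=> // c Yc; apply: eI'; apply: (submod_trans sY' (ee' c)).
    by apply/YY' => //; apply: Xsum.
  move=> x Xx; have [a [c [a0 Yc]]] := eS' _ (XX' _ Xx).
  exists a, c; split=> //; apply/YY'.
    by apply: submodB => //; [apply: submodZ|apply: Xsum].
  by rewrite linearB linearZ; apply: submod_sub_trans (ee' c).
Qed.

Lemma has_rank0 M (X Y : M -> Prop) : (forall x, X x -> Y x) -> has_rank X Y 0.
Proof.
move=> XY; exists 'I_0, (fun=> 0); rewrite card_ord; split=> //; first by split=> [[]|c _ []].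
move=> x /XY Yx; exists 1, (fun=> 0).
by rewrite oner_neq0 scale1r big_ord0 subr0.
Qed.

Definition finrk M (X Y : M -> Prop) : Prop := exists r, has_rank X Y r.

(** The value 0 for infinite rank is a placeholder, which is why [rk_add] assumes [finrk]. *)
Definition rk M (X Y : M -> Prop) : nat :=
  if pselect (finrk X Y) is left h then projT1 (cid h) else 0%N.

Lemma rk_has_rank M (X Y : M -> Prop) : finrk X Y -> has_rank X Y (rk X Y).
Proof. by rewrite /rk; case: pselect => // h _; apply: (projT2 (cid h)). Qed.

Lemma has_rank_rk M (X Y : M -> Prop) r : submodule Y -> has_rank X Y r -> rk X Y = r.
Proof. by move=> sY rX; apply: (has_rank_uniq sY _ rX); apply: rk_has_rank; exists r. Qed.

Lemma finrk_sub M (X Y X' Y' : M -> Prop) :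
  submodule Y -> submodule Y' ->
  (forall x, X' x -> X x) -> (forall x, Y x -> Y' x) -> finrk X Y -> finrk X' Y'.
Proof.
move=> sY sY' X'X YY' [r rX].
by have [r' _ ?] := has_rank_sub sY sY' rX X'X YY'; exists r'.
Qed.

Lemma rk_add M (X Y W : M -> Prop) :
  submodule Y -> submodule W -> (forall x, Y x -> X x) -> (forall x, W x -> Y x) ->
  finrk X W -> rk X W = (rk X Y + rk Y W)%N.
Proof.
move=> sY sW YX WY fX; apply: has_rank_rk => //.
by apply: (has_rank_add sW YX WY sY); apply: rk_has_rank;
  [apply: (finrk_sub sW sY _ WY fX)|apply: (finrk_sub sW sW YX _ fX)].
Qed.

Section RankIso.
Variables (M M' : lmodType A) (phi : {linear M -> M'}).
Variables (X Y : M -> Prop) (X' Y' : M' -> Prop).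
Hypotheses (sX : submodule X) (sY' : submodule Y').
Hypotheses (XX' : forall x, X x -> X' (phi x))
  (YY' : forall x, X x -> Y' (phi x) <-> Y x)
  (X'X : forall x', X' x' -> exists2 x, X x & Y' (x' - phi x)).

Lemma finrk_iso : finrk X Y <-> finrk X' Y'.
Proof. by split=> -[r /(has_rank_iso r sX sY' XX' YY' X'X) rX]; exists r. Qed.

Lemma rk_iso : rk X Y = rk X' Y'.
Proof.
case: (pselect (finrk X Y)) => [fX|nX].
  by apply/esym/has_rank_rk => //; apply/(has_rank_iso _ sX sY' XX' YY' X'X)/rk_has_rank.
rewrite /rk; case: pselect => // _; case: pselect => // fX.
by case: nX; apply/finrk_iso.
Qed.
End RankIso.

End Rank.

(** * p-adic integers and the Iwasawa algebra *)

Section PadicInt.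
Variables (p : nat) (p_pr : prime p).
Local Notation Zp := (padic_int p_pr).
Local Notation v := (@padic_val p p_pr).
Implicit Types x y : Zp.

Lemma padic_valD x y n : v (x + y) n = v x n + v y n. Proof. by []. Qed.
Lemma padic_valM x y n : v (x * y) n = v x n * v y n. Proof. by []. Qed.
Lemma padic_valMn x k n : v (x *+ k) n = v x n *+ k.
Proof. by elim: k => // k IHk; rewrite !mulrS padic_valD IHk. Qed.
Lemma padic_val_nat k n : v k%:R n = k%:R. Proof. exact: padic_valMn. Qed.

Lemma padic_val_pexp k n : (n < k)%N -> v (p%:R ^+ k) n = 0.
Proof.
move=> ltnk; rewrite -natrX padic_val_nat -(subnK ltnk) expnD natrM.
by rewrite (pchar_Zp (padic_pow_gt1 p_pr n)) mulr0.
Qed.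

Lemma padic_separated x : (forall k, exists y, x = p%:R ^+ k * y) -> x = 0.
Proof.
move=> px; apply: padicP => n; have [y ->] := px n.+1.
by rewrite padic_valM padic_val_pexp // mul0r.
Qed.

Lemma padic_unit_val0 x : v x 0%N != 0 -> x \is a GRing.unit.
Proof.
move=> x0.
have cop n : coprime (p ^ n.+1) (v x n).
  rewrite coprime_pexpl // prime_coprime //; apply: contra x0.
  rewrite -{1}[p]expn1 /dvdn => /eqP xn0; apply/eqP/val_inj.
  by rewrite /= -(padic_val_mod x 0 n) add0n.
have xU n : v x n \is a GRing.unit.
  by rewrite -[v x n]natr_Zp unitZpE ?padic_pow_gt1.
have yP : padic_compat (fun n => (v x n)^-1).
  apply/asboolP => n; rewrite -/(padic_red _).
  have h : v x n * padic_red ((v x n.+1)^-1) = 1.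
    by rewrite -{1}(padic_valS x n) -(padic_redM p_pr) divrr ?xU // (padic_red_nat p_pr n 1).
  by rewrite -[LHS](mulKr (xU n)) h mulr1.
apply/unitrP; exists (PadicInt p_pr yP).
by split; apply: padicP => n; rewrite padic_valM /= ?(mulVr (xU n)) ?(divrr (xU n)).
Qed.

Lemma padic_div_val0 x : v x 0%N = 0 -> exists y, x = p%:R * y.
Proof.
move=> x0.
have px n : (p %| v x n)%N.
  suff : (p ^ 1 %| v x n)%N by rewrite expn1.
  by rewrite /dvdn; have := padic_val_mod x 0 n; rewrite add0n x0 => ->.
(* Dividing by [p] loses one digit, so level [n] of the quotient is read off level [n.+1] of [x]. *)
have yP : padic_compat (fun n => (v x n.+1 %/ p)%:R : 'Z_(p ^ n.+1)).
  apply/asboolP => n; rewrite -/(padic_red _) (padic_red_nat p_pr).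
  rewrite -(padic_val_mod x n.+1 1) addn1.
  by rewrite (expnSr p n.+1) -modn_divl Zp_nat_mod ?padic_pow_gt1.
exists (PadicInt p_pr yP); apply: padicP => n.
by rewrite padic_valM padic_val_nat /= -natrM mulnC divnK // -(padic_valS x n).
Qed.

Lemma padic_unit_or_div x : x \is a GRing.unit \/ exists y, x = p%:R * y.
Proof.
have [x0|x0] := eqVneq (v x 0%N) 0; first by right; apply: padic_div_val0.
by left; apply: padic_unit_val0.
Qed.

Lemma padic_p_nonunit x : 1 != p%:R * x :> Zp.
Proof.
apply/eqP => /(congr1 (fun y => v y 0%N)); rewrite padic_valM padic_val_nat.
have -> : p%:R = 0 :> 'Z_(p ^ 1) by have := pchar_Zp (padic_pow_gt1 p_pr 0); rewrite expn1.
by rewrite mul0r => /eqP; rewrite oner_eq0.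
Qed.

Lemma padic_p_neq0 : p%:R != 0 :> Zp.
Proof.
apply/eqP => /(congr1 (fun y => v y 1%N)); rewrite padic_val_nat => /(congr1 val) /=.
rewrite val_Zp_nat ?padic_pow_gt1 // => /eqP.
rewrite -/(dvdn _ _) => /(dvdn_leq (prime_gt0 p_pr)).
by rewrite leqNgt !expnS expn0 muln1 ltn_Pmull ?prime_gt0 ?prime_gt1.
Qed.

Lemma padic_valuation x : x != 0 ->
  exists k u, u \is a GRing.unit /\ x = p%:R ^+ k * u.
Proof.
move=> x0; apply: contrapT => nx; case/eqP: x0; apply: padic_separated.
elim=> [|k [y xy]]; first by exists x; rewrite mul1r.
have [yU|[z yz]] := padic_unit_or_div y; first by case: nx; exists k, y.
by exists z; rewrite xy yz mulrA exprSr.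
Qed.

Lemma padic_prime x y z : x * y = p%:R * z ->
  (exists x', x = p%:R * x') \/ exists y', y = p%:R * y'.
Proof.
move=> xy; have [xU|] := padic_unit_or_div x; last by left.
by right; exists (x^-1 * z); rewrite mulrCA -xy mulKr.
Qed.

(** The convergent series of the [p ^ m * f m]: level [n] is taken modulo [p ^ n.+1], where only the
    terms with [m <= n] survive. *)
Lemma padic_series_compat (f : nat -> Zp) :
  padic_compat (fun n => \sum_(m < n.+1) p%:R ^+ m * v (f m) n).
Proof.
apply/asboolP => n; rewrite -/(padic_red _) (big_morph _ (padic_redD p_pr (n := n)) (padic_red_nat p_pr n 0)).
rewrite big_ord_recr /= -!natrX (padic_redM p_pr) (padic_red_nat p_pr) natrX.
have -> : p%:R ^+ n.+1 = 0 :> 'Z_(p ^ n.+1).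
  by rewrite -natrX (pchar_Zp (padic_pow_gt1 p_pr n)).
rewrite mul0r addr0; apply: eq_bigr => m _.
by rewrite -natrX (padic_redM p_pr) (padic_red_nat p_pr) padic_valS natrX.
Qed.

Definition padic_series f : Zp := PadicInt p_pr (padic_series_compat f).

Lemma padic_seriesE f : padic_series f = f 0%N + p%:R * padic_series (f \o S).
Proof.
apply: padicP => n; rewrite padic_valD padic_valM padic_val_nat /=.
rewrite big_ord_recl expr0 mul1r; congr (_ + _); rewrite mulr_sumr.
rewrite [RHS]big_ord_recr /= mulrA -exprS.
have -> : p%:R ^+ n.+1 = 0 :> 'Z_(p ^ n.+1).
  by rewrite -natrX (pchar_Zp (padic_pow_gt1 p_pr n)).
by rewrite mul0r addr0; apply: eq_bigr => m _; rewrite mulrA -exprS.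
Qed.
End PadicInt.

Section PowSer.
Variable R : comNzRingType.
Local Notation PS := (powser R).
Implicit Types f g : PS.

Lemma pcoefD f g n : pcoef (f + g) n = pcoef f n + pcoef g n. Proof. by []. Qed.
Lemma pcoef_sum (T : Type) (s : seq T) (P : pred T) (F : T -> PS) n :
  pcoef (\sum_(i <- s | P i) F i) n = \sum_(i <- s | P i) pcoef (F i) n.
Proof. by apply: (big_morph (fun f => pcoef f n)) => // f g; rewrite pcoefD. Qed.

Lemma pcoef_const_mul (c : R) f n : pcoef (ps_const c * f) n = c * pcoef f n.
Proof.
rewrite pcoefM big_ord_recl /= subn0 big1 ?addr0 // => i _.
by rewrite mul0r.
Qed.

Lemma pcoef_natmul k f n : pcoef (k%:R * f) n = k%:R * pcoef f n.
Proof. by rewrite -(rmorph_nat (@ps_const R)) pcoef_const_mul. Qed.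

Definition psX : PS := PowSer (fun n => (n == 1%N)%:R).

Lemma pcoefX_mul f n : pcoef (psX * f) n = if n is m.+1 then pcoef f m else 0.
Proof.
rewrite pcoefM; case: n => [|n]; first by rewrite big_ord1 mul0r.
rewrite big_ord_recl mul0r add0r big_ord_recl /= mul1r subSS subn0 big1 ?addr0 //.
by move=> i _; rewrite mul0r.
Qed.

Lemma pcoefXn_mul k f n : pcoef (psX ^+ k * f) n = if (k <= n)%N then pcoef f (n - k) else 0.
Proof.
elim: k n => [|k IHk] n; first by rewrite mul1r subn0.
by rewrite exprS -mulrA pcoefX_mul; case: n => [|n] //; rewrite IHk.
Qed.

Lemma psX_separated f : (forall k, exists g, f = psX ^+ k * g) -> f = 0.
Proof.
by move=> fX; apply: powserP => n; have [g ->] := fX n.+1; rewrite pcoefXn_mul ltnn.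
Qed.

(** Gauss's lemma for a prime ideal [Q]: modulo [Q], the product of the lowest coefficients of [f]
    and [g] outside [Q] is the coefficient of [f * g] in the sum of their degrees. With [Q]
    generated by [p] it shows that [p] is prime among the power series, with [Q] zero that they form
    a domain. *)
Lemma ps_mul_lowest (Q : R -> Prop) f g :
  Q 0 -> (forall a b, Q a -> Q b -> Q (a - b)) -> (forall a b, Q a -> Q (a * b)) ->
  (forall a b, Q (a * b) -> Q a \/ Q b) ->
  (exists i, ~ Q (pcoef f i)) -> (exists j, ~ Q (pcoef g j)) ->
  exists n, ~ Q (pcoef (f * g) n).
Proof.
move=> Q0 QB QM Qprime [i0 fi0] [j0 gj0].
have low h k : ~ Q (pcoef h k) ->
    exists2 i, ~ Q (pcoef h i) & forall j, (j < i)%N -> Q (pcoef h j).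
  move=> hk; have ex : exists k, `[< ~ Q (pcoef h k) >] by exists k; apply/asboolP.
  case: (ex_minnP ex) => i /asboolP hi imin; exists i => // j ltji.
  by apply: contrapT => hj; have /imin := asboolT hj; rewrite leqNgt ltji.
have [i fi fmin] := low f _ fi0; have [j gj gmin] := low g _ gj0.
exists (i + j)%N => Qfg; have lti : (i < (i + j).+1)%N by rewrite ltnS leq_addr.
have QS (T : finType) (P : pred T) (F : T -> R) :
    (forall k, P k -> Q (F k)) -> Q (\sum_(k | P k) F k).
  move=> QF; apply: (big_ind Q) => // a b Qa Qb.
  by rewrite -[b]opprK; apply: (QB) => //; rewrite -[- b]add0r; apply: (QB).
suff /Qprime[] : Q (pcoef f i * pcoef g j) by [].
have -> : pcoef f i * pcoef g j = pcoef (f * g) (i + j) -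
    \sum_(k < (i + j).+1 | k != Ordinal lti) pcoef f k * pcoef g (i + j - k).
  by rewrite pcoefM (bigD1 (Ordinal lti)) //= addrK addKn.
apply: QB => //; apply: QS => k ki.
have [ltki|] := ltnP k i; first exact/QM/fmin.
rewrite leq_eqVlt => /orP[/eqP eik|ltik].
  by case/eqP: ki; apply: val_inj.
rewrite mulrC; apply/QM/gmin; have := ltn_ord k; rewrite ltnS => lek.
by rewrite ltn_subLR ?ltn_add2r.
Qed.

(** Long division from the lowest degree: [step] removes the multiple of [w] with the right constant
    term and divides the rest by the variable. The constant terms met on the way, times [c], are the
    coefficients of the quotient, and [y - w * q] is divisible by every power of the variable. *)
Lemma ps_unit_const_div (w y : PS) (c : R) :
  pcoef w 0 * c = 1 -> exists q, y = w * q.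
Proof.
move=> wc; pose step z : PS := PowSer (fun n => pcoef (z - w * ps_const (c * pcoef z 0)) n.+1).
have stepE z : z = w * ps_const (c * pcoef z 0) + psX * step z.
  apply: powserP => -[|n]; rewrite pcoefD pcoefX_mul.
    by rewrite pcoefM big_ord1 /= mulrA wc mul1r addr0.
  by rewrite [pcoef (step z) n]/= -/(ps_opp _) addrC subrK.
pose q k : PS := PowSer (fun j => c * pcoef (iter (k + j) step y) 0).
have qE k : q k = ps_const (c * pcoef (iter k step y) 0) + psX * q k.+1.
  apply: powserP => -[|n]; rewrite pcoefD pcoefX_mul /= ?addn0 ?addr0 //.
  by rewrite add0r addnS.
exists (q 0%N); apply/eqP; rewrite -subr_eq0; apply/eqP/psX_separated => k.
exists (iter k step y - w * q k).
elim: k => [|k IHk]; first by rewrite mul1r.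
rewrite IHk exprSr -mulrA; congr (_ * _).
rewrite [in LHS](stepE (iter k step y)) (qE k) mulrDr opprD addrACA subrr add0r.
by rewrite mulrBr [w * (_ * _)]mulrCA.
Qed.

End PowSer.

Section IwasawaAlgebra.
Variables (p : nat) (p_pr : prime p).
Local Notation Zp := (padic_int p_pr).
Local Notation S := (powser Zp).
Implicit Types f g x : S.

Definition pdvd f : Prop := exists f', f = p%:R * f'.

Lemma pdvdP f : pdvd f <-> forall n, exists y, pcoef f n = p%:R * y.
Proof.
split=> [[f' ->] n|/choice[y yP]]; first by exists (pcoef f' n); rewrite pcoef_natmul.
by exists (PowSer y); apply: powserP => n; rewrite pcoef_natmul.
Qed.

Lemma pdvd_add f g : pdvd f -> pdvd g -> pdvd (f + g).
Proof. by move=> [f' ->] [g' ->]; exists (f' + g'); rewrite mulrDr. Qed.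
Lemma pdvd_mull f g : pdvd g -> pdvd (f * g).
Proof. by move=> [g' ->]; exists (f * g'); rewrite mulrCA. Qed.

Lemma not_pdvd_coef f : ~ pdvd f -> exists n, ~ exists y, pcoef f n = p%:R * y.
Proof.
by move=> nf; apply: contrapT => h; apply/nf/pdvdP => n; apply: contrapT => fn; apply: h; exists n.
Qed.

Lemma not_pdvd_mul f g : ~ pdvd f -> ~ pdvd g -> ~ pdvd (f * g).
Proof.
move=> /not_pdvd_coef nf /not_pdvd_coef ng /pdvdP fg.
have [] := ps_mul_lowest (Q := fun c => exists y, c = p%:R * y) _ _ _ _ nf ng.
- by exists 0; rewrite mulr0.
- by move=> _ _ [a ->] [b ->]; exists (a - b); rewrite mulrBr.
- by move=> _ b [a ->]; exists (a * b); rewrite mulrA.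
- by move=> a b [z /padic_prime].
- by move=> n; apply.
Qed.

Lemma not_pdvd1 : ~ pdvd 1.
Proof.
move=> [f /(congr1 (fun f => pcoef f 0))]; rewrite pcoef_natmul => /eqP.
by apply/negP; apply: padic_p_nonunit.
Qed.

Lemma not_pdvd_exp f k : ~ pdvd f -> ~ pdvd (f ^+ k).
Proof.
by move=> nf; elim: k => [|k IHk]; [apply: not_pdvd1|rewrite exprS; apply: not_pdvd_mul].
Qed.

Lemma ps_p_inj f : p%:R * f = 0 -> f = 0.
Proof.
move=> pf; apply: powserP => n; apply/eqP.
have /eqP := congr1 (fun f => pcoef f n) pf.
by rewrite pcoef_natmul mulf_eq0 (negPf (padic_p_neq0 p_pr)).
Qed.

Lemma not_pdvd_inj f x : ~ pdvd f -> f * x = 0 -> x = 0.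
Proof.
move=> nf fx; apply: contrapT => x0.
have [] := ps_mul_lowest (Q := fun c : Zp => c = 0) (f := f) (g := x).
- by [].
- by move=> a b -> ->; rewrite subr0.
- by move=> a b ->; rewrite mul0r.
- by move=> a b /eqP; rewrite mulf_eq0 => /orP[]/eqP; [left|right].
- apply: contrapT => h; apply: nf; exists 0; rewrite mulr0; apply: powserP => n.
  by apply: contrapT => fn; apply: h; exists n.
- apply: contrapT => h; apply: x0; apply: powserP => n.
  by apply: contrapT => xn; apply: h; exists n.
- by move=> n; rewrite fx.
Qed.

(** [d] is the Weierstrass degree, the first degree in which the coefficient of [g] is a unit.
    Modulo [p], [g] is the [d]-th power of the variable times a series [w] with unit constant term,
    so that dividing [x] by [g] amounts to dividing by [w] the part of [x] from degree [d] on. *)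
Lemma weierstrass_mod_p g : ~ pdvd g -> exists d, forall x,
  exists (c : 'I_d -> Zp) q y,
    x = \sum_i ps_const (c i) * psX _ ^+ i + g * q + p%:R * y.
Proof.
move=> /not_pdvd_coef[n0 gn0].
have ex : exists n, `[< ~ exists y, pcoef g n = p%:R * y >] by exists n0; apply/asboolP.
case: (ex_minnP ex) => d /asboolP gd dmin.
have gU : pcoef g d \is a GRing.unit by case: (padic_unit_or_div (pcoef g d)).
have /choice[a aP] n : exists y, (n < d)%N -> pcoef g n = p%:R * y.
  have [nd|dn] := ltnP n d; last by exists 0.
  have [y yE] : exists y, pcoef g n = p%:R * y; last by exists y.
  by apply: contrapT => h; have /dmin := asboolT h; rewrite leqNgt nd.
pose w : S := PowSer (fun n => pcoef g (n + d)).
pose ga : S := PowSer (fun n => if (n < d)%N then a n else 0).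
have gE : g = p%:R * ga + psX _ ^+ d * w.
  apply: powserP => n; rewrite pcoefD pcoef_natmul pcoefXn_mul /=.
  have [nd|dn] := ltnP n d; first by rewrite addr0 aP.
  by rewrite mulr0 add0r subnK.
exists d => x.
pose xh : S := PowSer (fun n => pcoef x (n + d)).
have [q qE] : exists q, xh = w * q.
  by apply: (@ps_unit_const_div _ w xh (pcoef g d)^-1); rewrite /= add0n divrr.
exists (fun i => pcoef x i), q, (- (ga * q)).
have -> : g * q = p%:R * (ga * q) + psX _ ^+ d * xh by rewrite {1}gE mulrDl -!mulrA -qE.
rewrite mulrN [p%:R * _ + _]addrC addrA addrK.
apply: powserP => n; rewrite pcoefD pcoef_sum pcoefXn_mul [pcoef xh _]/=.
have cE (i : 'I_d) : pcoef (ps_const (pcoef x i) * psX _ ^+ i) n = if i == n :> nat then pcoef x n else 0.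
  rewrite pcoef_const_mul -[psX _ ^+ i]mulr1 pcoefXn_mul.
  case: leqP => [|ltni]; last by rewrite mulr0 gtn_eqF.
  rewrite leq_eqVlt => /orP[/eqP <-|ltin]; first by rewrite subnn eqxx mulr1.
  by rewrite (ltn_eqF ltin) -(subnSK ltin) /= mulr0.
under eq_bigr do rewrite cE.
have [dn|nd] := leqP d n.
  by rewrite subnK // big1 ?add0r // => i _; rewrite ltn_eqF // (leq_trans _ dn).
rewrite addr0 (bigD1 (Ordinal nd)) //= eqxx big1 ?addr0 // => i.
by rewrite -val_eqE /= => /negPf ->.
Qed.

(* The p-adic limit of iterating the division modulo [p]. *)
Lemma weierstrass_division g : ~ pdvd g -> exists d, forall x,
  exists (c : 'I_d -> Zp) q, x = \sum_i ps_const (c i) * psX _ ^+ i + g * q.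
Proof.
move=> /weierstrass_mod_p[d dP]; exists d => x.
have /choice[s sP] z : exists t : ('I_d -> Zp) * S * S,
    z = \sum_i ps_const (t.1.1 i) * psX _ ^+ i + g * t.1.2 + p%:R * t.2.
  by have [c [q [y ?]]] := dP z; exists (c, q, y).
pose z k := iter k (fun z => (s z).2) x.
pose c k i := padic_series (fun j => (s (z (k + j)%N)).1.1 i).
pose q k : S := PowSer (fun n => padic_series (fun j => pcoef (s (z (k + j)%N)).1.2 n)).
have shiftE (F : nat -> Zp) k : padic_series (fun j => F (k + j)%N) =
    F k + p%:R * padic_series (fun j => F (k.+1 + j)%N).
  rewrite padic_seriesE addn0; congr (_ + _ * padic_series _).
  by apply/funext => j /=; rewrite addnS.
have cE k i : ps_const (c k i) = ps_const ((s (z k)).1.1 i) + p%:R * ps_const (c k.+1 i).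
  rewrite /c (shiftE (fun k => (s (z k)).1.1 i)) rmorphD rmorphM /=.
  by rewrite (rmorph_nat (@ps_const Zp)).
have qE k : q k = (s (z k)).1.2 + p%:R * q k.+1.
  apply: powserP => n; rewrite pcoefD pcoef_natmul.
  exact: (shiftE (fun k => pcoef (s (z k)).1.2 n)).
pose r k := \sum_i ps_const (c k i) * psX _ ^+ i.
exists (c 0%N), (q 0%N); apply/eqP; rewrite -subr_eq0; apply/eqP.
have DE k : x - (r 0%N + g * q 0%N) = p%:R ^+ k * (z k - (r k + g * q k)).
  elim: k => [|k IHk]; first by rewrite mul1r.
  rewrite IHk exprSr -mulrA; congr (_ * _).
  rewrite [in LHS](sP (z k)) (qE k) /r.
  under [X in _ - (X + _)]eq_bigr do rewrite cE mulrDl -mulrA.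
  rewrite big_split /= -mulr_sumr [g * (_ + _)]mulrDr [g * (p%:R * _)]mulrCA.
  rewrite addrACA opprD addrACA subrr add0r -mulrDr -mulrBr.
  by [].
apply: powserP => n; apply: padic_separated => k.
exists (pcoef (z k - (r k + g * q k)) n).
by rewrite -/(r 0%N) (DE k) -natrX pcoef_natmul natrX.
Qed.

End IwasawaAlgebra.

(** The determinant trick modulo [N]: a matrix [B] expresses [u] on the [e i], which may satisfy
    relations, and the characteristic polynomial of [B] kills [B]. *)
Lemma cayley_hamilton_gen (A : comNzRingType) (M : lmodType A) (N : M -> Prop)
    (u : {linear M -> M}) n (e : 'I_n -> M) :
  submodule N -> (forall x, N x -> N (u x)) ->
  (forall i, exists c : 'I_n -> A, N (u (e i) - \sum_j c j *: e j)) ->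
  exists2 q : {poly A}, q \is monic &
    forall i, N (\sum_(j < size q) q`_j *: iter j u (e i)).
Proof.
case: n e => [|n] e sN uN.
  by exists 1; [exact: monic1|case].
move=> /choice[c cP]; pose B : 'M_n.+1 := \matrix_(i, j) c i j.
exists (char_poly B); first exact: char_poly_monic.
have pow j i : N (iter j u (e i) - \sum_k (B ^+ j) i k *: e k).
  elim: j => [|j IHj].
    rewrite (bigD1 i) //= mxE eqxx scale1r big1 ?addr0 ?subrr; first exact: submod0.
    by move=> k /negPf ki; rewrite mxE eq_sym ki scale0r.
  apply: (submod_sub_trans sN (y := u (\sum_k (B ^+ j) i k *: e k))).
    by rewrite iterS -linearB; apply: uN.
  have -> : \sum_k (B ^+ j.+1) i k *: e k = \sum_k (B ^+ j) i k *: \sum_l B k l *: e l.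
    under [RHS]eq_bigr do rewrite scaler_sumr; rewrite [RHS]exchange_big /=.
    apply: eq_bigr => k _; rewrite exprSr mxE scaler_suml.
    by apply: eq_bigr => l _; rewrite scalerA.
  rewrite linear_sum -sumrB; apply: submod_sum => // k _.
  rewrite linearZ -scalerBr; apply: submodZ => //.
  by under eq_bigr do rewrite mxE; apply: cP.
move=> i; set q := char_poly B.
apply: (submod_trans sN (y := \sum_(j < size q) q`_j *: \sum_k (B ^+ j) i k *: e k)).
  by rewrite -sumrB; apply: submod_sum => // j _; rewrite -scalerBr; apply: submodZ.
rewrite (_ : \sum_j _ = 0); first exact: submod0.
under eq_bigr do rewrite scaler_sumr; rewrite exchange_big big1 //= => k _.
under eq_bigr do rewrite scalerA; rewrite -scaler_suml.
rewrite (_ : \sum_j _ = horner_mx B q i k); first by rewrite Cayley_Hamilton mxE scale0r.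
rewrite -[in RHS](coefK q) poly_def rmorph_sum summxE; apply: eq_bigr => j _.
by rewrite -mul_polyC rmorphM rmorphXn /= horner_mx_C horner_mx_X -mulmxE mul_scalar_mx mxE.
Qed.

(** * Finitely generated modules over the p-adic integers *)

Section FinitelyGenerated.
Variables (p : nat) (p_pr : prime p).
Local Notation Zp := (padic_int p_pr).
Implicit Types M : lmodType Zp.

Definition gspan M (X Y : M -> Prop) (T : finType) (e : T -> M) : Prop :=
  forall x, X x -> exists c : T -> Zp, Y (x - \sum_i c i *: e i).

Definition fgen M (X Y : M -> Prop) : Prop :=
  exists (T : finType) (e : T -> M), (forall i, X (e i)) /\ gspan X Y e.

Lemma gspan_ord M (X Y : M -> Prop) (T : finType) (e : T -> M) :
  gspan X Y e -> gspan X Y (fun i : 'I_#|T| => e (enum_val i)).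
Proof.
move=> eS x /eS[c cP]; exists (fun i => c (enum_val i)).
rewrite (_ : \sum_i _ = \sum_i c i *: e i) //.
rewrite [RHS](reindex_onto enum_val enum_rank) /=; last by move=> j _; rewrite enum_rankK.
by apply: eq_bigl => j; rewrite enum_valK eqxx.
Qed.

Lemma gspan_tspan M (X Y : M -> Prop) (T : finType) (e : T -> M) :
  gspan X Y e -> tspan X Y e.
Proof. by move=> eS x /eS[c cP]; exists 1, c; rewrite oner_neq0 scale1r. Qed.

Lemma gspan_finrk M (X Y : M -> Prop) (T : finType) (e : T -> M) :
  submodule Y -> gspan X Y e -> finrk X Y.
Proof.
move=> sY /gspan_tspan eS.
have [r _ rX] := has_rank_bounded sY (fun T' f => steinitz sY eS (f := f)).
by exists r.
Qed.

Lemma fgen_finrk M (X Y : M -> Prop) : submodule Y -> fgen X Y -> finrk X Y.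
Proof. by move=> sY [T [e [_]]]; apply: gspan_finrk. Qed.

(** An element of least valuation divides all the others. *)
Lemma padic_ideal_principal (J : Zp -> Prop) : J 0 ->
  exists2 a0, J a0 & forall a, J a -> exists b, a = b * a0.
Proof.
move=> J0; case: (pselect (exists a, J a /\ a != 0)) => [[a [Ja a0]]|nJ]; last first.
  exists 0 => // a Ja; exists 0; rewrite mulr0; apply/eqP/negPn/negP => a0.
  by apply: nJ; exists a.
pose P k := `[< exists u, u \is a GRing.unit /\ J (p%:R ^+ k * u) >].
have exP : exists k, P k.
  have [k [u [uU aE]]] := padic_valuation a0.
  by exists k; apply/asboolP; exists u; rewrite -aE.
case: (ex_minnP exP) => k /asboolP[u [uU Ju]] kmin; exists (p%:R ^+ k * u) => // b Jb.
have [->|b0] := eqVneq b 0; first by exists 0; rewrite mul0r.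
have [l [w [wU bE]]] := padic_valuation b0.
have /kmin lekl : P l by apply/asboolP; exists w; rewrite -bE.
exists (p%:R ^+ (l - k) * w * u^-1); rewrite bE mulrCA mulrA -!mulrA mulVr // mulr1.
by rewrite mulrA -exprD subnKC.
Qed.

(** Noetherianity of [Zp]: the family [e] may lie outside [X], and generators inside [X] are sought.
    Among the coefficients at the first [e] of elements of [X], one divides all the others; it is
    attained at some [x0]. Subtracting multiples of [x0] leads into [X'], which is spanned by the
    remaining [e]. *)
Lemma fgen_gspan M (X Y : M -> Prop) (T : finType) (e : T -> M) :
  submodule X -> submodule Y -> (forall x, Y x -> X x) -> gspan X Y e -> fgen X Y.
Proof.
move=> sX sY YX /gspan_ord; move: (fun i => _); move: #|T| => n {T}e.
elim: n e X sX YX => [|n IHn] e X sX YX eS.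
  exists 'I_0, (fun=> 0); split=> [[]//|x /eS[c]].
  by rewrite big_ord0 => Yx; exists (fun=> 0); rewrite big_ord0.
pose J a := exists c : 'I_n -> Zp, X (a *: e ord0 + \sum_i c i *: e (lift ord0 i)).
have [|a0 [c0 Xx0] a0P] := @padic_ideal_principal J.
  exists (fun=> 0); rewrite scale0r add0r big1; first exact: submod0.
  by move=> i _; rewrite scale0r.
move: Xx0; set x0 := _ + _ => Xx0.
pose e' i := e (lift ord0 i).
pose X' x := X x /\ exists c : 'I_n -> Zp, Y (x - \sum_i c i *: e' i).
have sX' : submodule X'.
  split=> [|a x y [Xx [c cP]] [Xy [d dP]]].
    split; first exact: submod0.
    by exists (fun=> 0); rewrite big1 ?subr0 => [|i _]; [exact: submod0|rewrite scale0r].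
  split; first exact: (proj2 sX).
  exists (fun i => a * c i + d i).
  under eq_bigr do rewrite scalerDl -scalerA.
  rewrite big_split -scaler_sumr /= opprD addrACA -scalerBr.
  exact: (proj2 sY).
have YX' x : Y x -> X' x.
  move=> Yx; split; first exact: YX.
  by exists (fun=> 0); rewrite big1 ?subr0 // => i _; rewrite scale0r.
have [|T [f [fX' fS]]] := IHn e' X' sX' YX'; first by move=> x [].
exists (option T), (oapp f x0); split=> [[i|] //=|x Xx]; first by case: (fX' i).
have [c cP] := eS x Xx.
have [b bE] : exists b, c ord0 = b * a0.
  apply: a0P; exists (fun i => c (lift ord0 i)).
  apply: (submod_trans sX _ Xx); apply: submod_subC => //; apply: YX.
  by move: cP; rewrite big_ord_recl.
have X'x : X' (x - b *: x0).
  split; first by apply: submodB => //; apply: submodZ.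
  exists (fun i => c (lift ord0 i) - b * c0 i).
  move: cP; rewrite big_ord_recl bE; congr (Y _).
  under [in RHS]eq_bigr do rewrite scalerBl -scalerA.
  rewrite sumrB -scaler_sumr /x0 scalerDr scalerA [in RHS]opprB.
  by rewrite [- (_ + b *: _)]opprD [x + (- _ + _)]addrA subrKA opprD addrA.
have [d dP] := fS _ X'x.
exists (oapp d b).
rewrite (bigD1 None) //= opprD addrA.
rewrite (reindex_omap Some id) => [|[i|]] //=.
rewrite (eq_bigl xpredT) // => i; by rewrite eqxx.
Qed.

Lemma fgen_sub M (X X' Y : M -> Prop) :
  submodule X' -> submodule Y -> (forall x, Y x -> X' x) -> (forall x, X' x -> X x) ->
  fgen X Y -> fgen X' Y.
Proof.
move=> sX' sY YX' X'X [T [e [_ eS]]]; apply: (@fgen_gspan _ _ _ T e) => //.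
by move=> x /X'X /eS.
Qed.

Lemma fgen_iso M M' (phi : {linear M -> M'}) (X Y : M -> Prop) (X' Y' : M' -> Prop) :
  submodule X -> submodule Y' ->
  (forall x, X x -> X' (phi x)) -> (forall x, X x -> Y' (phi x) <-> Y x) ->
  (forall x', X' x' -> exists2 x, X x & Y' (x' - phi x)) ->
  fgen X Y <-> fgen X' Y'.
Proof.
move=> sX sY' XX' YY' X'X.
have lin (T : finType) (c : T -> Zp) (e : T -> M) :
    phi (\sum_i c i *: e i) = \sum_i c i *: phi (e i).
  by rewrite linear_sum; apply: eq_bigr => i _; rewrite linearZ.
have Xsum (T : finType) (c : T -> Zp) (e : T -> M) : (forall i, X (e i)) ->
    X (\sum_i c i *: e i).
  by move=> eX; apply: submod_sum => // i _; apply: submodZ.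
split=> [[T [e [eX eS]]]|[T [e' [eX' eS']]]].
- exists T, (phi \o e); split=> [i|x' /X'X[x Xx xx']] /=; first exact: XX'.
  have [c Yc] := eS x Xx; exists c; rewrite -lin.
  apply: (submod_sub_trans sY' xx'); rewrite -linearB; apply/YY' => //.
  by apply: submodB => //; apply: Xsum.
- have /choice[e eP] i : exists x, X x /\ Y' (e' i - phi x).
    by have [x] := X'X _ (eX' i); exists x.
  have eX i : X (e i) by case: (eP i).
  exists T, e; split=> // x Xx.
  have [c Yc] := eS' _ (XX' _ Xx); exists c; apply/YY'.
    by apply: submodB => //; apply: Xsum.
  rewrite linearB; apply: (submod_sub_trans sY' Yc).
  rewrite lin -sumrB; apply: submod_sum => // i _; rewrite -scalerBr.
  by apply: submodZ => //; case: (eP i).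
Qed.

(** Generators are removed one at a time. Writing the first one modulo [N] as [p] times a
    combination leaves it with a coefficient [1 - p c], a unit because [Zp] is local, so it is
    expressed through the others. *)
Lemma nakayama M (X N : M -> Prop) :
  submodule X -> submodule N -> fgen X N ->
  (forall x, X x -> exists2 y, X y & N (x - p%:R *: y)) -> forall x, X x -> N x.
Proof.
move=> sX sN [T [e [eX eS]]] pX.
pose f (i : 'I_#|T|) := e (enum_val i).
have fS : gspan X N f := gspan_ord eS.
have fX i : X (f i) := eX (enum_val i).
move: f fS fX; move: #|T| => n {T eS eX}e.
elim: n e => [|n IHn] e eS eX.
  by move=> x /eS[c]; rewrite big_ord0 subr0.
apply: (IHn (fun i => e (lift ord0 i))) => //.
have [y Xy eyN] := pX _ (eX ord0); have [c cP] := eS y Xy.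
have e0 : N ((1 - p%:R * c ord0) *: e ord0 - \sum_i (p%:R * c (lift ord0 i)) *: e (lift ord0 i)).
  have := submod_sub_trans sN eyN (z := p%:R *: \sum_i c i *: e i).
  rewrite -scalerBr => /(_ (submodZ sN _ cP)).
  rewrite big_ord_recl scalerDr scalerA scaler_sumr scalerBl scale1r opprD addrA.
  by under [in X in X -> _]eq_bigr do rewrite scalerA.
have [u|[z zE]] := padic_unit_or_div (1 - p%:R * c ord0); last first.
  have := padic_p_nonunit (z + c ord0).
  by rewrite mulrDr -zE subrK eqxx.
move=> x /eS[d dP].
exists (fun i => d (lift ord0 i) + d ord0 * ((1 - p%:R * c ord0)^-1 * (p%:R * c (lift ord0 i)))).
apply: (submod_sub_trans sN dP).
have /(submodZ sN (d ord0 * (1 - p%:R * c ord0)^-1)) := e0.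
rewrite scalerBr scalerA mulrVK // big_ord_recl scaler_sumr.
congr N; under [X in _ = _ - X]eq_bigr do rewrite scalerDl.
rewrite big_split /= opprD [in RHS]addrA addrK; congr (_ - _).
by apply: eq_bigr => i _; rewrite scalerA !mulrA.
Qed.

(** A generating family of least size is independent: without p-torsion a relation can be divided by
    [p] until one coefficient is a unit, and the corresponding generator could then be dropped. *)
Lemma torsionfree_basis M (X Y : M -> Prop) :
  submodule X -> submodule Y -> fgen X Y ->
  (forall x, X x -> Y (p%:R *: x) -> Y x) ->
  exists (T : finType) (e : T -> M), indep X Y e /\ gspan X Y e.
Proof.
move=> sX sY [T [e [eX eS]]] tf.
pose P n := `[< exists e : 'I_n -> M, (forall i, X (e i)) /\ gspan X Y e >].
have exP : exists n, P n.
  exists #|T|; apply/asboolP; exists (fun i => e (enum_val i)); split=> //.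
  exact: gspan_ord.
case: (ex_minnP exP) => n /asboolP[{eX eS}e [eX eS]] nmin.
exists 'I_n, e; split=> //; split=> // c cY i0.
apply/eqP/negPn/negP => /padic_valuation[k [u [uU cE]]].
have [d [j [dY dU]]] : exists (d : 'I_n -> Zp) j, Y (\sum_i d i *: e i) /\ d j \is a GRing.unit.
  elim: k u uU c cE cY => [|k IHk] u uU c cE cY.
    by exists c, i0; rewrite cE mul1r.
  case: (pselect (exists j, c j \is a GRing.unit)) => [[j cj]|nc]; first by exists c, j.
  have /choice[c' c'E] i : exists y, c i = p%:R * y.
    by have [ci|//] := padic_unit_or_div (c i); case: nc; exists i.
  apply: (IHk u uU c').
    by apply: (mulfI (padic_p_neq0 p_pr)); rewrite -c'E cE exprS mulrA.
  apply: tf; first by apply: submod_sum => // i _; apply: submodZ.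
  move: cY; congr Y; rewrite scaler_sumr; apply: eq_bigr => i _.
  by rewrite scalerA -c'E.
move: d j dY dU {c cY cE i0}; case: n e eX eS nmin => [|n] e eX eS nmin d j dY dU; first by case: (j).
have /nmin : P n; last by rewrite ltnn.
apply/asboolP; exists (fun i => e (lift j i)); split=> // x /eS[c cP].
exists (fun i => c (lift j i) - c j * (d j)^-1 * d (lift j i)).
have := submodB sY cP (submodZ sY (c j * (d j)^-1) (submodN sY dY)).
congr Y; rewrite -addrA; congr (_ + _).
rewrite -opprD scalerN; congr (- _).
have sumj (f : 'I_n.+1 -> M) : \sum_i f i = f j + \sum_i f (lift j i).
  rewrite (bigD1 j) //=; congr (_ + _).
  rewrite (reindex_omap (lift j) (unlift j)) /=.
    by apply: eq_bigl => i; rewrite liftK eqxx eq_sym neq_lift.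
  by move=> i; case: unliftP => [i' ->|->] //=; rewrite eqxx.
rewrite !sumj scalerDr scalerA mulrVK // opprD addrACA subrr add0r.
rewrite scaler_sumr -sumrB; apply: eq_bigr => i _.
by rewrite scalerBl scalerA.
Qed.

End FinitelyGenerated.

(** * Dual bases over the Iwasawa algebra *)

Lemma projective_dual_basis (R : nzRingType) (X : lmodType R) :
  fin_gen X -> projective X ->
  exists n (e : 'I_n -> X) (phi : 'I_n -> {linear X -> R^o}),
    forall x, x = \sum_i (phi i x : R) *: e i.
Proof.
move=> [n [e eP]] prX.
have g_lin : linear (fun v : 'rV[R]_n => \sum_i v 0 i *: e i).
  move=> a u v; rewrite scaler_sumr -big_split /=; apply: eq_bigr => i _.
  by rewrite !mxE scalerDl scalerA.
pose g := linear_pack g_lin.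
have [|k kP] := prX _ _ g idfun.
  move=> y; have [c ->] := eP y; exists (\row_i c i).
  by apply: eq_bigr => i _; rewrite mxE.
have phi_lin i : linear (fun x => k x 0 i : R^o).
  by move=> a x y; rewrite linearP !mxE.
exists n, e, (fun i => linear_pack (phi_lin i)).
by move=> x; rewrite -[LHS]kP.
Qed.

Section DualBasis.
Variables (p : nat) (p_pr : prime p).
Local Notation Zp := (padic_int p_pr).
Local Notation S := (powser Zp).

(** Says that [M] is a direct summand of the free module on [T], that is, finitely generated and
    projective over [S]. In this form, facts about [S] pass to [M] coordinate by coordinate. *)
Definition dual_basis (M : lmodType S) : Prop :=
  exists (T : finType) (e : T -> M) (phi : T -> M -> S),
    (forall t a x y, phi t (a *: x + y) = a * phi t x + phi t y) /\
    (forall x, x = \sum_t phi t x *: e t).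

Section Theory.
Variable M : lmodType S.
Hypothesis dM : dual_basis M.
Local Notation MZ := (restr (@ps_const Zp) M).

Lemma dual_basis_inj f (x : M) : ~ pdvd f -> f *: x = 0 -> x = 0.
Proof.
case: dM => T [e [phi [phi_lin xE]]] nf fx.
have phi0 t : phi t 0 = 0.
  by have := phi_lin t (-1) 0 0; rewrite scaler0 addr0 mulN1r addNr.
rewrite (xE x) big1 // => t _; rewrite (_ : phi t x = 0) ?scale0r //.
apply: (not_pdvd_inj nf); have := phi_lin t f x 0.
by rewrite addr0 fx phi0 addr0.
Qed.

Lemma dual_basis_p_inj (x : M) : p%:R *: x = 0 -> x = 0.
Proof.
case: dM => T [e [phi [phi_lin xE]]] px.
have phi0 t : phi t 0 = 0.
  by have := phi_lin t (-1) 0 0; rewrite scaler0 addr0 mulN1r addNr.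
rewrite (xE x) big1 // => t _; rewrite (_ : phi t x = 0) ?scale0r //.
apply: ps_p_inj; have := phi_lin t p%:R x 0.
by rewrite addr0 px phi0 addr0.
Qed.

Lemma dual_basis_pdvd f (x y : M) : ~ pdvd f -> f *: x = p%:R *: y ->
  exists z, x = p%:R *: z.
Proof.
case: dM => T [e [phi [phi_lin xE]]] nf fx.
have phi0 t : phi t 0 = 0.
  by have := phi_lin t (-1) 0 0; rewrite scaler0 addr0 mulN1r addNr.
have phiZ t a z : phi t (a *: z) = a * phi t z.
  by have := phi_lin t a z 0; rewrite !addr0 phi0 addr0.
have /choice[q qE] t : exists q, phi t x = p%:R * q.
  apply: contrapT => nx; have := not_pdvd_mul nf nx; apply.
  by exists (phi t y); rewrite -!phiZ fx.
exists (\sum_t q t *: e t); rewrite [LHS]xE scaler_sumr.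
by apply: eq_bigr => t _; rewrite qE scalerA.
Qed.

Lemma dual_basis_fin_gen : exists n (e : 'I_n -> M),
  forall x, exists c : 'I_n -> S, x = \sum_i c i *: e i.
Proof.
case: dM => T [e [phi [_ xE]]]; exists #|T|, (fun i => e (enum_val i)) => x.
exists (fun i => phi (enum_val i) x); rewrite [LHS]xE.
rewrite (reindex_onto enum_val enum_rank) /=; last by move=> j _; rewrite enum_rankK.
by apply: eq_bigl => j; rewrite enum_valK eqxx.
Qed.

(** Weierstrass division in each coordinate reduces modulo [g] to polynomials of degree below [d],
    whence the generators. *)
Lemma dual_basis_fgen g : ~ pdvd g ->
  fgen (fun _ : MZ => True) (fun x : MZ => exists y : M, x = g *: y).
Proof.
case: dM => T [e [phi [_ xE]]] /weierstrass_division[d dP].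
exists (T * 'I_d)%type, (fun k : T * 'I_d => psX _ ^+ k.2 *: e k.1); split=> // x _.
have /choice[cq cqP] t : exists cq : ('I_d -> Zp) * S,
    phi t x = \sum_i ps_const (cq.1 i) * psX _ ^+ i + g * cq.2.
  by have [c [q ?]] := dP (phi t x); exists (c, q).
exists (fun k => (cq k.1).1 k.2), (\sum_t (cq t).2 *: e t).
rewrite -(pair_bigA _ (fun t i => (cq t).1 i *: (psX _ ^+ i *: e t : MZ))) /=.
rewrite [X in X - _ = _](xE x) -sumrB scaler_sumr; apply: eq_bigr => t _.
have E : (\sum_i ps_const ((cq t).1 i) * psX _ ^+ i) *: e t =
    \sum_i (cq t).1 i *: (psX _ ^+ i *: e t : MZ) :> M.
  by rewrite scaler_suml; apply: eq_bigr => i _; rewrite -scalerA.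
by rewrite {1}cqP scalerDl E [in LHS]addrC addrA addNr add0r scalerA.
Qed.
End Theory.
End DualBasis.

(* A central [Zp[[T]]]-algebra which is a direct factor of a free module of
   finite rank. *)
Definition finite_free_algebra (p : nat) (p_pr : prime p) (R : nzRingType)
    (iota : {rmorphism powser (padic_int p_pr) -> R}) : Prop :=
  (forall s r, iota s * r = r * iota s) /\ dual_basis (restr iota R^o).

Lemma dual_basis_restr (p : nat) (p_pr : prime p) (R : nzRingType)
    (iota : {rmorphism powser (padic_int p_pr) -> R}) (X : lmodType R) :
  finite_free_algebra iota -> fin_gen X -> projective X -> dual_basis (restr iota X).
Proof.
move=> [_ [T [b [beta [beta_lin rE]]]]] fX pX.
have [n [e [phi xE]]] := projective_dual_basis fX pX.
exists ('I_n * T)%type, (fun k => (b k.2 : R) *: (e k.1 : X)), (fun k x => beta k.2 (phi k.1 x)).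
split=> [k a x y|x].
  by rewrite -beta_lin; congr (beta _ _); rewrite -[LHS]/(phi k.1 (iota a *: (x : X) + y)) linearP.
rewrite -(pair_bigA _ (fun i t => beta t (phi i x) *: ((b t : R) *: (e i : X) : restr iota X))) /=.
rewrite [LHS]xE; apply: eq_bigr => i _; rewrite {1}(rE (phi i x)).
rewrite scaler_suml; apply: eq_bigr => t _.
by rewrite /GRing.scale /= /restr_scale /= scalerA.
Qed.

(** * Augmentation ideals and coinvariants *)

(** The inner binomial coefficients are divisible by [p], and 1 commutes with [d] in any ring. For
    [d = x - 1] this makes [d ^ p] congruent to [x ^ p - 1] modulo [p]. *)
Lemma exprD1_prime (R : nzRingType) (d : R) p : prime p ->
  exists e, (1 + d) ^+ p = 1 + d ^+ p + p%:R * e.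
Proof.
case: p => // q q_pr; rewrite (exprDn_comm _ (commr_sym (commr1 d))).
exists (\sum_(i < q) ('C(q.+1, i.+1) %/ q.+1)%:R * d ^+ i.+1).
rewrite big_ord_recl big_ord_recr /= bin0 subn0 expr0 expr1n mul1r mulr1n -addrA.
congr (1 + _); rewrite addrC /bump add1n subnn mul1r binn mulr1n; congr (_ + _).
rewrite mulr_sumr; apply: eq_bigr => i _.
rewrite expr1n mul1r mulrA -natrM mulnC divnK ?mulr_natl //.
by apply: prime_dvd_bin => //=; rewrite ltnS.
Qed.

(** [x] lifts an element of order [p] in the centre of the nontrivial p-group [G / H], and [K] is
    the preimage of the subgroup it generates. These are the rungs of the descent in
    [aug_nilpotent]. *)
Lemma pgroup_central_step (p : nat) (gT : finGroupType) (H : {group gT}) :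
  (p.-group [set: gT])%g -> (H <| [set: gT])%g -> H != [set: gT]%G ->
  exists (K : {group gT}) (x : gT), [/\ (K <| [set: gT])%g, (#|H| < #|K|)%N,
    forall k, k \in K -> exists2 h, h \in H & exists j, k = (x ^+ j * h)%g,
    (x ^+ p)%g \in H & forall g, ((g * x) * (x * g)^-1)%g \in H].
Proof.
move=> pG nHG HG; set G := [set: gT] in pG nHG HG *.
have nH g : g \in ('N(H))%g by have := fintype.subsetP (normal_norm nHG) g; rewrite inE; apply.
have pQ : (p.-group (G / H))%g by apply: quotient_pgroup.
have ntQ : (G / H)%g != 1%g.
  apply: contra HG => /eqP GH1; apply/eqP/val_inj/eqP; rewrite finset.eqEsubset finset.subsetT /=.
  by rewrite -quotient_sub1 ?normal_norm // GH1.
have ntZ : ('Z(G / H))%g != 1%g by rewrite (center_nil_eq1 (pgroup_nil pQ)).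
have pZ : (p.-group 'Z(G / H))%g by apply: pgroupS pQ; apply: center_sub.
have [p_pr pdZ _] := pgroup_pdiv pZ ntZ.
have [z zZ oz] := Cauchy p_pr pdZ.
have [x _ zx] : exists2 x, x \in ('N(H))%g & z = coset H x.
  by case/morphimP: (fintype.subsetP (center_sub _) _ zZ) => x Nx _ ->; exists x.
have cosM g h : coset H (g * h)%g = (coset H g * coset H h)%g by rewrite morphM.
have cosV g : coset H (g^-1)%g = ((coset H g)^-1)%g by rewrite morphV.
have cosX g j : coset H (g ^+ j)%g = (coset H g ^+ j)%g by rewrite morphX.
have nzQ : (<[z]> <| G / H)%g by apply: sub_center_normal; rewrite cycle_subG.
exists (coset H @*^-1 <[z]>)%G, x; split.
- by have := nzQ; rewrite -cosetpre_normal quotientGK.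
- rewrite card_cosetpre -/(order z) oz.
  by rewrite ltn_Pmulr ?cardG_gt0 ?prime_gt1.
- move=> k /morphpreP[_ /cycleP[j kj]]; exists (x ^- j * k)%g; last by exists j; rewrite mulKVg.
  by apply: coset_idr => //; rewrite cosM kj zx cosV cosX mulVg.
- by apply: coset_idr => //; rewrite cosX -zx -oz expg_order.
- move=> g; apply: coset_idr => //; rewrite cosM cosV !cosM -zx.
  have /centerP[_ ->] := zZ; last by apply: mem_quotient; rewrite inE.
  by rewrite mulgV.
Qed.

Section GroupRing.
Variables (L : nzRingType) (G : finGroupType).
Local Notation R := (group_ring L G).

Definition gr_of (g : G) : R := GroupRing [ffun h => (h == g)%:R].

Lemma gr_of1 : gr_of 1%g = 1.
Proof. by apply: group_ringP => h; rewrite !ffunE; case: eqP. Qed.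

Lemma gr_ofM g h : gr_of (g * h)%g = gr_of g * gr_of h.
Proof.
apply: group_ringP => k; rewrite !ffunE (bigD1 g) //= big1.
  by rewrite !ffunE eqxx mul1r addr0 -(inj_eq (mulgI g^-1%g)) mulKg.
by move=> l /negPf lg; rewrite ffunE lg mul0r.
Qed.

Lemma gr_ofX g n : gr_of (g ^+ n)%g = gr_of g ^+ n.
Proof. by elim: n => [|n IHn]; rewrite ?gr_of1 // expgS gr_ofM IHn exprS. Qed.

Lemma gr_const_mul (c : L) (a : R) g : gcoef (gr_const G c * a) g = c * gcoef a g.
Proof.
rewrite ffunE (bigD1 1%g) //= big1; first by rewrite ffunE eqxx invg1 mul1g addr0.
by move=> h /negPf h1; rewrite ffunE h1 mul0r.
Qed.

Lemma gcoef_sum (T : Type) (s : seq T) (P : pred T) (F : T -> R) g :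
  gcoef (\sum_(i <- s | P i) F i) g = \sum_(i <- s | P i) gcoef (F i) g.
Proof.
by apply: (big_morph (fun a => gcoef a g)) => [a b|]; rewrite ffunE.
Qed.

Lemma group_ringE (a : R) : a = \sum_g gr_const G (gcoef a g) * gr_of g.
Proof.
apply: group_ringP => g; rewrite gcoef_sum (bigD1 g) // big1.
  by rewrite gr_const_mul ffunE eqxx mulr1 /= addr0.
by move=> h /andP[_ /negPf hg]; rewrite gr_const_mul ffunE eq_sym hg mulr0.
Qed.

Lemma augmentation_gr_of g : augmentation (gr_of g) = 1.
Proof.
rewrite /augmentation (bigD1 g) //= ffunE eqxx big1 ?addr0 // => h /negPf hg.
by rewrite ffunE hg.
Qed.

Lemma gr_of_comm_const g c : gr_of g * gr_const G c = gr_const G c * gr_of g.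
Proof.
apply: group_ringP => h; rewrite gr_const_mul !ffunE (bigD1 g) //= big1.
  rewrite !ffunE eqxx mul1r addr0 -eq_mulVg1 eq_sym.
  by case: eqP; rewrite ?mulr1 ?mulr0.
by move=> k /negPf kg; rewrite ffunE kg mul0r.
Qed.

Section AugmentationPowers.
Variable X : lmodType R.
Implicit Types x y : X.

(** For a submodule [Y] this is [I Y], where [I] is the augmentation ideal, so that [augpow k] is
    [I ^ k X]. *)
Inductive augspan (Y : X -> Prop) : X -> Prop :=
| AugSpan0 : augspan Y 0
| AugSpanD g y x : Y y -> augspan Y x -> augspan Y ((gr_of g - 1) *: y + x).

Definition augpow k : X -> Prop := iter k augspan (fun=> True).

Lemma augspanD (Y : X -> Prop) x y : augspan Y x -> augspan Y y -> augspan Y (x + y).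
Proof.
by elim=> [|g z u Yz _ IHu] Yy; rewrite ?add0r // -addrA; apply: AugSpanD => //; apply: IHu.
Qed.

Lemma augspan_gen (Y : X -> Prop) g y : Y y -> augspan Y ((gr_of g - 1) *: y).
Proof. by move=> Yy; rewrite -[_ *: y]addr0; apply: AugSpanD => //; apply: AugSpan0. Qed.

(** The elements [g - 1] generate the augmentation ideal: [a] differs from the combination of the
    [g - 1] with its own coefficients by its augmentation. *)
Lemma augspan_kernel (a : R) x : augmentation a = 0 -> augspan (fun=> True) (a *: x).
Proof.
move=> a0; have -> : a = \sum_g gr_const G (gcoef a g) * (gr_of g - 1).
  under eq_bigr do rewrite mulrBr mulr1.
  rewrite sumrB -group_ringE -rmorph_sum /= -[\sum_i _]/(augmentation a) a0.
  by rewrite rmorph0 subr0.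
rewrite scaler_suml; apply: big_ind => [|u v|g _]; [exact: AugSpan0|exact: augspanD|].
by rewrite mulrBr mulr1 -gr_of_comm_const -[gr_const G _ in X in _ - X]mul1r -mulrBl -scalerA; apply: augspan_gen.
Qed.

(** The sum of [p X] and all [(h - 1) X] with [h] in [H]; it interpolates between [p X] for trivial
    [H] and [p X + I X] for [H = G]. *)
Inductive paug (p : nat) (H : {set G}) : X -> Prop :=
| PAug0 : paug p H 0
| PAugG h y x : h \in H -> paug p H x -> paug p H ((gr_of h - 1) *: y + x)
| PAugP y x : paug p H x -> paug p H (p%:R *: y + x).

Section PAug.
Variables (p : nat) (H : {group G}).
Local Notation J := (paug p H).

Lemma paugD x y : J x -> J y -> J (x + y).
Proof.
elim=> [|h z u hH _ IHu|z u _ IHu] Jy; rewrite ?add0r // -addrA.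
  by apply: PAugG => //; apply: IHu.
by apply: PAugP; apply: IHu.
Qed.

Lemma paug_genG h y : h \in H -> J ((gr_of h - 1) *: y).
Proof. by move=> hH; rewrite -[_ *: y]addr0; apply: PAugG => //; apply: PAug0. Qed.

Lemma paug_genP y : J (p%:R *: y).
Proof. by rewrite -[_ *: y]addr0; apply: PAugP; apply: PAug0. Qed.

Lemma paugN x : J x -> J (- x).
Proof.
elim=> [|h z u hH _ IHu|z u _ IHu]; rewrite ?oppr0 ?opprD -?scalerN; first exact: PAug0.
  exact: PAugG.
exact: PAugP.
Qed.

Lemma paugB x y : J x -> J y -> J (x - y).
Proof. by move=> Jx Jy; apply: paugD => //; apply: paugN. Qed.

Hypothesis nH : (H <| [set: G])%g.

Lemma paug_stable g x : J x -> J (gr_of g *: x).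
Proof.
elim=> [|h z u hH _ IHu|z u _ IHu]; rewrite ?scaler0 ?scalerDr; first exact: PAug0.
  apply: paugD => //; rewrite scalerA mulrBr mulr1 -gr_ofM.
  have -> : gr_of (g * h)%g - gr_of g = (gr_of (h ^ g^-1)%g - 1) * gr_of g.
    by rewrite mulrBl mul1r -gr_ofM /conjg invgK -!mulgA mulVg mulg1.
  rewrite -scalerA; apply: paug_genG.
  by rewrite memJ_norm // (fintype.subsetP (normal_norm nH)) // inE.
by apply: paugD => //; rewrite scalerA mulr_natr -mulr_natl -scalerA; apply: paug_genP.
Qed.

Lemma paug_stable1 g x : J x -> J ((gr_of g - 1) *: x).
Proof. by move=> Jx; rewrite scalerBl scale1r; apply: paugB => //; apply: paug_stable. Qed.
End PAug.

(** Some [I ^ k X] lies in [paug p H], by descent on the normal subgroup [H] from [G] to 1. For the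
    step from [K] to [H], with [K / H] central of order [p] and generated by [x], put [d = x - 1].
    Modulo [paug p H], [I ^ n X] lies in [d X] and [d] commutes with [G], so [I ^ (n a) X] lies in
    [d ^ a X]. For [a = p], [d ^ p] is [x ^ p - 1] modulo [p], and [x ^ p] belongs to [H]. *)
Lemma aug_nilpotent (p : nat) : prime p -> (p.-group [set: G])%g ->
  exists k, forall x, augpow k x -> exists y, x = p%:R *: y.
Proof.
move=> p_pr pG.
suff aug_paug (H : {group G}) : (H <| [set: G])%g ->
    exists k, forall x, augpow k x -> paug p H x.
  have [k kP] := aug_paug [1 G]%G (normal1 _).
  exists k => x /kP; elim=> [|h y u /finset.set1P -> _ [z ->]|y u _ [z ->]].
  - by exists 0; rewrite scaler0.
  - by exists z; rewrite gr_of1 subrr scale0r add0r.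
  - by exists (y + z); rewrite scalerDr.
have [m] := ubnP (#|G| - #|H|)%N; elim: m H => // m IHm H + nH.
rewrite ltnS => leHm.
have [HG|HG] := eqVneq H [set: G]%G.
  exists 1%N => x /=; elim=> [|g y u _ _ IHu]; first exact: PAug0.
  by apply: PAugG => //; rewrite HG inE.
have [K [x [nK ltHK Kx xp xc]]] := pgroup_central_step pG nH HG.
have ltHG : (#|H| < #|G|)%N by apply: leq_trans ltHK _; apply: max_card.
have [n nP] : exists k, forall x, augpow k x -> paug p K x.
  by apply: IHm nK; apply: leq_trans leHm; apply: ltn_sub2l.
pose d := gr_of x - 1.
have KH w : paug p K w -> exists y, paug p H (w - d *: y).
  elim=> [|h y u /Kx[k kH [j ->]] _ [z uz]|y u _ [z uz]].
  - by exists 0; rewrite scaler0 subr0; apply: PAug0.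
  - exists ((\sum_(i < j) gr_of x ^+ i) *: (gr_of k *: y) + z).
    rewrite scalerDr [d *: (_ *: _)]scalerA -subrX1 opprD addrACA; apply: paugD => //.
    rewrite gr_ofM gr_ofX scalerA -scalerBl mulrBl mul1r opprB addrC subrKA.
    exact: paug_genG.
  - by exists z; rewrite -addrA; apply: PAugP.
have dJ a w : paug p H w -> paug p H (d ^+ a *: w).
  elim: a => [|a IHa] Jw; first by rewrite scale1r.
  by rewrite exprS -scalerA; apply: paug_stable1 => //; apply: IHa.
(* Since [g x (x g)^-1] lies in [H], [d] commutes with the action of [G] modulo [paug p H]. *)
have dcomm a g y : paug p H ((gr_of g - 1) *: (d ^+ a *: y) - d ^+ a *: ((gr_of g - 1) *: y)).
  elim: a y => [|a IHa] y; first by rewrite !scale1r subrr; apply: PAug0.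
  rewrite exprSr -!scalerA.
  have := paugD (IHa (d *: y)) (dJ a ((gr_of g - 1) *: (d *: y) - d *: ((gr_of g - 1) *: y)) _).
  rewrite scalerBr addrA subrK; apply.
  rewrite !scalerA -scalerBl.
  have -> : (gr_of g - 1) * d - d * (gr_of g - 1) = gr_of g * gr_of x - gr_of x * gr_of g.
    have E (b c : R) : (b - 1) * (c - 1) = b * c - (b + c - 1).
      by rewrite mulrBl mul1r mulrBr mulr1 -[LHS]addrA -opprD addrA.
    by rewrite /d !E [gr_of x + gr_of g]addrC [- (gr_of x * _ - _)]opprB addrA subrK.
  rewrite -!gr_ofM.
  have -> : gr_of (g * x)%g - gr_of (x * g)%g = (gr_of (g * x * (x * g)^-1)%g - 1) * gr_of (x * g)%g.
    by rewrite mulrBl mul1r -gr_ofM mulgKV.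
  by rewrite -scalerA; apply: paug_genG.
(* The surplus [j] feeds the induction on [a]: to split off one more factor [d] by [nP], the
   quotient [w'] must itself lie in [I ^ n X]. *)
have main a j w : augpow (j + n * a) w ->
    exists2 w', augpow j w' & paug p H (w - d ^+ a *: w').
  elim: a j w => [|a IHa] j w.
    by rewrite muln0 addn0 => jw; exists w; rewrite // scale1r subrr; apply: PAug0.
  have {}IHa w0 : augpow (n * a.+1) w0 -> exists w', paug p H (w0 - d ^+ a.+1 *: w').
    rewrite mulnS => /IHa[w' /nP/KH[y wy] ww']; exists y.
    have := paugD ww' (dJ a _ wy); rewrite scalerBr addrA subrK scalerA -exprSr.
    exact.
  elim: j w => [|j IHj] w; first by move=> /IHa[w' ?]; exists w'.
  rewrite addSn /=; elim=> [|g y u jy _ [u' ju' uu']].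
    by exists 0; [exact: AugSpan0|rewrite scaler0 subr0; apply: PAug0].
  have [y' jy' yy'] := IHj _ jy.
  exists ((gr_of g - 1) *: y' + u'); first exact: AugSpanD.
  rewrite scalerDr opprD addrACA; apply: paugD => //.
  have := paugD (paug_stable1 nH g yy') (dcomm a.+1 g y').
  by rewrite scalerBr addrA subrK.
exists (n * p)%N => w /(main p 0%N)[w' _ ww'].
rewrite -[w](subrK (d ^+ p *: w')); apply: paugD => //.
have [e] := exprD1_prime d p_pr.
have -> : 1 + d = gr_of x by rewrite addrC subrK.
rewrite -gr_ofX -addrA addrC => xpE.
have := paugB (paug_genG p w' xp) (paug_genP p H (e *: w')).
by rewrite xpE addrK scalerDl scalerA addrK.
Qed.
End AugmentationPowers.
End GroupRing.

Lemma augmentation_const (L : nzRingType) (G : finGroupType) (c : L) :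
  augmentation (gr_const G c) = c.
Proof.
rewrite /augmentation (bigD1 1%g) //= ffunE eqxx big1 ?addr0 // => h /negPf h1.
by rewrite ffunE h1.
Qed.

Section AugPair.
Variables (L : nzRingType) (G : finGroupType).
Local Notation R := (group_ring L G).
Local Notation aug := (@augmentation L G).

(* [pi] exhibits [Xb] as the coinvariants [X / IX] of [X]. *)
Definition aug_pair (X : lmodType R) (Xb : lmodType L)
    (pi : {linear X -> restr aug Xb}) : Prop :=
  (forall y, exists x, pi x = y) /\ (forall x, pi x = 0 -> augspan (fun=> True) x).

Lemma aug_pairZ (X : lmodType R) (Xb : lmodType L) (pi : {linear X -> restr aug Xb}) a x :
  pi (a *: x) = aug a *: (pi x : Xb).
Proof. by rewrite linearZ. Qed.

Lemma augspan_linear (X Y : lmodType R) (u : {linear X -> Y}) (P : X -> Prop) (Q : Y -> Prop) x :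
  (forall x, P x -> Q (u x)) -> augspan P x -> augspan Q (u x).
Proof.
move=> PQ; elim=> [|g y z /PQ Qy _ IHz]; first by rewrite raddf0; apply: AugSpan0.
by rewrite raddfD /= linearZ; apply: AugSpanD.
Qed.

Lemma aug_pair_kernel (X : lmodType R) (Xb : lmodType L) (pi : {linear X -> restr aug Xb}) P x :
  augspan P x -> pi x = 0.
Proof.
elim=> [|g y z _ _ IHz]; first by rewrite raddf0.
by rewrite raddfD /= aug_pairZ IHz addr0 rmorphB /= augmentation_gr_of rmorph1 subrr scale0r.
Qed.

Section Descend.
Variables (X Y : lmodType R) (Xb Yb : lmodType L).
Variables (pi : {linear X -> restr aug Xb}) (rho : {linear Y -> restr aug Yb}).

Lemma aug_pair_descend (u : {linear X -> Y}) : aug_pair pi ->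
  exists ub : {linear Xb -> Yb}, forall x, ub (pi x) = rho (u x).
Proof.
move=> [/choice[s sK] kerpi].
have well x x' : pi x = pi x' -> rho (u x) = rho (u x').
  move=> xx'; apply/eqP; rewrite -subr_eq0 -!raddfB; apply/eqP.
  apply: (@aug_pair_kernel _ _ _ (fun=> True)); apply: (@augspan_linear _ _ _ (fun=> True)) => //.
  by apply: kerpi; rewrite raddfB /= xx' subrr.
have ub_lin : linear (fun y : Xb => rho (u (s y)) : Yb).
  move=> a y z; rewrite -[a in RHS](augmentation_const G) -aug_pairZ -linearZ -[RHS]raddfD -raddfD.
  by apply: well; rewrite sK raddfD /= aug_pairZ augmentation_const !sK.
by exists (linear_pack ub_lin) => x; apply: well; rewrite sK.
Qed.
End Descend.

Lemma aug_pair_lift (X : lmodType R) (Xb : lmodType L) (pi : {linear X -> restr aug Xb})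
    (ub : {linear Xb -> Xb}) : projective X -> aug_pair pi ->
  exists u : {linear X -> X}, forall x, pi (u x) = ub (pi x).
Proof.
move=> prX [pi_surj _].
by have [u uP] := prX _ _ pi (restr_map aug ub \o pi) pi_surj; exists u.
Qed.
End AugPair.

(** * Lifting an annihilator from the coinvariants *)

Lemma iter_linear (R : nzRingType) (M : lmodType R) (u : {linear M -> M}) k :
  linear (iter k u).
Proof. by elim: k => [|k IHk] a x y //=; rewrite IHk linearP. Qed.

Section MuLift.
Variables (p : nat) (p_pr : prime p) (L : nzRingType).
Variable psi : {rmorphism powser (padic_int p_pr) -> L}.
Variable G : finGroupType.
Hypothesis pG : (p.-group [set: G])%g.
Local Notation S := (powser (padic_int p_pr)).
Local Notation R := (group_ring L G).
Local Notation aug := (@augmentation L G).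
Local Notation iota := (@gr_const L G \o psi).
Hypothesis iotaC : forall s r, iota s * r = r * iota s.
Variables (X : lmodType R) (Xb : lmodType L) (pi : {linear X -> restr aug Xb}).
Hypotheses (prX : projective X) (dX : dual_basis (restr iota X)) (piP : aug_pair pi).
Variables (d : {linear X -> X}) (db hb : {linear Xb -> Xb}) (f : S).
Hypotheses (ddK : forall x, d (d x) = 0) (dpi : forall x, db (pi x) = pi (d x)).
Hypotheses (nf : ~ pdvd f) (hbP : forall y, psi f *: y = db (hb y) + hb (db y)).

Lemma central_scale_linear s : linear (fun x : X => iota s *: x).
Proof. by move=> a x y; rewrite scalerDr !scalerA iotaC. Qed.

(* [f] is homotopic on [X] to a chain map [v] with image in [IX], hence
   [v ^ K = p u] for some [K] and [u]; if [q] is a monic polynomial of degree [m]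
   with [q(u) = 0], then [p ^ m q(f ^ K / p)] kills the cohomology. *)
Lemma mu_lift : exists2 g : S, ~ pdvd g &
  forall z, d z = 0 -> exists y, iota g *: z = d y.
Proof.
have [h hP] := aug_pair_lift hb prX piP.
pose v : {linear X -> X} := (linear_pack (central_scale_linear f) \- (d \o h)) \- (h \o d).
have vE x : v x = iota f *: x - d (h x) - h (d x) by [].
have pv x : pi (v x) = 0.
  rewrite vE !raddfB /= aug_pairZ /= augmentation_const hbP.
  rewrite -(dpi (h x)) !hP -(dpi x) [X in X - _]addrC.
  by rewrite addKr subrr.
(* [v] has image in [I X] and is linear over the group ring, so each application gains one power of
   [I]. *)
have v_aug k x : augpow k x -> augpow k.+1 (v x).
  elim: k x => [|k IHk] x; first by move=> _; apply: (proj2 piP).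
  exact: augspan_linear.
have [K KP] := aug_nilpotent X p_pr pG.
have /choice[u uP] x : exists y, iter K v x = p%:R *: y.
  by apply: KP; elim: (K) => [|k IHk] //; apply: v_aug.
have pS (x : X) : (p%:R : R) *: x = (p%:R : S) *: (x : restr iota X).
  by rewrite /GRing.scale /= /restr_scale rmorph_nat.
have p_inj (x y : X) : (p%:R : R) *: x = (p%:R : R) *: y -> x = y.
  move=> /eqP; rewrite -subr_eq0 -scalerBr => /eqP; rewrite pS.
  by move=> /(dual_basis_p_inj dX) /eqP; rewrite subr_eq0 => /eqP.
have v_iter_lin k : linear (iter k v) := @iter_linear _ _ v k.
(* Division by [p] is unique on [X], so the chosen [u] inherits linearity from [iter K v]. *)
have u_lin : linear u.
  move=> a x y; apply: p_inj.
  by rewrite -uP v_iter_lin !uP scalerDr !scalerA mulr_natl mulr_natr.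
pose uL := linear_pack u_lin.
have [n [e eP]] := dual_basis_fin_gen dX.
have [|//||q q_mon qP] := @cayley_hamilton_gen _ _ (fun x : restr iota X => x = 0)
    (restr_map iota uL) n e.
- by split=> // a x y -> ->; rewrite scaler0 addr0.
- by move=> x ->; rewrite raddf0.
- by move=> i; have [c cP] := eP (u (e i)); exists c; apply/eqP; rewrite subr_eq0; apply/eqP; apply: cP.
have [m sq] : exists m, size q = m.+1.
  by exists (size q).-1; rewrite prednK // size_poly_gt0 monic_neq0.
have qm : q`_m = 1 by have /monicP := q_mon; rewrite /lead_coef sq.
rewrite sq in qP.
have qu (x : restr iota X) : \sum_(j < m.+1) q`_j *: (iter j u x : restr iota X) = 0.
  have [c ->] := eP x.
  pose uS : {linear restr iota X -> restr iota X} := restr_map iota uL.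
  pose W j := linear_pack (iter_linear uS j).
  rewrite (_ : \sum_j _ = \sum_i c i *: \sum_(j < m.+1) q`_j *: W j (e i)).
    by rewrite big1 // => i _; rewrite qP scaler0.
  rewrite [RHS](eq_bigr _ (fun i _ => scaler_sumr _ _ _ _)) exchange_big /=.
  apply: eq_bigr => j _; rewrite -[iter j u _]/(W j _) linear_sum scaler_sumr.
  by apply: eq_bigr => i _; rewrite linearZ /= !scalerA mulrC.
pose g := \sum_(j < m.+1) q`_j * p%:R ^+ (m - j) * f ^+ (K * j).
(* Modulo [p] only the leading term of [q] contributes, so [g] is congruent to [f ^ (K m)], which
   [p] does not divide. *)
exists g.
  have nfKm := @not_pdvd_exp _ _ f (K * m) nf; apply: contra_not nfKm => pg.
  have -> : f ^+ (K * m) = g + - 1 * \sum_(j < m) q`_j * p%:R ^+ (m - j) * f ^+ (K * j).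
    by rewrite /g big_ord_recr /= qm subnn !mul1r mulN1r addrC addrK.
  apply: pdvd_add => //; apply: pdvd_mull; apply: big_ind => [|a b|j _].
  - by exists 0; rewrite mulr0.
  - exact: pdvd_add.
  - exists (q`_j * p%:R ^+ (m - j.+1) * f ^+ (K * j)).
    by rewrite -(subnSK (ltn_ord j)) exprS mulrCA !mulrA.
pose B (x : restr iota X) := exists y : X, x = d y.
have sB : submodule B.
  split=> [|a x y [x' ->] [y' ->]]; first by exists 0; rewrite raddf0.
  by exists (a *: (x' : restr iota X) + y'); rewrite raddfD /= linearZ.
have dv x : d (v x) = v (d x).
  by rewrite !vE !raddfB /= !ddK !raddf0 !addr0 linearZ.
have Bv z : d z = 0 -> B (f *: (z : restr iota X) - v z).
  by move=> dz; exists (h z); rewrite vE dz raddf0 subr0 opprB addrC subrK.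
have Bvk k z : d z = 0 -> B (f ^+ k *: (z : restr iota X) - iter k v z) /\ d (iter k v z) = 0.
  move=> dz; elim: k => [|k [IHk dk]].
    by split=> //; rewrite scale1r subrr; apply: submod0.
  split; last by rewrite /= dv dk raddf0.
  apply: (submod_sub_trans sB (y := f *: (iter k v z : restr iota X))); last exact: Bv.
  by rewrite exprS -scalerA -scalerBr; apply: submodZ.
have pj j z : iter (K * j) v z = (p%:R ^+ j : S) *: (iter j u z : restr iota X).
  elim: j => [|j IHj]; first by rewrite muln0 scale1r.
  rewrite mulnS iterD IHj exprSr -scalerA -pS -uP.
  by rewrite -[LHS]/(linear_pack (v_iter_lin K) (iota (p%:R ^+ j) *: (iter j u z : X))) linearZ.
move=> z dz; suff : B (g *: (z : restr iota X)) by [].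
apply: (submod_trans sB (y := \sum_(j < m.+1) (q`_j * p%:R ^+ (m - j)) *: (iter (K * j) v z : restr iota X))).
  rewrite scaler_suml -sumrB; apply: submod_sum => // j _.
  by rewrite -scalerA -scalerBr; apply: submodZ => //; apply: (Bvk _ _ dz).1.
rewrite (_ : \sum_j _ = p%:R ^+ m *: \sum_(j < m.+1) q`_j *: (iter j u z : restr iota X)).
  by rewrite qu scaler0; apply: submod0.
rewrite scaler_sumr; apply: eq_bigr => j _; rewrite pj !scalerA; congr (_ *: _).
have jm : (j <= m)%N by rewrite -ltnS.
by rewrite -mulrA -exprD (subnK jm); apply: mulrC.
Qed.
End MuLift.

(** * Total modules and null-homotopies of bounded complexes *)

Lemma dep_choice (I : Type) (T : I -> Type) (P : forall i, T i -> Prop) :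
  (forall i, exists x, P i x) -> exists f : forall i, T i, forall i, P i (f i).
Proof. by move=> h; exists (fun i => projT1 (cid (h i))) => i; apply: projT2 (cid (h i)). Qed.

Section ImageModule.
Variables (R : nzRingType) (M N : lmodType R) (v : {linear M -> N}).

Definition in_image : {pred N} := fun y => `[< exists x, v x = y >].

Fact in_image_closed : submod_closed in_image.
Proof.
split=> [|a x y /asboolP[u ux] /asboolP[w wy]]; apply/asboolP.
  by exists 0; rewrite raddf0.
by exists (a *: u + w); rewrite linearP ux wy.
Qed.
HB.instance Definition _ := GRing.isSubmodClosed.Build R N in_image
  (GRing.submod_closed_semi in_image_closed).

Record image_module := ImageModule { image_val : N; _ : image_val \in in_image }.
HB.instance Definition _ := [isSub for image_val].
HB.instance Definition _ := [Choice of image_module by <:].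
HB.instance Definition _ := [SubChoice_isSubLmodule of image_module by <:].

(** [projective] lifts along surjections only, so [v] is first corestricted to its image, built as a
    module for this purpose. *)
Lemma projective_lift_image (P : lmodType R) (u : {linear P -> N}) :
  projective P -> (forall x, exists y, v y = u x) ->
  exists s : {linear P -> M}, forall x, v (s x) = u x.
Proof.
move=> prP uv.
pose v1 x := ImageModule (asboolT (ex_intro (fun y => v y = v x) x erefl) : v x \in in_image).
pose u1 x := ImageModule (asboolT (uv x) : u x \in in_image).
have v1_lin : linear v1 by move=> a x y; apply: val_inj; rewrite /= linearP.
have u1_lin : linear u1 by move=> a x y; apply: val_inj; rewrite /= linearP.
have [|s sP] := prP _ _ (linear_pack v1_lin) (linear_pack u1_lin).
  move=> [y /[dup] /asboolP[x xy] yv]; exists x.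
  by apply: val_inj.
by exists s => x; have /(congr1 val) := sP x.
Qed.
End ImageModule.

(** For a bounded complex this product is the direct sum of all terms. It turns differentials and
    homotopies into plain endomorphisms, free of casts between degrees. *)
Definition tot (R : nzRingType) (M : int -> lmodType R) : Type := forall i, M i.

Section Tot.
Variables (R : nzRingType) (M : int -> lmodType R).
Local Notation T := (tot M).
Implicit Types x y z : T.

HB.instance Definition _ := Choice.copy T (forall i, M i).

Definition tot_zero : T := fun i => 0.
Definition tot_opp x : T := fun i => - x i.
Definition tot_add x y : T := fun i => x i + y i.
Definition tot_scale (a : R) x : T := fun i => a *: x i.

Lemma totP x y : (forall i, x i = y i) -> x = y.
Proof. exact: functional_extensionality_dep. Qed.

Fact tot_addA : associative tot_add.
Proof. by move=> x y z; apply: totP => i; apply: addrA. Qed.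
Fact tot_addC : commutative tot_add.
Proof. by move=> x y; apply: totP => i; apply: addrC. Qed.
Fact tot_add0 : left_id tot_zero tot_add.
Proof. by move=> x; apply: totP => i; apply: add0r. Qed.
Fact tot_addN : left_inverse tot_zero tot_opp tot_add.
Proof. by move=> x; apply: totP => i; apply: addNr. Qed.
HB.instance Definition _ :=
  GRing.isZmodule.Build T tot_addA tot_addC tot_add0 tot_addN.

Fact tot_scaleA a b x : tot_scale a (tot_scale b x) = tot_scale (a * b) x.
Proof. by apply: totP => i; apply: scalerA. Qed.
Fact tot_scale1 : left_id 1 tot_scale.
Proof. by move=> x; apply: totP => i; apply: scale1r. Qed.
Fact tot_scaleDr : right_distributive tot_scale +%R.
Proof. by move=> a x y; apply: totP => i; apply: scalerDr. Qed.
Fact tot_scaleDl x : {morph tot_scale^~ x : a b / a + b}.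
Proof. by move=> a b; apply: totP => i; apply: scalerDl. Qed.
HB.instance Definition _ := GRing.Zmodule_isLmodule.Build R T
  tot_scaleA tot_scale1 tot_scaleDr tot_scaleDl.

Lemma totDE x y i : (x + y) i = x i + y i. Proof. by []. Qed.
Lemma totNE x i : (- x) i = - x i. Proof. by []. Qed.
Lemma totZE a x i : (a *: x) i = a *: x i. Proof. by []. Qed.
Lemma tot0E i : (0 : T) i = 0. Proof. by []. Qed.
Lemma tot_sumE (J : Type) (s : seq J) (P : pred J) (F : J -> T) i :
  (\sum_(j <- s | P j) F j) i = \sum_(j <- s | P j) F j i.
Proof. by apply: (big_morph (fun x : T => x i)). Qed.

Definition tot_proj i x : M i := x i.
Fact tot_proj_linear i : linear (@tot_proj i). Proof. by []. Qed.
HB.instance Definition _ i := GRing.isLinear.Build R T (M i) _ (@tot_proj i) (@tot_proj_linear i).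

Definition tot_inj i (y : M i) : T := dfwith (fun j => 0 : M j) y.
Lemma tot_inj_in i (y : M i) : tot_inj y i = y.
Proof. exact: dfwith_in. Qed.
Lemma tot_inj_out i j (y : M i) : i != j -> tot_inj y j = 0.
Proof. exact: dfwith_out. Qed.
Fact tot_inj_linear i : linear (@tot_inj i).
Proof.
move=> a x y; apply: totP => j; rewrite totDE totZE.
have [<-|ij] := eqVneq i j; first by rewrite !tot_inj_in.
by rewrite !tot_inj_out // scaler0 addr0.
Qed.
HB.instance Definition _ i := GRing.isLinear.Build R (M i) T _ (@tot_inj i) (@tot_inj_linear i).

Variable n : nat.
Hypothesis Mn : forall i : int, (n < `|i|)%N -> forall x : M i, x = 0.

(** Enumerates the [2 n + 1] degrees from [-n] to [n], outside of which [M] vanishes by [Mn]. *)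
Definition tot_deg (j : 'I_n.*2.+1) : int := (j : nat)%:Z - n%:Z.

Lemma tot_degP i : (`|i| <= n)%N -> exists j, tot_deg j = i.
Proof.
move=> ni; have lt : (absz (i + n%:Z)%R < n.*2.+1)%N by lia.
by exists (Ordinal lt); rewrite /tot_deg /=; lia.
Qed.

Lemma tot_deg_inj : injective tot_deg.
Proof. by move=> j k; rewrite /tot_deg => jk; apply: val_inj => /=; lia. Qed.

Lemma tot_sum_inj x : x = \sum_(j < n.*2.+1) tot_inj (x (tot_deg j)).
Proof.
apply: totP => i; rewrite tot_sumE.
have [ni|ni] := leqP `|i| n; last by rewrite (Mn ni (x i)) [RHS](Mn ni).
have [j jE] := tot_degP ni; rewrite -jE (bigD1 j) //= tot_inj_in big1 ?addr0 // => k kj.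
by rewrite tot_inj_out // (inj_eq tot_deg_inj).
Qed.

Lemma tot_projective : (forall i, projective (M i)) -> projective T.
Proof.
move=> prM A B g h g_surj.
have /dep_choice[k kP] i : exists k : {linear M i -> A}, forall x : M i, g (k x) = h (tot_inj x).
  by have [k kP] := prM i _ _ g (h \o @tot_inj i) g_surj; exists k.
have K_lin : linear (fun x : T => \sum_(j < n.*2.+1) k _ (x (tot_deg j))).
  move=> a x y; rewrite scaler_sumr -big_split /=; apply: eq_bigr => j _.
  by rewrite totDE totZE linearP.
exists (linear_pack K_lin) => x; rewrite [in RHS](tot_sum_inj x) !linear_sum.
by apply: eq_bigr => j _; rewrite kP.
Qed.

Lemma tot_fin_gen : (forall i, fin_gen (M i)) -> fin_gen T.
Proof.
move=> fM.
have /choice[m mP] i : exists m, exists e : 'I_m -> M i,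
    forall x : M i, exists c : 'I_m -> R, x = \sum_l c l *: e l := fM i.
have e0 i := cid (mP i).
pose e i := projT1 (e0 i); pose eP i := projT2 (e0 i).
pose J := {j : 'I_n.*2.+1 & 'I_(m (tot_deg j))}.
pose f (s : J) : T := tot_inj (e _ (tagged s)).
exists #|{: J}|, (fun i => f (enum_val i)) => x.
have cP i := cid (eP i (x i)).
pose c (s : J) := projT1 (cP (tot_deg (tag s))) (tagged s).
exists (fun i => c (enum_val i)).
have -> : \sum_(i < #|{: J}|) c (enum_val i) *: f (enum_val i) = \sum_s c s *: f s.
  rewrite [RHS](reindex_onto enum_val enum_rank) /=; last by move=> s _; rewrite enum_rankK.
  by apply: eq_bigl => i; rewrite enum_valK eqxx.
rewrite (tot_sum_inj x) /f /c.
transitivity (\sum_(j < n.*2.+1) \sum_(l < m (tot_deg j))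
    projT1 (cP (tot_deg j)) l *: tot_inj (e (tot_deg j) l)).
  apply: eq_bigr => j _; rewrite [in LHS](projT2 (cP (tot_deg j))) linear_sum.
  by apply: eq_bigr => l _; rewrite linearZ.
by rewrite sig_big_dep.
Qed.
End Tot.

Section TotComplex.
Variables (R : nzRingType) (P : complex R).
Local Notation T := (tot P).

Definition tot_diff (x : T) : T := fun i => cdiff P (i - 1) i (x (i - 1)).
Fact tot_diff_linear : linear tot_diff.
Proof. by move=> a x y; apply: totP => i; rewrite totDE totZE /tot_diff linearP. Qed.
HB.instance Definition _ := GRing.isLinear.Build R T T _ tot_diff tot_diff_linear.

Lemma tot_diffE x i : tot_diff x i = cdiff P (i - 1) i (x (i - 1)). Proof. by []. Qed.

Lemma tot_diffK x : tot_diff (tot_diff x) = 0.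
Proof. by apply: totP => i; rewrite !tot_diffE cdiffK. Qed.

Lemma tot_diff_cocycle x i : tot_diff x = 0 -> cdiff P i (i + 1) (x i) = 0.
Proof. by move=> /(congr1 (fun y : T => y (i + 1))); rewrite tot_diffE addrK. Qed.

Lemma tot_diff_inj i (z : P i) : cdiff P i (i + 1) z = 0 -> tot_diff (tot_inj z) = 0.
Proof.
move=> dz; apply: totP => j; rewrite tot_diffE tot0E.
have [ij|ij] := eqVneq i (j - 1); last by rewrite tot_inj_out ?raddf0.
have -> : j = i + 1 by rewrite ij subrK.
by rewrite addrK tot_inj_in.
Qed.

Definition kills (c : R) : Prop := forall z : T, tot_diff z = 0 -> exists y, c *: z = tot_diff y.

Lemma killsP c : kills c <->
  forall i (z : P i), cdiff P i (i + 1) z = 0 -> exists y, cdiff P (i - 1) i y = c *: z.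
Proof.
split=> [kc i z dz|kc z dz].
  have [y /(congr1 (fun y : T => y i))] := kc _ (tot_diff_inj dz).
  by rewrite totZE tot_inj_in tot_diffE => ->; exists (y (i - 1)).
have /dep_choice[y yP] j : exists y : P j, cdiff P j (j + 1) y = c *: z (j + 1).
  have := kc (j + 1) (z (j + 1)) (tot_diff_cocycle _ dz); by rewrite addrK.
exists y; apply: totP => i; rewrite totZE tot_diffE.
by have := yP (i - 1); rewrite subrK.
Qed.

Variable n : nat.
Hypothesis Pn : forall i : int, (n < `|i|)%N -> forall x : P i, x = 0.
Hypothesis prP : forall i, projective (P i).

(* Descending induction on the degree: each step extends the homotopy to one
   more degree at the cost of a factor [c]. *)
Lemma kills_nullhomotopic c : (forall r, c * r = r * c) -> kills c ->
  exists k (h : {linear T -> T}), forall x, c ^+ k *: x = tot_diff (h x) + h (tot_diff x).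
Proof.
move=> cC kc.
have c_lin (M N : lmodType R) (u : {linear M -> N}) : linear (fun x => c *: u x).
  by move=> a x y; rewrite linearP scalerDr !scalerA cC.
have step k : exists h : {linear T -> T}, forall x : T, (forall i, i <= n%:Z - k%:Z -> x i = 0) ->
    c ^+ k *: x = tot_diff (h x) + h (tot_diff x).
  elim: k => [|k [h hP]].
    exists \0 => x x0; rewrite !raddf0 addr0 scale1r; apply: totP => i.
    have [ni|ni] := Num.Theory.lerP i n%:Z; first by apply: x0; rewrite subr0.
    by apply: Pn; lia.
  pose i0 : int := n%:Z - k%:Z.
  have dinj (y : P i0) i : i <= i0 -> tot_diff (tot_inj y) i = 0.
    by move=> ii0; rewrite tot_diffE tot_inj_out ?raddf0 //; apply/eqP; lia.
  have ck_lin : linear (fun y : P i0 => c ^+ k *: (tot_inj y : T)).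
    move=> a x y; rewrite linearP scalerDr !scalerA.
    by have <- : a * c ^+ k = c ^+ k * a by apply: commrX; rewrite /GRing.comm cC.
  (* The defect of [h] in degree [i0]. The boundary of an element of degree [i0] lies in degree
     [i0 + 1], where [h] is already a homotopy, so the values of [w] are cocycles and [c] times them
     are boundaries; projectivity of [P i0] makes the choice of primitives linear. *)
  pose w : {linear P i0 -> T} := linear_pack ck_lin \- (h \o (tot_diff \o @tot_inj _ _ i0)).
  have wE y : w y = c ^+ k *: (tot_inj y : T) - h (tot_diff (tot_inj y)) by [].
  have [|s sP] := @projective_lift_image R T T tot_diff (P i0) (linear_pack (@c_lin _ _ w)) (@prP i0).
    move=> y; have [|z zE] := kc (w y); last by exists z.
    rewrite wE raddfB /= linearZ /= (hP _ (dinj y)) tot_diffK raddf0 addr0.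
    by rewrite subrr.
  pose r : {linear T -> T} := idfun \- (@tot_inj _ _ i0 \o @tot_proj _ _ i0).
  pose h' : {linear T -> T} := linear_pack (@c_lin _ _ (h \o r)) \+ (s \o @tot_proj _ _ i0).
  exists h' => x x0.
  have h'E y : h' y = c *: h (y - tot_inj (y i0)) + s (y i0) by [].
  have dx0 : tot_diff x i0 = 0 by rewrite tot_diffE x0 ?raddf0 //; lia.
  have sE : tot_diff (s (x i0)) = c *: w (x i0) := sP _.
  set x' := x - tot_inj (x i0).
  have x'0 i : i <= i0 -> x' i = 0.
    have [->|ii0] := eqVneq i i0; first by rewrite /x' totDE totNE tot_inj_in subrr.
    move=> lei; rewrite /x' totDE totNE tot_inj_out 1?eq_sym // subr0 x0 //.
    by move/eqP: ii0; lia.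
  rewrite !h'E dx0 !raddf0 !addr0 -/x' raddfD /= sE wE linearZ /=.
  have -> : h (tot_diff x) = h (tot_diff x') + h (tot_diff (tot_inj (x i0))).
    by rewrite -!raddfD /= subrK.
  rewrite exprS -scalerA -[in LHS](subrK (tot_inj (x i0)) x) -/x' [c ^+ k *: (_ + _)]scalerDr.
  rewrite (hP x' x'0) -!scalerDr; congr (_ *: _).
  by rewrite addrACA subrK -!addrA; congr (_ + _); rewrite addrC.
(* In degrees up to [n - (2 n + 1) = -n - 1] the complex vanishes, so after [2 n + 1] steps every
   [x] is covered. *)
have [h hP] := step n.*2.+1; exists n.*2.+1, h => x; apply: hP => i ni.
by apply: Pn; lia.
Qed.
End TotComplex.

(** * Cohomology as a subquotient, and its annihilators *)

Lemma submodule_restr (R S : nzRingType) (f : {rmorphism R -> S}) (M : lmodType S)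
    (Y : M -> Prop) : submodule Y -> @submodule _ (restr f M) Y.
Proof. by move=> [Y0 YP]; split=> // a x y; apply: YP. Qed.

Section Cocycles.
Variables (R : nzRingType) (C : complex R) (i : int).

Definition coc (x : C i) : Prop := cdiff C i (i + 1) x = 0.
Definition cob (x : C i) : Prop := exists y, cdiff C (i - 1) i y = x.

Lemma submodule_coc : submodule coc.
Proof.
by split=> [|a x y]; rewrite /coc ?raddf0 // linearP => -> ->; rewrite scaler0 addr0.
Qed.

Lemma submodule_cob : submodule cob.
Proof.
split=> [|a _ _ [x <-] [y <-]]; first by exists 0; rewrite raddf0.
by exists (a *: x + y); rewrite linearP.
Qed.

Lemma cob_coc x : cob x -> coc x.
Proof. by move=> [y <-]; apply: cdiffK. Qed.
End Cocycles.
Arguments coc {R} C i x.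
Arguments cob {R} C i x.

Section QuasiIso.
Variables (R : nzRingType) (P C : complex R) (q : chain_map P C).
Hypothesis qP : quasi_iso q.

Lemma chain_map_coc i x : coc P i x -> coc C i (q i x).
Proof. by rewrite /coc -cmapP => ->; rewrite raddf0. Qed.

Lemma coh_classP (D : complex R) i (x y : cocycle D i) :
  coh_class x = coh_class y <-> cob D i (cocycle_val x - cocycle_val y).
Proof.
rewrite /coh_class; split=> [/qmod_piP/asboolP[z zE]|[z zE]]; first by exists z.
by apply/qmod_piP/asboolP; exists z.
Qed.

Lemma quasi_iso_cob i x : coc P i x -> cob C i (q i x) <-> cob P i x.
Proof.
move=> /[dup] dx /eqP zx; split=> [[y yE]|[y <-]]; last first.
  by exists (q _ y); rewrite -cmapP.
pose z := Cocycle (zx : x \in is_cocycle (C := P) (i := i)).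
have /bij_inj inj := qP i.
have /inj/coh_classP : cohomology_map q (coh_class z) = cohomology_map q (coh_class (0 : cocycle P i)).
  rewrite !cohomology_mapE; apply/coh_classP; exists y.
  by rewrite yE /= raddf0 subr0.
by rewrite subr0.
Qed.

Lemma quasi_iso_surj i z : coc C i z -> exists2 x, coc P i x & cob C i (z - q i x).
Proof.
move=> /eqP dz; pose z' := Cocycle (dz : z \in is_cocycle (C := C) (i := i)).
have [g _ gK] := qP i.
pose x := coh_repr (g (coh_class z')); exists (cocycle_val x).
  by case: (x) => y /= /eqP.
apply/(@coh_classP _ _ z' (cocycle_map q x)); rewrite -cohomology_mapE /x.
by rewrite /coh_repr /coh_class qmod_reprK gK.
Qed.
End QuasiIso.

Section Criterion.
Variables (p : nat) (p_pr : prime p).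
Local Notation Zp := (padic_int p_pr).
Local Notation S := (powser Zp).

(** Multiplication by the variable satisfies a monic polynomial [q] over [Zp] on [X] modulo [Y]. The
    value of [q] at the variable is the required [g]: its leading coefficient 1 keeps [p] from
    dividing it. *)
Lemma fgen_killed (M : lmodType S) (X Y : M -> Prop) :
  submodule X -> submodule Y -> (forall x, Y x -> X x) ->
  @fgen _ _ (restr (@ps_const Zp) M) X Y ->
  exists2 g : S, ~ pdvd g & forall x, X x -> Y (g *: x).
Proof.
move=> sX sY YX [T [e0 [e0X /gspan_ord eS]]].
pose n := #|T|; pose e (i : 'I_n) : restr (@ps_const Zp) M := e0 (enum_val i).
have eX i : X (e i) := e0X (enum_val i).
have sYZ := submodule_restr (@ps_const Zp) sY.
have scaleC f a (x : M) : f *: (ps_const a *: x) = ps_const a *: (f *: x).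
  by rewrite !scalerA mulrC.
have u_lin : linear (fun x : restr (@ps_const Zp) M => psX _ *: (x : M) : restr (@ps_const Zp) M).
  move=> a x y; rewrite -[a *: x]/(ps_const a *: (x : M)) scalerDr; congr (_ + _).
  exact: scaleC.
have [||q q_mon qP] := @cayley_hamilton_gen Zp (restr (@ps_const Zp) M) Y (linear_pack u_lin) n e sYZ.
- by move=> x Yx; apply: submodZ.
- by move=> i; apply: eS; apply: submodZ.
have [m sq] : exists m, size q = m.+1.
  by exists (size q).-1; rewrite prednK // size_poly_gt0 monic_neq0.
have qm : q`_m = 1 by have /monicP := q_mon; rewrite /lead_coef sq.
rewrite sq in qP.
have iterE j (x : M) : iter j (linear_pack u_lin) x = psX _ ^+ j *: x.
  by elim: j => [|j IHj]; rewrite ?scale1r // iterS IHj exprS -scalerA.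
exists (\sum_(j < m.+1) ps_const q`_j * psX _ ^+ j).
  have coefE (j : 'I_m.+1) : pcoef (ps_const q`_j * psX _ ^+ j) m = if j == m :> nat then 1 else 0 : Zp.
    rewrite pcoef_const_mul -[psX _ ^+ j]mulr1 pcoefXn_mul -ltnS ltn_ord.
    have [->|jm] := eqVneq (j : nat) m; first by rewrite subnn qm mul1r.
    have ltjm : (j < m)%N by rewrite ltn_neqAle jm -ltnS ltn_ord.
    by rewrite -(subnSK ltjm) mulr0.
  move=> /pdvdP/(_ m)[y]; rewrite pcoef_sum; under eq_bigr do rewrite coefE.
  rewrite big_ord_recr big1 /= => [|j _]; last by rewrite ltn_eqF.
  by rewrite eqxx add0r => /eqP; apply/negP; apply: padic_p_nonunit.
move=> x Xx; have [c cP] := eS x Xx.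
set g := \sum_(j < _) _.
apply: (submod_trans sY (y := g *: (\sum_i c i *: e i : M))).
  by rewrite -scalerBr; apply: submodZ.
rewrite scaler_sumr; apply: submod_sum => // i _.
have -> : g *: (c i *: e i : M) = ps_const (c i) *: (g *: (e i : M)) by apply: scaleC.
apply: submodZ => //; rewrite /g scaler_suml.
have := qP i; congr Y; apply: eq_bigr => j _.
by rewrite iterE -scalerA.
Qed.

Section Complexes.
Variables (R : nzRingType) (iota : {rmorphism S -> R}).
Definition padic_restr (M : lmodType R) : lmodType Zp := restr (@ps_const Zp) (restr iota M).

Lemma submodule_padic (M : lmodType R) (Y : M -> Prop) :
  submodule Y -> @submodule _ (padic_restr M) Y.
Proof. by move=> sY; apply/submodule_restr/submodule_restr. Qed.

Definition coh_fgen (C : complex R) i := @fgen _ _ (padic_restr (C i)) (coc C i) (cob C i).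

(** Modulo [g P] the cocycles form a submodule of a finitely generated module. A cocycle of the form
    [g y] is a coboundary: [g] is injective in the next degree, so [y] is a cocycle too, and [g]
    kills its class. *)
Lemma killed_coh_fgen (P : complex R) i g : ~ pdvd g ->
  (forall s r, iota s * r = r * iota s) ->
  dual_basis (restr iota (P i)) -> dual_basis (restr iota (P (i + 1))) ->
  (forall z, coc P i z -> cob P i (iota g *: z)) -> coh_fgen P i.
Proof.
move=> ng iotaC dP dP1 kg; have fg := dual_basis_fgen dP ng.
pose gP (x : padic_restr (P i)) := exists y : P i, x = iota g *: y.
have sgP : submodule gP.
  apply: submodule_padic; split=> [|a _ _ [x ->] [y ->]].
    by exists 0; rewrite scaler0.
  by exists (a *: x + y); rewrite scalerDr !scalerA iotaC.
have sZ := submodule_padic (@submodule_coc _ P i).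
have sB := submodule_padic (@submodule_cob _ P i).
have [|||T [e [eX eS]]] := fgen_sub (X' := fun x : padic_restr (P i) =>
   exists u v, [/\ coc P i u, gP v & x = u + v]) _ sgP _ _ fg.
- exact: submodule_sum.
- by move=> x gx; exists 0, x; rewrite add0r; split=> //; apply: submod0 sZ.
- by [].
have /choice[f fP] t : exists f : padic_restr (P i), coc P i f /\ gP (e t - f).
  by have [u [v [uZ vg ->]]] := eX t; exists u; rewrite addrC addKr.
exists T, f; split=> [t|z zZ]; first by case: (fP t).
have [|c cP] := eS z.
  by exists z, 0; rewrite addr0; split=> //; apply: submod0 sgP.
exists c.
have [y yE] : gP (z - \sum_t c t *: f t).
  apply: (submod_sub_trans sgP cP); rewrite -sumrB; apply: submod_sum => // t _.
  by rewrite -scalerBr; apply: submodZ => //; case: (fP t).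
rewrite yE; apply: kg; apply: (dual_basis_inj dP1 ng).
have : coc P i (z - \sum_t c t *: f t).
  apply: (submodB sZ) => //; apply: submod_sum => // t _.
  by apply: (submodZ sZ); case: (fP t).
by rewrite yE /coc linearZ.
Qed.

Lemma quasi_iso_fgen (P C : complex R) (q : chain_map P C) i :
  quasi_iso q -> coh_fgen P i <-> coh_fgen C i.
Proof.
move=> qP; have q_lin : linear (q i : padic_restr (P i) -> padic_restr (C i)).
  by move=> a x y; rewrite raddfD /= linearZ.
apply: (fgen_iso (phi := linear_pack q_lin)).
- exact/submodule_padic/submodule_coc.
- exact/submodule_padic/submodule_cob.
- exact: chain_map_coc.
- exact: quasi_iso_cob.
- exact: quasi_iso_surj.
Qed.

Lemma quasi_iso_rank (P C : complex R) (q : chain_map P C) i : quasi_iso q ->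
  @rk _ (padic_restr (P i)) (coc P i) (cob P i) = @rk _ (padic_restr (C i)) (coc C i) (cob C i).
Proof.
move=> qP; have q_lin : linear (q i : padic_restr (P i) -> padic_restr (C i)).
  by move=> a x y; rewrite raddfD /= linearZ.
apply: (rk_iso (phi := linear_pack q_lin)).
- exact/submodule_padic/submodule_coc.
- exact/submodule_padic/submodule_cob.
- exact: chain_map_coc.
- exact: quasi_iso_cob.
- exact: quasi_iso_surj.
Qed.
End Complexes.
End Criterion.

Definition sum_pred (A : nzRingType) (M : lmodType A) (X Y : M -> Prop) (x : M) : Prop :=
  exists u v, [/\ X u, Y v & x = u + v].

Lemma submoduleT (A : nzRingType) (M : lmodType A) : submodule (fun _ : M => True).
Proof. by []. Qed.

(** * Ranks of square roots *)

Section Split.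
Variables (A : idomainType) (X : lmodType A) (g : {linear X -> X}).
Hypothesis g_inj : forall x, g x = 0 -> x = 0.

Definition kerp (u : {linear X -> X}) (x : X) : Prop := u x = 0.
Definition gmul (W : X -> Prop) (x : X) : Prop := exists2 y, W y & x = g y.

Lemma submodule_kerp u : submodule (kerp u).
Proof. by split=> [|a x y]; rewrite /kerp ?raddf0 // linearP => -> ->; rewrite scaler0 addr0. Qed.
Lemma submodule_gmul W : submodule W -> submodule (gmul W).
Proof. exact: submodule_image. Qed.

Hypothesis fin : finrk (fun=> True) (gmul (fun=> True)).

(** The condition on [W] means that [W] meets [g X] in [g W], so [W / g W] embeds into [X / g X]. *)
Lemma finrk_gmul W : submodule W -> (forall y, W (g y) -> W y) -> finrk W (gmul W).
Proof.
move=> sW gW; have sT := submodule_gmul (submoduleT X).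
apply/(finrk_iso (phi := idfun) (X' := sum_pred W (gmul (fun=> True))) (Y' := gmul (fun=> True))) => //.
- by move=> x Wx; exists x, 0; rewrite addr0; split=> //; apply: submod0.
- move=> x Wx; split=> [[y _ xE]|[y _ ->]]; last by exists y.
  by exists y => //; apply: gW; rewrite -xE.
- by move=> _ [u [v [Wu gv ->]]]; exists u; rewrite // addrC addKr.
by apply: (finrk_sub sT sT _ _ fin).
Qed.

(** [g] carries [W / g W] isomorphically onto [g W / g^2 W]. *)
Lemma rk_gmul_square (W : X -> Prop) : submodule W -> (forall y, W y -> W (g y)) ->
  (forall y, W (g y) -> W y) ->
  rk W (gmul (gmul W)) = (rk W (gmul W) + rk W (gmul W))%N.
Proof.
move=> sW Wg gW; have sgW := submodule_gmul sW; have sggW := submodule_gmul sgW.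
have E : rk (gmul W) (gmul (gmul W)) = rk W (gmul W).
  apply/esym/(rk_iso (phi := g)) => //.
  - by move=> x Wx; exists x.
  - move=> x Wx; split=> [[_ [y Wy ->] xE]|[y Wy ->]]; last by exists (g y) => //; exists y.
    exists y => //; apply/eqP; rewrite -subr_eq0; apply/eqP/g_inj.
    by rewrite raddfB /= xE subrr.
  - by move=> _ [y Wy ->]; exists y; rewrite // subrr; apply: submod0 sggW.
rewrite -{2}E; apply: has_rank_rk => //.
apply: (has_rank_add sggW (Y := gmul W)) => //.
- by move=> _ [y Wy ->]; apply: Wg.
- by move=> _ [_ [y Wy ->] ->]; exists (g y) => //; apply: Wg.
- by apply/rk_has_rank/finrk_gmul.
- apply/rk_has_rank; apply/(finrk_iso (phi := g) (X := W) (Y := gmul W)) => //.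
  - by move=> x Wx; exists x.
  - move=> x Wx; split=> [[_ [y Wy ->] xE]|[y Wy ->]]; last by exists (g y) => //; exists y.
    exists y => //; apply/eqP; rewrite -subr_eq0; apply/eqP/g_inj.
    by rewrite raddfB /= xE subrr.
  - by move=> _ [y Wy ->]; exists y; rewrite // subrr; apply: submod0 sggW.
  - exact: finrk_gmul.
Qed.

Variables e f : {linear X -> X}.
Hypotheses (efE : forall x, e x + f x = x) (efK : forall x, e (f x) = 0).
Hypothesis ge : forall x, g (e x) = e (g x).

Lemma feK x : f (e x) = 0.
Proof.
have exx : e (e x) = e x by rewrite -[in RHS](efE x) raddfD /= efK addr0.
by apply: (addrI (e (e x))); rewrite efE exx addr0.
Qed.

Lemma gf x : g (f x) = f (g x).
Proof.
by apply: (addrI (g (e x))); rewrite -raddfD /= efE ge efE.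
Qed.

Lemma kerp_g u y : (u = e \/ u = f) -> kerp u (g y) -> kerp u y.
Proof. by move=> uef ugy; apply: g_inj; case: uef ugy => ->; rewrite (ge, gf). Qed.

Lemma rk_gmul_parts : rk (fun=> True) (gmul (fun=> True)) =
  (rk (kerp e) (gmul (kerp e)) + rk (kerp f) (gmul (kerp f)))%N.
Proof.
have sT := submodule_gmul (submoduleT X).
have sE := submodule_kerp e; have sF := submodule_kerp f.
rewrite (rk_add (Y := sum_pred (kerp e) (gmul (fun=> True)))) //; last first.
- by move=> x gx; exists 0, x; rewrite add0r; split=> //; apply: submod0 sE.
- exact: submodule_sum.
rewrite addnC; congr (_ + _)%N.
- apply/esym/(rk_iso (phi := idfun)) => //.
  + by move=> x Wx; exists x, 0; rewrite addr0; split=> //; apply: submod0 sT.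
  + move=> x Wx; split=> [[y _ xE]|[y _ ->]]; last by exists y.
    by exists y => //; apply: (kerp_g (u := e)); [left|rewrite -xE].
  + by move=> _ [u [v [Wu gv ->]]]; exists u; rewrite // addrC addKr.
- apply/esym/(rk_iso (phi := idfun)) => //.
  + exact: submodule_sum.
  + move=> x fx; split=> [[u [_ [eu [y _ ->] /= xE]]]|[y fy ->]].
      exists (e y); first exact: feK.
      by rewrite -[x]efE fx addr0 xE raddfD /= eu add0r ge.
    by exists 0, (g y); rewrite add0r; split; [exact: submod0 sE|exists y|].
  + move=> x _; exists (e x); first exact: feK.
    exists (f x), 0; rewrite addr0; split; [exact: efK|exact: submod0 sT|].
    by rewrite -{1}[x]efE addrC addKr.
Qed.

End Split.

(* A differential module [(X, d)] with a square-zero homotopy [h] from [g] to [0],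
   for a grading by [Z/2] in which [ker f] is the part on which [e] is the identity
   and vice versa. Then [d + h] is a square root of [g], exchanging the two parts. *)
Section Folded.
Variables (A : idomainType) (X : lmodType A) (d h g e f : {linear X -> X}).
Hypotheses (efE : forall x, e x + f x = x) (efK : forall x, e (f x) = 0).
Hypotheses (de : forall x, d (e x) = f (d x)) (df : forall x, d (f x) = e (d x)).
Hypotheses (he : forall x, h (e x) = f (h x)) (hf : forall x, h (f x) = e (h x)).
Hypotheses (dd : forall x, d (d x) = 0) (hh : forall x, h (h x) = 0).
Hypothesis gE : forall x, g x = d (h x) + h (d x).
Hypothesis g_inj : forall x, g x = 0 -> x = 0.

Definition zpart (u : {linear X -> X}) (x : X) : Prop := u x = 0 /\ d x = 0.
Definition bpart (u : {linear X -> X}) (x : X) : Prop := exists2 y, u y = 0 & x = d y.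
Definition dhpart (u : {linear X -> X}) (x : X) : Prop := exists2 y, u y = 0 & x = d y + h y.
Local Notation gmul := (gmul g).
Hypothesis fin : finrk (fun=> True) (gmul (fun=> True)).

Lemma submodule_zpart u : submodule (zpart u).
Proof.
split=> [|a x y [ux dx] [uy dy]]; first by rewrite /zpart !raddf0.
by rewrite /zpart !linearP ux dx uy dy scaler0 addr0.
Qed.
Lemma submodule_bpart u : submodule (bpart u).
Proof. exact: submodule_image (submodule_kerp u). Qed.
Lemma submodule_dhpart u : submodule (dhpart u).
Proof. exact: (submodule_image (d \+ h) (submodule_kerp u)). Qed.
Lemma gd x : g (d x) = d (g x).
Proof. by rewrite (gE (d x)) dd raddf0 addr0 gE raddfD /= dd add0r. Qed.
Lemma ge_folded x : g (e x) = e (g x).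
Proof. by rewrite !gE de hf he df raddfD. Qed.

Lemma zpart_g u y : (u = e \/ u = f) -> zpart u (g y) -> zpart u y.
Proof. by move=> uef [/(kerp_g g_inj efE ge_folded uef) uy dgy]; split=> //; apply: g_inj; rewrite gd. Qed.

Lemma dh0 x : d (h x) = 0 -> h x = 0.
Proof. by move=> dhx; apply: g_inj; rewrite gE hh dhx !raddf0 addr0. Qed.

(** Write D for [d + h]. Then [g (ker e)] lies in [D (ker f)], which lies in [ker e], and the
    injective D carries [ker f / D (ker e)] onto [D (ker f) / g (ker e)]. *)
Lemma rk_square_root : rk (kerp e) (gmul (kerp e)) =
  (rk (kerp e) (dhpart f) + rk (kerp f) (dhpart e))%N.
Proof.
have sE := submodule_kerp e; have sF := submodule_kerp f.
have DD x : d (d x + h x) + h (d x + h x) = g x.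
  by rewrite !raddfD /= dd hh add0r addr0 gE.
have eD x : e (d x + h x) = d (f x) + h (f x) by rewrite raddfD /= df hf.
have fD x : f (d x + h x) = d (e x) + h (e x) by rewrite raddfD /= de he.
have D0 x : d x + h x = 0 -> x = 0.
  by move=> Dx; apply: g_inj; rewrite -DD Dx !raddf0 addr0.
rewrite (rk_add (Y := dhpart f)).
- congr (_ + _)%N; apply/esym/(rk_iso (phi := d \+ h)) => //.
  + exact: submodule_gmul.
  + by move=> x fx; exists x.
  + move=> x fx; split=> [[y ey /= xE]|[y ey ->]] /=; last by exists y; rewrite // DD.
    exists y => //; apply/eqP; rewrite -subr_eq0; apply/eqP/D0.
    by rewrite !raddfB /= addrACA xE -opprD DD subrr.
  + by move=> _ [y fy ->]; exists y => //=; rewrite subrr; apply: submod0; apply: submodule_gmul.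
- exact: submodule_dhpart.
- exact: submodule_gmul.
- by move=> _ [y fy ->]; rewrite /kerp eD fy !raddf0 addr0.
- move=> _ [y ey ->]; exists (d y + h y); last by rewrite DD.
  by rewrite fD ey !raddf0 addr0.
- by apply: (finrk_gmul fin) => // y; apply: (kerp_g g_inj efE ge_folded); left.
Qed.

(** The cokernel of [d + h] on [ker e] and the quotient [ker d / g ker d] on the part [ker f] have
    filtrations sharing two pieces: [d (ker e) / d h (ker f)], and [ker f] modulo its elements
    killed by [d] plus those killed by [h] ([U]). The second piece arises through [d] in one
    filtration ([E5]) and through [d h] in the other ([E8]). What remains is the cohomology of the
    two parts. *)
Lemma rk_folded : (rk (kerp e) (dhpart f) + rk (zpart f) (bpart e) =
  rk (zpart f) (gmul (zpart f)) + rk (zpart e) (bpart f))%N.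
Proof.
pose U x := f x = 0 /\ h x = 0.
have sU : submodule U.
  split=> [|a x y [ux dx] [uy dy]]; first by rewrite /U !raddf0.
  by rewrite /U !linearP ux dx uy dy scaler0 addr0.
pose dU x := exists2 y, U y & x = d y.
have sdU : submodule dU by apply: submodule_image.
pose dhX x := exists2 y, kerp f y & x = d (h y).
have sdhX : submodule dhX by apply: (submodule_image (d \o h) (submodule_kerp f)).
have sE := submodule_kerp e; have sF := submodule_kerp f.
have sZe := submodule_zpart e; have sZf := submodule_zpart f.
have sBe := submodule_bpart e; have sBf := submodule_bpart f.
have sD := submodule_dhpart f.
have sgZ : submodule (gmul (zpart f)) by apply: submodule_gmul.
have sgZe : submodule (gmul (zpart e)) by apply: submodule_gmul.
have sZD : submodule (sum_pred (zpart e) (dhpart f)) by apply: submodule_sum.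
have sZU : submodule (sum_pred (zpart f) U) by apply: submodule_sum.
have finZf : finrk (zpart f) (gmul (zpart f)).
  by apply: (finrk_gmul fin) => // y; apply: zpart_g; right.
have finZe : finrk (zpart e) (gmul (zpart e)).
  by apply: (finrk_gmul fin) => // y; apply: zpart_g; left.
have finE : finrk (kerp e) (gmul (kerp e)).
  by apply: (finrk_gmul fin) => // y; apply: (kerp_g g_inj efE ge_folded); left.
have gED x : gmul (kerp e) x -> dhpart f x.
  move=> [y ey ->]; exists (d y + h y).
    by rewrite raddfD /= -de -he ey !raddf0 addr0.
  by rewrite !raddfD /= dd hh add0r addr0 gE.
have Dk x : dhpart f x -> kerp e x.
  by move=> [y fy ->]; rewrite /kerp raddfD /= -df -hf fy !raddf0 addr0.
have gdh z : d z = 0 -> g z = d (h z) by move=> dz; rewrite gE dz raddf0 addr0.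
have E1 : rk (kerp e) (dhpart f) =
    (rk (kerp e) (sum_pred (zpart e) (dhpart f)) + rk (sum_pred (zpart e) (dhpart f)) (dhpart f))%N.
  apply: rk_add => //.
  - by move=> _ [u [v [[eu _] /Dk ev ->]]]; rewrite /kerp raddfD /= eu ev addr0.
  - by move=> x Dx; exists 0, x; rewrite add0r; split=> //; apply: submod0 sZe.
  - exact: (finrk_sub (submodule_gmul g sE) sD _ gED finE).
have E2 : rk (kerp e) (sum_pred (zpart e) (dhpart f)) = rk (bpart e) dhX.
  apply: (rk_iso (phi := d)) => //.
  - by move=> x ex; exists x.
  - move=> x ex; split=> [[y fy dxE]|[u [v [[_ du] [y fy ->] ->]]]].
      exists (x - (d y + h y)), (d y + h y); rewrite subrK; split=> //; last by exists y.
      split; first by rewrite raddfB /= ex raddfD /= -df -hf fy !raddf0 addr0 subr0.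
      by rewrite raddfB raddfD /= dxE dd add0r subrr.
    by exists y; rewrite // !raddfD /= du dd !add0r.
  - by move=> _ [y ey ->]; exists y; rewrite // subrr; apply: submod0 sdhX.
have E3 : rk (sum_pred (zpart e) (dhpart f)) (dhpart f) = rk (zpart e) dU.
  apply/esym/(rk_iso (phi := idfun)) => //.
  - by move=> x Zx; exists x, 0; rewrite addr0; split=> //; apply: submod0 sD.
  - move=> x [ex dx]; split=> [[y fy xE]|[y [fy hy] ->]].
      have hy : h y = 0.
        by apply: dh0; have := congr1 d xE; rewrite /= dx raddfD /= dd add0r.
      by exists y; rewrite // -[x]/(idfun x) xE hy addr0.
    by exists y; rewrite // hy addr0.
  - by move=> _ [u [v [Zu Dv ->]]]; exists u; rewrite // addrC addKr.
have E4 : rk (zpart e) dU = (rk (zpart e) (bpart f) + rk (bpart f) dU)%N.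
  apply: rk_add => //.
  - by move=> _ [y fy ->]; split; [rewrite -df fy raddf0|rewrite dd].
  - by move=> _ [y [fy _] ->]; exists y.
  - apply: (finrk_sub sgZe sdU _ _ finZe) => // _ [z [ez dz] ->].
    exists (h z); last exact: gdh.
    by split; rewrite ?hh // -he ez raddf0.
have E5 : rk (bpart f) dU = rk (kerp f) (sum_pred (zpart f) U).
  apply/esym/(rk_iso (phi := d)) => //.
  - by move=> x fx; exists x.
  - move=> x fx; split=> [[u [fu hu] dxu]|[z [u [[_ dz] Uu ->]]]].
      exists (x - u), u; rewrite subrK; split=> //.
      by split; rewrite raddfB /= ?fx ?fu ?subrr // dxu subrr.
    by exists u; rewrite // raddfD /= dz add0r.
  - by move=> _ [y fy ->]; exists y; rewrite // subrr; apply: submod0 sdU.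
have E6 : rk (zpart f) (gmul (zpart f)) = (rk (zpart f) (bpart e) + rk (bpart e) (gmul (zpart f)))%N.
  apply: rk_add => //.
  - by move=> _ [y ey ->]; split; [rewrite -de ey raddf0|rewrite dd].
  - move=> _ [z [fz dz] ->]; exists (h z); last exact: gdh.
    by rewrite -hf fz raddf0.
have E7 : rk (bpart e) (gmul (zpart f)) = (rk (bpart e) dhX + rk dhX (gmul (zpart f)))%N.
  apply: rk_add => //.
  - by move=> _ [y fy ->]; exists (h y); rewrite // -hf fy raddf0.
  - by move=> _ [z [fz dz] ->]; exists z; rewrite // gdh.
  - apply: (finrk_sub sgZ sgZ _ _ finZf) => //.
    by move=> _ [y ey ->]; split; [rewrite -de ey raddf0|rewrite dd].
have E8 : rk dhX (gmul (zpart f)) = rk (kerp f) (sum_pred (zpart f) U).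
  apply/esym/(rk_iso (phi := d \o h)) => //.
  - by move=> x fx; exists x.
  - move=> x fx; split=> [[z [fz dz] /= xz]|[z [u [[fz dz] [fu hu] ->]]]].
      exists z, (x - z); split=> //; last (by rewrite addrC subrK); split; first by rewrite raddfB /= fx fz subrr.
      by apply: dh0; rewrite !raddfB /= xz gdh // subrr.
    by exists z; rewrite //= !raddfD /= hu raddf0 addr0 gdh.
  - by move=> _ [y fy ->]; exists y; rewrite // subrr; apply: submod0 sgZ.
rewrite E1 E2 E3 E4 E5 E6 E7 E8.
lia.
Qed.

End Folded.

Section PadicRestr.
Variables (p : nat) (p_pr : prime p) (R : nzRingType).
Variable iota : {rmorphism powser (padic_int p_pr) -> R}.
Hypothesis iotaC : forall s r, iota s * r = r * iota s.
Local Notation ZM := (padic_restr iota).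

Lemma padic_scaleE (M : lmodType R) (c : padic_int p_pr) (x : ZM M) :
  c *: x = iota (ps_const c) *: (x : M).
Proof. by []. Qed.

Lemma padic_nat_scaleE (M : lmodType R) k (x : ZM M) :
  (k%:R : padic_int p_pr) *: x = (k%:R : R) *: (x : M).
Proof. by rewrite padic_scaleE !rmorph_nat. Qed.

Lemma padic_map_linear (M N : lmodType R) (u : {linear M -> N}) :
  linear (u : ZM M -> ZM N).
Proof. by move=> a x y; rewrite raddfD /= linearZ. Qed.

Definition padic_map (M N : lmodType R) (u : {linear M -> N}) : {linear ZM M -> ZM N} :=
  linear_pack (padic_map_linear u).

Lemma scalar_linear (M : lmodType R) g : linear (fun x : M => iota g *: x).
Proof. by move=> a x y; rewrite scalerDr !scalerA iotaC. Qed.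

Definition scalar_map (M : lmodType R) g : {linear M -> M} := linear_pack (@scalar_linear M g).
End PadicRestr.

(** * Ranks of coinvariants *)

Section CoinvariantRank.
Variables (p : nat) (p_pr : prime p) (L : nzRingType).
Variable psi : {rmorphism powser (padic_int p_pr) -> L}.
Variable G : finGroupType.
Hypothesis pG : (p.-group [set: G])%g.
Local Notation Zp := (padic_int p_pr).
Local Notation R := (group_ring L G).
Local Notation aug := (@augmentation L G).
Local Notation iota := (@gr_const L G \o psi).
Hypothesis iotaC : forall s r, iota s * r = r * iota s.
Variables (X : lmodType R) (Xb : lmodType L) (pi : {linear X -> restr aug Xb}).
Hypothesis piP : aug_pair pi.
Local Notation XZ := (padic_restr iota X).
Local Notation XbZ := (padic_restr psi Xb).

Lemma aug_pair_padic_linear : linear (pi : XZ -> XbZ).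
Proof.
move=> a x y; rewrite raddfD /= padic_scaleE aug_pairZ /= augmentation_const.
by [].
Qed.

(* Lift generators of the coinvariants: they generate [W / F] over [Zp[G]] modulo
   [I W], hence modulo [I ^ k W] for all [k], hence modulo [p W]; conclude by
   Nakayama's lemma. *)
Lemma rank_coinvariants (W F : X -> Prop) (E : {linear X -> X}) (Wb Fb : Xb -> Prop) :
  submodule W -> submodule F -> submodule Wb -> submodule Fb ->
  (forall x, W (E x)) -> (forall x, W x -> E x = x) -> (forall x, F x -> W x) ->
  (forall x, W x -> Wb (pi x)) -> (forall y, Wb y -> exists2 x, W x & pi x = y) ->
  (forall x, F x -> Fb (pi x)) -> (forall y, Fb y -> exists2 x, F x & pi x = y) ->
  @fgen _ _ XZ W F ->
  (forall y, Wb y -> Fb ((p%:R : L) *: y) -> Fb y) ->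
  (@rk _ XZ W F <= #|G| * @rk _ XbZ Wb Fb)%N.
Proof.
move=> sW sF sWb sFb WE EW FW WWb WbW FFb FbF fgW tf.
have sWZ := submodule_padic iota sW; have sFZ := submodule_padic iota sF.
have sWbZ := submodule_padic psi sWb; have sFbZ := submodule_padic psi sFb.
pose piZ : {linear XZ -> XbZ} := linear_pack aug_pair_padic_linear.
have fgWb : @fgen _ _ XbZ Wb Fb.
  have [T [e [eW eS]]] := fgW; exists T, (piZ \o e); split=> [t|y /WbW[x Wx <-]]; first exact: WWb.
  have [c cP] := eS x Wx; exists c; have := FFb _ cP.
  by rewrite -[pi _]/(piZ _) linearB linear_sum; congr (Fb (_ - _)); apply: eq_bigr => t _; rewrite linearZ.
(* Here [tf] makes the number of generators to be lifted equal to the rank on the right-hand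
   side. *)
have [|T [e [eI eS]]] := torsionfree_basis sWbZ sFbZ fgWb.
  by move=> y Wy; rewrite padic_nat_scaleE; apply: tf.
have -> : @rk _ XbZ Wb Fb = #|T|.
  by apply: has_rank_rk => //; exists T, e; split=> //; apply: gspan_tspan.
have /choice[x xP] t : exists x, W x /\ pi x = e t.
  by have [x Wx xE] := WbW _ (eI.1 t); exists x.
pose f (k : G * T) : XZ := gr_of L k.1 *: x k.2.
pose N (y : XZ) := exists c : G * T -> Zp, F (y - \sum_k c k *: f k).
have NF y : F y -> N y.
  by move=> Fy; exists (fun=> 0); rewrite big1 ?subr0 // => k _; rewrite scale0r.
have sN : submodule N.
  split=> [|a y z [c cP] [d dP]]; first by apply: NF; apply: submod0 sF.
  exists (fun k => a * c k + d k); under eq_bigr do rewrite scalerDl -scalerA.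
  rewrite big_split -scaler_sumr /= opprD addrACA -scalerBr; exact: (proj2 sFZ).
have Nf k : N (f k).
  exists (fun j => (j == k)%:R); rewrite (bigD1 k) //= eqxx scale1r big1 ?addr0 ?subrr.
    exact: submod0 sF.
  by move=> j /negPf ->; rewrite scale0r.
have NG s y : N y -> N (gr_of L s *: (y : X)).
  move=> [c cP]; rewrite -[y : X](subrK (\sum_k c k *: f k : XZ)) scalerDr.
  apply: (submodD sN); first by apply: NF; apply: submodZ.
  rewrite scaler_sumr; apply: (submod_sum sN) => k _.
  have -> : gr_of L s *: (c k *: f k : X) = c k *: f (s * k.1, k.2)%g.
    by rewrite /f /= gr_ofM !padic_scaleE !scalerA !mulrA iotaC.
  by apply: submodZ.
have NG1 s y : N y -> N ((gr_of L s - 1) *: (y : X)).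
  by move=> Ny; rewrite scalerBl scale1r; apply: (submodB sN) => //; apply: NG.
(* The error [t] lies in [W] and in [I X], but is recorded as [E t]: its successors below are only
   known to lie in [I ^ k X], and the projector [E] brings them back into [W]. *)
have N0 y : W y -> exists2 t, augpow 1 t & N (y - E t).
  move=> Wy; have [c] := eS _ (WWb _ Wy).
  set Sb := \sum_i _ => /FbF[w Fw wE].
  pose Sx : XZ := \sum_i c i *: (x i : XZ).
  have WS : W Sx by apply: (submod_sum sWZ) => i _; apply: (submodZ sWZ); case: (xP i).
  pose t : X := y - Sx - w.
  have Wt : W t by apply: (submodB sW); [apply: (submodB sW)|apply: FW].
  exists t.
    apply: (proj2 piP); rewrite -[pi _]/(piZ _) !raddfB /=.
    have -> : piZ Sx = Sb.
      rewrite linear_sum; apply: eq_bigr => i _; rewrite linearZ; congr (_ *: _).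
      by case: (xP i).
    by rewrite -[piZ w]/(pi w) wE subrr.
  rewrite (EW _ Wt) /t -addrA -opprD opprB addrC subrK.
  apply: (submodD sN); last exact: NF.
  apply: (submod_sum sN) => i _; apply: (submodZ sN).
  by have := Nf (1%g, i); rewrite /f gr_of1 scale1r.
have Nk k t : augpow k t -> exists2 t', augpow k.+1 t' & N (E t - E t').
  elim: k t => [|k IHk] t; first by move=> _; apply: N0.
  elim=> [|s y z /IHk[y' ky' yy'] _ [z' kz' zz']].
    by exists 0; [exact: AugSpan0|rewrite subrr; apply: submod0 sN].
  exists ((gr_of L s - 1) *: y' + z'); first exact: AugSpanD.
  rewrite [E (_ + z)]raddfD [E (_ + z')]raddfD /= [E (_ *: y)]linearZ [E (_ *: y')]linearZ /= opprD addrACA -scalerBr.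
  by apply: (submodD sN) => //; apply: NG1.
have Npow k y : W y -> exists2 t, augpow k t & N (y - E t).
  move=> Wy; elim: k => [|k [t kt yt]].
    by exists y => //; rewrite EW // subrr; apply: submod0 sN.
  have [t' kt' tt'] := Nk _ _ kt; exists t' => //.
  exact: (submod_sub_trans sN yt tt').
have WN y : W y -> N y.
  apply: (nakayama sWZ sN).
    have [T' [e' [e'W e'S]]] := fgW; exists T', e'; split=> // z Wz.
    by have [c cP] := e'S z Wz; exists c; apply: NF.
  have [K KP] := aug_nilpotent X p_pr pG.
  (* For exponent [K] the error lies in [p X], and applying [E] puts it into [p W], as Nakayama's
     lemma requires. *)
  move=> z Wz; have [t /KP[u ->] zt] := Npow K z Wz.
  by exists (E u); [exact: WE|rewrite padic_nat_scaleE -linearZ].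
have finW : finrk (W : XZ -> Prop) F by apply: fgen_finrk.
rewrite -card_prod; apply: (rank_le_tspan sFZ (rk_has_rank finW) (e := f)).
by apply: gspan_tspan => y /WN.
Qed.
End CoinvariantRank.

Lemma row_projective (R : nzRingType) n : projective 'rV[R]_n.
Proof.
move=> M N g h g_surj.
have /choice[m mP] i : exists m, g m = h (delta_mx 0 i) by apply: g_surj.
have k_lin : linear (fun v : 'rV[R]_n => \sum_i v 0 i *: m i).
  move=> a u v; rewrite scaler_sumr -big_split /=; apply: eq_bigr => i _.
  by rewrite !mxE scalerDl scalerA.
exists (linear_pack k_lin) => v; rewrite [in RHS](row_sum_delta v) !linear_sum.
by apply: eq_bigr => i _; rewrite !linearZ /= mP.
Qed.

Lemma row_fin_gen (R : nzRingType) n : fin_gen 'rV[R]_n.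
Proof.
by exists n, (fun i => delta_mx 0 i) => v; exists (fun i => v 0 i); apply: row_sum_delta.
Qed.

Lemma projective_retract (R : nzRingType) (X : lmodType R) : fin_gen X -> projective X ->
  exists n (s : {linear X -> 'rV[R]_n}) (r : {linear 'rV[R]_n -> X}), cancel s r.
Proof.
move=> [n [e eP]] prX.
have r_lin : linear (fun v : 'rV[R]_n => \sum_i v 0 i *: e i).
  move=> a u v; rewrite scaler_sumr -big_split /=; apply: eq_bigr => i _.
  by rewrite !mxE scalerDl scalerA.
have [|s sP] := prX _ _ (linear_pack r_lin) idfun.
  move=> y; have [c ->] := eP y; exists (\row_i c i).
  by apply: eq_bigr => i _; rewrite mxE.
by exists n, s, (linear_pack r_lin).
Qed.

Section AugRow.
Variables (L : nzRingType) (G : finGroupType) (n : nat).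
Local Notation R := (group_ring L G).
Local Notation aug := (@augmentation L G).

Lemma aug_row_linear : linear (map_mx aug : 'rV[R]_n -> restr aug 'rV[L]_n).
Proof.
move=> a u v; rewrite map_mxD map_mxZ.
by [].
Qed.
Definition aug_row : {linear 'rV[R]_n -> restr aug 'rV[L]_n} := linear_pack aug_row_linear.

Lemma aug_row_pair : aug_pair aug_row.
Proof.
split=> [y|v /rowP v0].
  exists (map_mx (@gr_const L G) y); apply/rowP => i.
  by rewrite !mxE augmentation_const.
rewrite (row_sum_delta v); apply: big_ind => [|u w|i _]; [exact: AugSpan0|exact: augspanD|].
by apply: augspan_kernel; have := v0 i; rewrite !mxE.
Qed.
End AugRow.

Lemma fgen_split (p : nat) (p_pr : prime p) (X : lmodType (padic_int p_pr))
    (g e f : {linear X -> X}) :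
  (forall x, e x + f x = x) -> (forall x, e (f x) = 0) -> (forall x, g (e x) = e (g x)) ->
  fgen (fun=> True) (gmul g (fun=> True)) -> fgen (kerp e) (gmul g (kerp e)).
Proof.
move=> efE efK ge [T [b [_ bS]]]; exists T, (f \o b); split=> [t|x ex]; first exact: efK.
have [c [y _ yE]] := bS x I; exists c, (f y); first exact: efK.
rewrite (gf efE ge) -yE raddfB /= [f (\sum_i _)]linear_sum -[in LHS](efE x) ex add0r.
by congr (_ - _); apply: eq_bigr => t _; rewrite linearZ.
Qed.

Section AugPairRank.
Variables (p : nat) (p_pr : prime p) (L : nzRingType).
Variable psi : {rmorphism powser (padic_int p_pr) -> L}.
Variable G : finGroupType.
Hypothesis pG : (p.-group [set: G])%g.
Local Notation Zp := (padic_int p_pr).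
Local Notation R := (group_ring L G).
Local Notation aug := (@augmentation L G).
Local Notation iota := (@gr_const L G \o psi).
Hypothesis iotaA : finite_free_algebra iota.
Hypothesis psiA : finite_free_algebra psi.
Variable g : powser Zp.
Hypothesis ng : ~ pdvd g.
Let iotaC := iotaA.1.
Let psiC := psiA.1.

Definition gR (X : lmodType R) := padic_map iota (scalar_map iotaC X g).
Definition gL (X : lmodType L) := padic_map psi (scalar_map psiC X g).

Lemma gR_inj (X : lmodType R) : dual_basis (restr iota X) -> forall x, gR X x = 0 -> x = 0.
Proof. by move=> dX x; apply: (dual_basis_inj dX ng). Qed.
Lemma gL_inj (X : lmodType L) : dual_basis (restr psi X) -> forall x, gL X x = 0 -> x = 0.
Proof. by move=> dX x; apply: (dual_basis_inj dX ng). Qed.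

Lemma gR_fgen (X : lmodType R) : dual_basis (restr iota X) ->
  fgen (fun=> True) (gmul (gR X) (fun=> True)).
Proof.
move=> dX; have := dual_basis_fgen dX ng; congr (fgen _ _).
by apply/funext => x; apply/propext; split=> [[y ->]|[y _ ->]]; exists y.
Qed.
Lemma gL_fgen (X : lmodType L) : dual_basis (restr psi X) ->
  fgen (fun=> True) (gmul (gL X) (fun=> True)).
Proof.
move=> dX; have := dual_basis_fgen dX ng; congr (fgen _ _).
by apply/funext => x; apply/propext; split=> [[y ->]|[y _ ->]]; exists y.
Qed.

Section Pair.
Variables (X : lmodType R) (Xb : lmodType L) (pi : {linear X -> restr aug Xb}).
Hypothesis piP : aug_pair pi.
Hypotheses (dX : dual_basis (restr iota X)) (dXb : dual_basis (restr psi Xb)).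
Variables (e f : {linear X -> X}) (eb fb : {linear Xb -> Xb}).
Hypotheses (efE : forall x, e x + f x = x) (efK : forall x, e (f x) = 0).
Hypotheses (ebP : forall x, eb (pi x) = pi (e x)) (fbP : forall x, fb (pi x) = pi (f x)).
Local Notation zR := (padic_map iota).
Local Notation zL := (padic_map psi).

Lemma pi_ind (Q : Xb -> Prop) : (forall x, Q (pi x)) -> forall y, Q y.
Proof. by move=> Qpi y; have [x <-] := piP.1 y. Qed.

Lemma ebfbE y : eb y + fb y = y.
Proof. by elim/pi_ind: y => x; rewrite ebP fbP -raddfD efE. Qed.
Lemma ebfbK y : eb (fb y) = 0.
Proof. by elim/pi_ind: y => x; rewrite fbP ebP efK raddf0. Qed.

Lemma pi_scale s x : pi (iota s *: x) = psi s *: (pi x : Xb).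
Proof. by rewrite aug_pairZ /= augmentation_const. Qed.

Lemma nat_psi_scale k (y : Xb) : (k%:R : L) *: y = (k%:R : powser Zp) *: (y : restr psi Xb).
Proof. by rewrite -(rmorph_nat psi). Qed.

Lemma eb_p_inj y : eb ((p%:R : L) *: y) = 0 -> eb y = 0.
Proof. by rewrite linearZ /= nat_psi_scale => /(dual_basis_p_inj dXb). Qed.

Lemma kerp_eb y : eb y = 0 -> exists2 x, e x = 0 & pi x = y.
Proof.
have [x <-] := piP.1 y; rewrite ebP => ex; exists (f x); first exact: efK.
by rewrite -[x in RHS]efE raddfD /= ex add0r.
Qed.

(** [rank_coinvariants] for the summand [W = ker e] and [F = g W]. Its torsion condition holds
    because [p y = g z] forces [p] to divide [z], [g] being injective modulo [p]. *)
Lemma rank_split :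
  (rk (kerp (zR e)) (gmul (gR X) (kerp (zR e))) <=
   #|G| * rk (kerp (zL eb)) (gmul (gL Xb) (kerp (zL eb))))%N.
Proof.
have eg x : iota g *: e x = e (iota g *: x) by rewrite linearZ.
have ebg y : psi g *: eb y = eb (psi g *: y) by rewrite linearZ.
apply: (rank_coinvariants pG iotaC piP (E := f)).
- by split=> [|a x y]; rewrite /kerp /= ?raddf0 // linearP => -> ->; rewrite scaler0 addr0.
- split=> [|a _ _ [x ex ->] [y ey ->]]; first by exists 0; rewrite /kerp /= ?raddf0 ?scaler0.
  exists (a *: x + y); first by move: ex ey; rewrite /kerp /= linearP => -> ->; rewrite scaler0 addr0.
  by rewrite /= scalerDr !scalerA iotaC.
- by split=> [|a x y]; rewrite /kerp /= ?raddf0 // linearP => -> ->; rewrite scaler0 addr0.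
- split=> [|a _ _ [x ex ->] [y ey ->]]; first by exists 0; rewrite /kerp /= ?raddf0 ?scaler0.
  exists (a *: x + y); first by move: ex ey; rewrite /kerp /= linearP => -> ->; rewrite scaler0 addr0.
  by rewrite /= scalerDr !scalerA psiC.
- exact: efK.
- by move=> x; rewrite /kerp /= => ex; rewrite -[RHS]efE ex add0r.
- by move=> _ [x ex ->]; rewrite /kerp /= -eg; move: ex; rewrite /kerp /= => ->; rewrite scaler0.
- by move=> x; rewrite /kerp /= ebP => ->; rewrite raddf0.
- exact: kerp_eb.
- move=> _ [x ex ->]; exists (pi x); last by rewrite /= pi_scale.
  by move: ex; rewrite /kerp /= ebP => ->; rewrite raddf0.
- move=> _ [y /kerp_eb[x ex <-] ->]; exists (iota g *: x); first by exists x.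
  by rewrite /= pi_scale.
- exact: (@fgen_split _ _ _ (gR X) (zR e) (zR f) efE efK eg (gR_fgen dX)).
- move=> y ey [z ez /= pz].
  have [|w zw] := @dual_basis_pdvd _ _ _ dXb _ (z : restr psi Xb) y ng.
    by rewrite -nat_psi_scale pz.
  have {zw} zw : z = (p%:R : L) *: w by rewrite nat_psi_scale.
  exists w; first by move: ez; rewrite /kerp /= zw => /eb_p_inj.
  apply/eqP; rewrite -subr_eq0; apply/eqP/(dual_basis_p_inj dXb).
  by rewrite -nat_psi_scale scalerBr pz zw /= !scalerA psiC subrr.
Qed.
End Pair.
End AugPairRank.

Section ProjectiveRank.
Variables (p : nat) (p_pr : prime p) (L : nzRingType).
Variable psi : {rmorphism powser (padic_int p_pr) -> L}.
Variable G : finGroupType.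
Hypothesis pG : (p.-group [set: G])%g.
Local Notation Zp := (padic_int p_pr).
Local Notation R := (group_ring L G).
Local Notation aug := (@augmentation L G).
Local Notation iota := (@gr_const L G \o psi).
Hypothesis iotaA : finite_free_algebra iota.
Hypothesis psiA : finite_free_algebra psi.
Variable g : powser Zp.
Hypothesis ng : ~ pdvd g.
Local Notation zR := (padic_map iota).
Local Notation zL := (padic_map psi).
Local Notation gR := (gR iotaA g).
Local Notation gL := (gL psiA g).

Definition gcoef_row n (s : G) (v : padic_restr iota 'rV[R]_n) : padic_restr psi 'rV[L]_n :=
  \row_i gcoef (v 0 i) s.

Lemma gcoef_row_linear n s : linear (@gcoef_row n s).
Proof.
move=> a u v; rewrite !padic_scaleE; apply/rowP => i.
by rewrite !mxE [LHS]ffunE gr_const_mul.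
Qed.

(** Over [L], the free module of rank [n] over the group ring is a direct sum of copies of [L^n]
    indexed by [G], and [g] acts on each copy. So the translates by [G] of an independent family of
    [L^n / g L^n] stay independent; [gcoef_row s] isolates the copy at [s]. *)
Lemma row_rank_ge n :
  (#|G| * rk (fun=> True) (gmul (gL 'rV[L]_n) (fun=> True)) <=
   rk (fun=> True) (gmul (gR 'rV[R]_n) (fun=> True)))%N.
Proof.
have dF := dual_basis_restr iotaA (@row_fin_gen R n) (@row_projective R n).
have dFb := dual_basis_restr psiA (@row_fin_gen L n) (@row_projective L n).
have sF : submodule (gmul (gR 'rV[R]_n) (fun=> True)) := submodule_gmul _ (submoduleT _).
have sFb : submodule (gmul (gL 'rV[L]_n) (fun=> True)) := submodule_gmul _ (submoduleT _).
have [T [b [<- [_ bI] _]]] := rk_has_rank (fgen_finrk sFb (gL_fgen psiA ng dFb)).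
rewrite -card_prod.
pose f (k : G * T) : padic_restr iota 'rV[R]_n :=
  gr_of L k.1 *: map_mx (@gr_const L G) (b k.2 : 'rV[L]_n).
apply: (indep_le_rank sF (rk_has_rank (fgen_finrk sF (gR_fgen iotaA ng dF))) (e := f)).
split=> // c [v _ vE] [s t0].
pose co : {linear padic_restr iota 'rV[R]_n -> padic_restr psi 'rV[L]_n} := linear_pack (@gcoef_row_linear n s).
have cof u t : co (f (u, t)) = if u == s then b t else 0.
  apply/rowP => i; rewrite mxE [X in gcoef X _]mxE mxE gr_of_comm_const gr_const_mul ffunE eq_sym.
  by case: eqP; rewrite ?mulr1 // mulr0 mxE.
apply: (bI (fun t => c (s, t))); exists (co v) => //.
have /(congr1 co) := vE; rewrite linear_sum => covE.
transitivity (co (gR _ v)).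
  rewrite -covE (eq_bigr (fun k => co (c (k.1, k.2) *: f (k.1, k.2)))); last by case.
  rewrite -(pair_bigA _ (fun u t => co (c (u, t) *: f (u, t)))) (bigD1 s) //= [X in _ + X]big1.
    rewrite addr0; apply: eq_bigr => t _; rewrite -[RHS]/(co _) linearZ /=.
    by rewrite -[gcoef_row _ _]/(co (f (s, t))) cof eqxx.
  move=> u /negPf us; rewrite big1 // => t _; rewrite -[LHS]/(co _) linearZ /=.
  by rewrite -[gcoef_row _ _]/(co (f (u, t))) cof us scaler0.
by apply/rowP => i; rewrite !mxE gr_const_mul.
Qed.

Variables (X : lmodType R) (Xb : lmodType L) (pi : {linear X -> restr aug Xb}).
Hypothesis piP : aug_pair pi.
Hypotheses (fX : fin_gen X) (prX : projective X).

(* The inequality [rank_split] holds for [X] and for a complement of [X] in a free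
   module, and adds up to an equality. *)
Lemma rank_projective :
  rk (fun=> True) (gmul (gR X) (fun=> True)) =
  (#|G| * rk (fun=> True) (gmul (gL Xb) (fun=> True)))%N.
Proof.
have [n [s [r srK]]] := projective_retract fX prX.
have dX := dual_basis_restr iotaA fX prX.
have dF := dual_basis_restr iotaA (@row_fin_gen R n) (@row_projective R n).
have dFb := dual_basis_restr psiA (@row_fin_gen L n) (@row_projective L n).
have rhoP := @aug_row_pair L G n.
pose f : {linear 'rV[R]_n -> 'rV[R]_n} := s \o r.
pose e : {linear 'rV[R]_n -> 'rV[R]_n} := idfun \- f.
have efE x : e x + f x = x by rewrite /= subrK.
have feE x : f x + e x = x by rewrite addrC efE.
have ff x : f (f x) = f x by rewrite /= srK.
have eE x : e x = x - f x by [].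
have efK x : e (f x) = 0 by rewrite eE ff subrr.
have feK x : f (e x) = 0 by rewrite eE raddfB /= srK subrr.
have [fb fbP] := aug_pair_descend (aug_row L G n) f rhoP.
have [eb ebP] := aug_pair_descend (aug_row L G n) e rhoP.
have [sb sbP] := aug_pair_descend (aug_row L G n) s piP.
have [rb rbP] := aug_pair_descend pi r rhoP.
have le1 := rank_split pG iotaA psiA ng rhoP dF dFb efE efK ebP.
have le2 := rank_split pG iotaA psiA ng rhoP dF dFb feE feK fbP.
have ge0 := row_rank_ge n.
have gefb x : psi g *: eb x = eb (psi g *: x) by rewrite linearZ.
have gef x : iota g *: e x = e (iota g *: x) by rewrite linearZ.
have E1 := rk_gmul_parts (gR_inj ng dF)
  (fgen_finrk (submodule_gmul _ (submoduleT _)) (gR_fgen iotaA ng dF)) (e := zR e) (f := zR f) efE efK gef.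
have ebfbE' := ebfbE rhoP efE ebP fbP.
have ebfbK' := ebfbK rhoP efK ebP fbP.
have E2 := rk_gmul_parts (gL_inj ng dFb)
  (fgen_finrk (submodule_gmul _ (submoduleT _)) (gL_fgen psiA ng dFb)) (e := zL eb) (f := zL fb) ebfbE' ebfbK' gefb.
have sbrb y : rb (sb y) = y.
  by have [x <-] := piP.1 y; rewrite sbP rbP srK.
have fbE y : fb y = sb (rb y).
  by have [x <-] := rhoP.1 y; rewrite fbP rbP sbP.
have E3 : rk (fun=> True) (gmul (gR X) (fun=> True)) = rk (kerp (zR e)) (gmul (gR 'rV[R]_n) (kerp (zR e))).
  apply: (rk_iso (phi := zR s)) => //.
  - by apply: submodule_gmul; apply: submodule_kerp.
  - by move=> x _; rewrite /kerp /= srK subrr.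
  - move=> x _; split=> [[v ev xv]|[y _ ->]].
      by exists (r v) => //; rewrite -[x]srK; have -> : s x = iota g *: v := xv; rewrite linearZ.
    exists (s y); first by rewrite /kerp /= srK subrr.
    by rewrite /= linearZ.
  - move=> v ev; exists (r v) => //; rewrite (_ : v - _ = 0) //.
    by apply: submod0; apply: submodule_gmul; apply: submodule_kerp.
have E4 : rk (fun=> True) (gmul (gL Xb) (fun=> True)) = rk (kerp (zL eb)) (gmul (gL 'rV[L]_n) (kerp (zL eb))).
  have esb y : eb (sb y) = 0.
    by apply: (addIr (fb (sb y))); rewrite ebfbE' add0r fbE sbrb.
  apply: (rk_iso (phi := zL sb)) => //.
  - by apply: submodule_gmul; apply: submodule_kerp.
  - by move=> x _; rewrite /kerp /= esb.
  - move=> x _; split=> [[v ev xv]|[y _ ->]].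
      by exists (rb v) => //; rewrite -[x]sbrb; have -> : sb x = psi g *: v := xv; rewrite linearZ.
    exists (sb y); first by rewrite /kerp /= esb.
    by rewrite /= linearZ.
  - move=> v ev; exists (rb v) => //; rewrite (_ : v - _ = 0) //.
      by apply: submod0; apply: submodule_gmul; apply: submodule_kerp.
    have vE : fb v = v by rewrite -[RHS]ebfbE' (ev : eb v = 0) add0r.
    by rewrite /= -fbE vE subrr.
rewrite E3 E4; move: le1 le2 ge0; rewrite E1 E2 mulnDr => le1 le2 ge0.
apply/eqP; rewrite eqn_leq le1 /= -(leq_add2r (rk (kerp (zR f)) (gmul (gR 'rV[R]_n) (kerp (zR f))))).
by apply: leq_trans ge0; rewrite leq_add2l.
Qed.
End ProjectiveRank.

(** * Folded modules and their coinvariants *)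

Record folded (R : nzRingType) (M : lmodType R) (g : M -> M) (d h e f : {linear M -> M}) : Prop :=
  Folded {
    fold_efE : forall x, e x + f x = x;
    fold_efK : forall x, e (f x) = 0;
    fold_de : forall x, d (e x) = f (d x);
    fold_df : forall x, d (f x) = e (d x);
    fold_he : forall x, h (e x) = f (h x);
    fold_hf : forall x, h (f x) = e (h x);
    fold_dd : forall x, d (d x) = 0;
    fold_hh : forall x, h (h x) = 0;
    fold_gE : forall x, g x = d (h x) + h (d x)
  }.

Lemma folded_swap (R : nzRingType) (M : lmodType R) (g : M -> M) (d h e f : {linear M -> M}) :
  folded g d h e f -> folded g d h f e.
Proof.
case=> efE efK de df he hf dd hh gE; split=> // x; first by rewrite addrC.
have exx : e (e x) = e x by rewrite -[in RHS](efE x) raddfD /= efK addr0.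
by apply: (addrI (e (e x))); rewrite efE exx addr0.
Qed.

Section FoldedPair.
Variables (p : nat) (p_pr : prime p) (L : nzRingType).
Variable psi : {rmorphism powser (padic_int p_pr) -> L}.
Variable G : finGroupType.
Hypothesis pG : (p.-group [set: G])%g.
Local Notation Zp := (padic_int p_pr).
Local Notation R := (group_ring L G).
Local Notation aug := (@augmentation L G).
Local Notation iota := (@gr_const L G \o psi).
Hypothesis iotaA : finite_free_algebra iota.
Hypothesis psiA : finite_free_algebra psi.
Local Notation zR := (padic_map iota).
Local Notation zL := (padic_map psi).
Variables (X : lmodType R) (Xb : lmodType L) (pi : {linear X -> restr aug Xb}).
Hypothesis piP : aug_pair pi.
Hypotheses (fX : fin_gen X) (prX : projective X).
Hypothesis dXb : dual_basis (restr psi Xb).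
Let dX := dual_basis_restr iotaA fX prX.
Local Notation T := (fun=> True).

Lemma folded_descend s (d h e f : {linear X -> X}) (db hb eb fb : {linear Xb -> Xb}) :
  folded (fun x => iota s *: x) d h e f ->
  (forall x, db (pi x) = pi (d x)) -> (forall x, hb (pi x) = pi (h x)) ->
  (forall x, eb (pi x) = pi (e x)) -> (forall x, fb (pi x) = pi (f x)) ->
  folded (fun y => psi s *: y) db hb eb fb.
Proof.
case=> efE efK de df he hf dd hh gE dP hP eP fP.
split=> y; elim/(pi_ind piP): y => x.
- by rewrite eP fP -raddfD efE.
- by rewrite fP eP efK raddf0.
- by rewrite eP !dP fP de.
- by rewrite fP !dP eP df.
- by rewrite eP !hP fP he.
- by rewrite fP !hP eP hf.
- by rewrite !dP dd raddf0.
- by rewrite !hP hh raddf0.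
- by rewrite !(hP, dP) -raddfD -gE -pi_scale.
Qed.

Lemma padic_folded s (d h e f : {linear X -> X}) :
  folded (fun x => iota s *: x) d h e f -> folded (gR iotaA s X) (zR d) (zR h) (zR e) (zR f).
Proof. by case. Qed.

Lemma padic_folded_bar s (d h e f : {linear Xb -> Xb}) :
  folded (fun x => psi s *: x) d h e f -> folded (gL psiA s Xb) (zL d) (zL h) (zL e) (zL f).
Proof. by case. Qed.

Section Data.
Variables (g : powser Zp) (d h e f : {linear X -> X}) (db hb eb fb : {linear Xb -> Xb}).
Hypothesis ng : ~ pdvd g.
Hypotheses (fold : folded (fun x => iota g *: x) d h e f).
Hypothesis foldb : folded (fun x => psi g *: x) db hb eb fb.
Hypotheses (dP : forall x, db (pi x) = pi (d x)) (hP : forall x, hb (pi x) = pi (h x)).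
Hypotheses (eP : forall x, eb (pi x) = pi (e x)) (fP : forall x, fb (pi x) = pi (f x)).

Lemma rank_folded_le :
  (rk (kerp (zR e)) (dhpart (zR d) (zR h) (zR f)) <=
   #|G| * rk (kerp (zL eb)) (dhpart (zL db) (zL hb) (zL fb)))%N.
Proof.
case: (fold) => efE efK de df he hf dd hh gE; have [feE feK _ _ _ _ _ _ _] := folded_swap fold.
case: (foldb) => _ _ deb dfb heb hfb ddb hhb gEb.
have eg x : iota g *: e x = e (iota g *: x) by rewrite linearZ.
apply: (rank_coinvariants pG iotaA.1 piP (E := f)).
- by split=> [|a x y]; rewrite /kerp /= ?raddf0 // linearP => -> ->; rewrite scaler0 addr0.
- split=> [|a _ _ [x ex ->] [y ey ->]]; first by exists 0; rewrite /kerp /= !raddf0 ?addr0.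
  exists (a *: x + y); first by move: ex ey; rewrite /kerp /= linearP => -> ->; rewrite scaler0 addr0.
  by rewrite /= !linearP scalerDr addrACA.
- by split=> [|a x y]; rewrite /kerp /= ?raddf0 // linearP => -> ->; rewrite scaler0 addr0.
- split=> [|a _ _ [x ex ->] [y ey ->]]; first by exists 0; rewrite /kerp /= !raddf0 ?addr0.
  exists (a *: x + y); first by move: ex ey; rewrite /kerp /= linearP => -> ->; rewrite scaler0 addr0.
  by rewrite /= !linearP scalerDr addrACA.
- exact: efK.
- by move=> x; rewrite /kerp /= => ex; rewrite -[RHS]efE ex add0r.
- by move=> _ [y /= fy ->]; rewrite /kerp /= raddfD /= -df -hf fy !raddf0 addr0.
- by move=> x; rewrite /kerp /= eP => ->; rewrite raddf0.
- exact: (kerp_eb piP efE efK eP).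
- move=> _ [y /= fy ->]; exists (pi y); first by rewrite /= fP fy raddf0.
  by rewrite /= raddfD /= dP hP.
- move=> _ [y /= /(kerp_eb piP feE feK fP)[x fx <-] ->]; exists (d x + h x); first by exists x.
  by rewrite raddfD /= dP hP.
- have [S [b [bW bS]]] := @fgen_split _ _ _ (gR iotaA g X) (zR e) (zR f) efE efK eg (gR_fgen iotaA ng dX).
  exists S, b; split=> // x Wx; have [c [y ey yE]] := bS x Wx; exists c.
  exists (d y + h y); first by rewrite /= raddfD /= -de -he (ey : e y = 0) !raddf0 addr0.
  by rewrite yE /= !raddfD /= dd hh add0r addr0 gE.
(* No p-torsion: applying [db + hb] to [p x = (db + hb) y] gives [g y = p (db + hb) x], so [p]
   divides [y], and dividing by [p] yields [x = (db + hb) z]. *)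
- move=> x ex [y /= fy px].
  have gy : psi g *: y = (p%:R : L) *: (db x + hb x).
    by rewrite gEb scalerDr -!linearZ /= px !raddfD /= ddb hhb add0r addr0.
  have [|z zE] := @dual_basis_pdvd _ _ _ dXb _ (y : restr psi Xb) (db x + hb x) ng.
    by rewrite -(nat_psi_scale psi) -gy.
  have {zE} zE : y = (p%:R : L) *: z by rewrite (nat_psi_scale psi).
  exists z; first by move: fy; rewrite /= zE => /(eb_p_inj dXb).
  apply/eqP; rewrite -subr_eq0; apply/eqP/(dual_basis_p_inj dXb).
  by rewrite -(nat_psi_scale psi) scalerBr px zE /= scalerDr !linearZ subrr.
Qed.
End Data.

Section Equality.
Variables (g : powser Zp) (d h e f : {linear X -> X}) (db hb eb fb : {linear Xb -> Xb}).
Hypothesis ng : ~ pdvd g.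
Hypotheses (fold : folded (fun x => iota g *: x) d h e f).
Hypotheses (dP : forall x, db (pi x) = pi (d x)) (hP : forall x, hb (pi x) = pi (h x)).
Hypotheses (eP : forall x, eb (pi x) = pi (e x)) (fP : forall x, fb (pi x) = pi (f x)).
Let foldb := folded_descend fold dP hP eP fP.

Lemma rank_folded :
  rk (kerp (zR e)) (dhpart (zR d) (zR h) (zR f)) =
  (#|G| * rk (kerp (zL eb)) (dhpart (zL db) (zL hb) (zL fb)))%N.
Proof.
have le1 := rank_folded_le ng fold foldb dP hP eP fP.
have le2 := rank_folded_le ng (folded_swap fold) (folded_swap foldb) dP hP fP eP.
have sT (M : lmodType Zp) (u : {linear M -> M}) : submodule (gmul u T) := submodule_gmul _ (submoduleT _).
have finX := fgen_finrk (sT _ _) (gR_fgen iotaA ng dX).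
have finXb := fgen_finrk (sT _ _) (gL_fgen psiA ng dXb).
have gi : forall x, gR iotaA g X x = 0 -> x = 0 := gR_inj ng dX.
have gib : forall x, gL psiA g Xb x = 0 -> x = 0 := gL_inj ng dXb.
have eq := rank_projective pG iotaA psiA ng piP fX prX.
have Pe x : gR iotaA g X (zR e x) = zR e (gR iotaA g X x) by rewrite /= linearZ.
have Peb x : gL psiA g Xb (zL eb x) = zL eb (gL psiA g Xb x) by rewrite /= linearZ.
have [efE efK de df he hf dd hh gE] := padic_folded fold.
have [feE _ _ _ _ _ _ _ _] := padic_folded (folded_swap fold).
have [efEb efKb deb dfb heb hfb ddb hhb gEb] := padic_folded_bar foldb.
have [feEb _ _ _ _ _ _ _ _] := padic_folded_bar (folded_swap foldb).
have P1 := rk_gmul_parts gi finX efE efK Pe.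
have Q1 := rk_gmul_parts gib finXb efEb efKb Peb.
have P2 := rk_square_root efE de df he hf dd hh gE gi finX.
have P3 := rk_square_root feE df de hf he dd hh gE gi finX.
have Q2 := rk_square_root efEb deb dfb heb hfb ddb hhb gEb gib finXb.
have Q3 := rk_square_root feEb dfb deb hfb heb ddb hhb gEb gib finXb.
move: eq; rewrite P1 Q1 P2 P3 Q2 Q3 !mulnDr.
set a := rk _ _ in le1 *; set b := (_ * _)%N in le1 *.
set a' := rk _ _ in le2 *; set b' := (_ * _)%N in le2 *.
lia.
Qed.
End Equality.

(* Comparing the homotopies [h] and [g h], from [g] and [g ^ 2], isolates the
   contribution of the cohomology to [rk_folded]. *)
Lemma euler_folded (g : powser Zp) (d h e f : {linear X -> X}) (db hb eb fb : {linear Xb -> Xb}) :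
  ~ pdvd g -> folded (fun x => iota g *: x) d h e f ->
  (forall x, db (pi x) = pi (d x)) -> (forall x, hb (pi x) = pi (h x)) ->
  (forall x, eb (pi x) = pi (e x)) -> (forall x, fb (pi x) = pi (f x)) ->
  (rk (zpart (zR d) (zR f)) (bpart (zR d) (zR e)) +
   #|G| * rk (zpart (zL db) (zL eb)) (bpart (zL db) (zL fb)) =
   rk (zpart (zR d) (zR e)) (bpart (zR d) (zR f)) +
   #|G| * rk (zpart (zL db) (zL fb)) (bpart (zL db) (zL eb)))%N.
Proof.
move=> ng fold dP hP eP fP; have foldb := folded_descend fold dP hP eP fP.
have ng2 := not_pdvd_mul ng ng.
pose h2 : {linear X -> X} := scalar_map iotaA.1 X g \o h.
pose hb2 : {linear Xb -> Xb} := scalar_map psiA.1 Xb g \o hb.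
have hP2 x : hb2 (pi x) = pi (h2 x) by rewrite /= hP pi_scale.
have fold2 : folded (fun x => iota (g * g) *: x) d h2 e f.
  case: (fold) => efE efK de df he hf dd hh gE; split=> //= x.
  - by rewrite he linearZ.
  - by rewrite hf linearZ.
  - by rewrite linearZ /= hh !scaler0.
  - have gx : gr_const G (psi g) *: x = d (h x) + h (d x) := gE x.
    by rewrite !rmorphM -scalerA gx scalerDr [d (_ *: _)]linearZ.
have foldb2 := folded_descend fold2 dP hP2 eP fP.
have A1 := rank_folded ng fold dP hP eP fP.
have A2 := rank_folded ng2 fold2 dP hP2 eP fP.
have sT (M : lmodType Zp) (u : {linear M -> M}) : submodule (gmul u T) := submodule_gmul _ (submoduleT _).
have finX := fgen_finrk (sT _ _) (gR_fgen iotaA ng dX).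
have finXb := fgen_finrk (sT _ _) (gL_fgen psiA ng dXb).
have finX2 := fgen_finrk (sT _ _) (gR_fgen iotaA ng2 dX).
have finXb2 := fgen_finrk (sT _ _) (gL_fgen psiA ng2 dXb).
have gi : forall x, gR iotaA g X x = 0 -> x = 0 := gR_inj ng dX.
have gib : forall x, gL psiA g Xb x = 0 -> x = 0 := gL_inj ng dXb.
have [efE efK de df he hf dd hh gE] := padic_folded fold.
have [efEb efKb deb dfb heb hfb ddb hhb gEb] := padic_folded_bar foldb.
have B1 := rk_folded efE de df he hf dd hh gE gi finX.
have C1 := rk_folded efEb deb dfb heb hfb ddb hhb gEb gib finXb.
have [_ _ _ _ he2 hf2 _ hh2 gE2] := padic_folded fold2.
have [_ _ _ _ heb2 hfb2 _ hhb2 gEb2] := padic_folded_bar foldb2.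
have B2 := rk_folded efE de df he2 hf2 dd hh2 gE2 (gR_inj ng2 dX) finX2.
have C2 := rk_folded efEb deb dfb heb2 hfb2 ddb hhb2 gEb2 (gL_inj ng2 dXb) finXb2.
have S1 : rk (zpart (zR d) (zR f)) (gmul (gR iotaA (g * g) X) (zpart (zR d) (zR f))) =
    (rk (zpart (zR d) (zR f)) (gmul (gR iotaA g X) (zpart (zR d) (zR f))) +
     rk (zpart (zR d) (zR f)) (gmul (gR iotaA g X) (zpart (zR d) (zR f))))%N.
  rewrite -(rk_gmul_square gi finX).
  - congr (rk _ _); apply/funext => x; apply/propext; split=> [[y Zy ->]|[_ [y Zy ->] ->]].
      by exists (gR iotaA g X y); [exists y|rewrite /= !rmorphM scalerA].
    by exists y; rewrite //= !rmorphM scalerA.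
  - exact: submodule_zpart.
  - by move=> y [fy dy]; split; [move: fy|move: dy]; rewrite /= linearZ /= => ->; rewrite scaler0.
  - by move=> y; apply: (zpart_g efE de df he hf dd gE gi); right.
have S2 : rk (zpart (zL db) (zL fb)) (gmul (gL psiA (g * g) Xb) (zpart (zL db) (zL fb))) =
    (rk (zpart (zL db) (zL fb)) (gmul (gL psiA g Xb) (zpart (zL db) (zL fb))) +
     rk (zpart (zL db) (zL fb)) (gmul (gL psiA g Xb) (zpart (zL db) (zL fb))))%N.
  rewrite -(rk_gmul_square gib finXb).
  - congr (rk _ _); apply/funext => x; apply/propext; split=> [[y Zy ->]|[_ [y Zy ->] ->]].
      by exists (gL psiA g Xb y); [exists y|rewrite /= !rmorphM scalerA].
    by exists y; rewrite //= !rmorphM scalerA.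
  - exact: submodule_zpart.
  - by move=> y [fy dy]; split; [move: fy|move: dy]; rewrite /= linearZ /= => ->; rewrite scaler0.
  - by move=> y; apply: (zpart_g efEb deb dfb heb hfb ddb gEb gib); right.
(* Twice the relation for [g] minus the one for [g ^ 2] cancels the rank of [ker d / g ker d]. It
   leaves the Euler characteristic as the same combination of two cokernel ranks on both sides, and
   these are compared by [A1] and [A2]. *)
rewrite A1 in B1; rewrite A2 S1 in B2; rewrite S2 in C2.
move: B1 B2 (congr1 (muln #|G|) C1) (congr1 (muln #|G|) C2); rewrite !mulnDr.
by lia.
Qed.
End FoldedPair.

(** * Folding a complex *)

Section Instances.
Variables (p : nat) (p_pr : prime p) (L : nzRingType).
Variable psi : {rmorphism powser (padic_int p_pr) -> L}.
Hypothesis psi_bij : bijective psi.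
Variable G : finGroupType.
Local Notation iota := (@gr_const L G \o psi).

Lemma psi_central s r : psi s * r = r * psi s.
Proof. by have [phi _ psiK] := psi_bij; rewrite -(psiK r) -!rmorphM mulrC. Qed.

Lemma iota_central s r : iota s * r = r * iota s.
Proof.
rewrite (group_ringE r) mulr_sumr mulr_suml; apply: eq_bigr => g _.
rewrite /= -[RHS]mulrA gr_of_comm_const !mulrA; congr (_ * _).
by rewrite -!(rmorphM (@gr_const L G)) psi_central.
Qed.

Lemma finite_free_psi : finite_free_algebra psi.
Proof.
split; first exact: psi_central.
have [phi phiK psiK] := psi_bij; have /bij_inj psi_inj := psi_bij.
exists unit, (fun=> 1 : L), (fun _ x => phi x); split=> [_ a x y|x].
  by apply: psi_inj; rewrite rmorphD rmorphM !psiK.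
by rewrite (big_pred1 tt) => [|[]] //; rewrite -[RHS]/(psi (phi x) * 1) psiK mulr1.
Qed.

Lemma finite_free_iota : finite_free_algebra iota.
Proof.
split; first exact: iota_central.
have [phi phiK psiK] := psi_bij; have /bij_inj psi_inj := psi_bij.
exists G, (fun g => gr_of L g), (fun g x => phi (gcoef x g)); split=> [g a x y|x].
  apply: psi_inj; rewrite rmorphD rmorphM !psiK.
  by rewrite -[LHS]/(gcoef (iota a * (x : group_ring L G) + y) g) [LHS]ffunE gr_const_mul.
rewrite [LHS]group_ringE; apply: eq_bigr => g _.
by rewrite -[RHS]/(gr_const G (psi (phi _)) * gr_of L g) psiK.
Qed.
End Instances.

Lemma odd_abszB1 (i : int) : odd (absz (i - 1)) = ~~ odd (absz i).
Proof. lia. Qed.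

Section Parity.
Variables (R : nzRingType) (P : complex R).
Local Notation T := (tot P).

Definition parity (b : bool) (x : T) : T := fun i => if odd (absz i) == b then x i else 0.

Fact parity_linear b : linear (parity b).
Proof.
move=> a x y; apply: totP => i; rewrite totDE totZE /parity.
by case: eqP => _ //; rewrite scaler0 addr0.
Qed.
HB.instance Definition _ b := GRing.isLinear.Build R T T _ (parity b) (parity_linear b).

Lemma parityE b x i : parity b x i = if odd (absz i) == b then x i else 0. Proof. by []. Qed.

Lemma parityD b x : parity b x + parity (~~ b) x = x.
Proof.
apply: totP => i; rewrite totDE !parityE; case: (odd _); case: b => /=;
  by rewrite ?addr0 ?add0r.
Qed.

Lemma parityK b x : parity b (parity (~~ b) x) = 0.
Proof. by apply: totP => i; rewrite !parityE tot0E; case: (odd _); case: b. Qed.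

Lemma parity_id b x : parity b (parity b x) = parity b x.
Proof. by apply: totP => i; rewrite !parityE; case: (odd _); case: b. Qed.

Lemma parity_diff b x : tot_diff (parity b x) = parity (~~ b) (tot_diff x).
Proof.
apply: totP => i; rewrite parityE !tot_diffE parityE odd_abszB1.
by case: (odd _); case: b => //=; rewrite raddf0.
Qed.
End Parity.

(** [h0] is corrected twice. [h1] is its parity-changing component, still a homotopy from [c] to 0
    because [d] changes parity and [c] preserves it. Then [h = h1 d h1] squares to zero because
    [d h1 h1] vanishes on cycles; as [d h1 d = c d], it is a homotopy for [c * c]. *)
Lemma folded_exists (R : nzRingType) (P : complex R) (c : R)
    (h0 : {linear tot P -> tot P}) :
  (forall r, c * r = r * c) ->
  (forall x : tot P, c *: x = tot_diff (h0 x) + h0 (tot_diff x)) ->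
  exists h : {linear tot P -> tot P}, forall b,
    folded (fun x => (c * c) *: x) (@tot_diff _ P) h (parity b) (parity (~~ b)).
Proof.
move=> cC h0P.
pose d : {linear tot P -> tot P} := @tot_diff _ P.
pose ev : {linear tot P -> tot P} := parity false; pose od : {linear tot P -> tot P} := parity true.
pose h1 : {linear tot P -> tot P} := (od \o (h0 \o ev)) \+ (ev \o (h0 \o od)).
have h1E x : h1 x = od (h0 (ev x)) + ev (h0 (od x)) by [].
have dev x : d (ev x) = od (d x) := parity_diff _ _.
have dod x : d (od x) = ev (d x) := parity_diff _ _.
have evod x : ev (od x) = 0 := parityK false x.
have odev x : od (ev x) = 0 := parityK true x.
have evev x : ev (ev x) = ev x := parity_id _ _.
have odod x : od (od x) = od x := parity_id _ _.
have cZ (u : {linear tot P -> tot P}) x : u (c *: x) = c *: u x by rewrite linearZ.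
have dd x : d (d x) = 0 := tot_diffK x.
have h0d x : c *: x = d (h0 x) + h0 (d x) := h0P x.
have h1P x : c *: x = d (h1 x) + h1 (d x).
  have H1 : d (h1 x) = ev (d (h0 (ev x))) + od (d (h0 (od x))).
    by rewrite h1E [d (_ + _)]raddfD /= dod dev.
  have H2 : h1 (d x) = od (h0 (d (od x))) + ev (h0 (d (ev x))).
    by rewrite h1E -dod -dev.
  rewrite H1 H2 [X in _ + X]addrC addrACA -(raddfD ev) -(raddfD od) -!h0d /= !cZ evev odod.
  by rewrite -scalerDr (parityD false).
have h1ev x : h1 (ev x) = od (h1 x).
  by rewrite !h1E evev odev !raddf0 addr0 [od (_ + _)]raddfD /= odod odev addr0.
have h1od x : h1 (od x) = ev (h1 x).
  by rewrite !h1E evod odod !raddf0 add0r [ev (_ + _)]raddfD /= evod evev add0r.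
pose h : {linear tot P -> tot P} := h1 \o (d \o h1).
have hE x : h x = h1 (d (h1 x)) by [].
have dh1 x : d (h1 x) = c *: x - h1 (d x) by rewrite h1P addrK.
have h1d x : h1 (d x) = c *: x - d (h1 x) by rewrite h1P addrC addKr.
have hev x : h (ev x) = od (h x) by rewrite !hE h1ev dod h1ev.
have hod x : h (od x) = ev (h x) by rewrite !hE h1od dev h1od.
have hh x : h (h x) = 0.
  rewrite !hE; set y := d (h1 x).
  have dy : d y = 0 by apply: dd.
  have h1dh1y : h1 (d (h1 y)) = c *: h1 y by rewrite dh1 dy raddf0 subr0 cZ.
  by rewrite [d (h1 (h1 y))]dh1 h1dh1y subrr raddf0.
exists h => b; split=> [x|x|x|x|x|x|x|x|x].
- exact: parityD.
- exact: parityK.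
- exact: parity_diff.
- by have := parity_diff (~~ b) x; rewrite negbK.
- by case: b; [apply: hod|apply: hev].
- by case: b; [apply: hev|apply: hod].
- exact: tot_diffK.
- exact: hh.
- rewrite -scalerA -/d !hE [d (h1 (d _))]dh1 [d (h1 (d x))]dh1 !dd !raddf0 !addr0.
  by rewrite cZ -scalerDr -h1P.
Qed.

(** * The coinvariants of the total module *)

Section BaseChangeTot.
Variables (L : nzRingType) (G : finGroupType).
Local Notation R := (group_ring L G).
Local Notation aug := (@augmentation L G).

Section Kernel.
Variable M : lmodType R.

Definition augspanp : {pred restr (@gr_const L G) M} := fun x => `[< augspan (fun=> True) (x : M) >].

Fact augspanp_closed : submod_closed augspanp.
Proof.
split=> [|a x y /asboolP ax /asboolP ay]; apply/asboolP; first exact: AugSpan0.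
apply: augspanD => //; elim: ax => [|g z u _ _ IHu].
  by rewrite scaler0; apply: AugSpan0.
rewrite scalerDr; apply: augspanD => //.
rewrite -[a *: _]/(gr_const G a *: ((gr_of L g - 1) *: z)) scalerA.
by rewrite mulrBr mulr1 -gr_of_comm_const -[X in _ - X]mul1r -mulrBl -scalerA; apply: augspan_gen.
Qed.
HB.instance Definition _ := GRing.isSubmodClosed.Build L (restr (@gr_const L G) M) augspanp
  (GRing.submod_closed_semi augspanp_closed).

(** The projection of [M] onto [M / I M] respects the relations defining the base change, hence
    factors through it. *)
Lemma bc_tens_kernel (x : M) : bc_tens aug 1 x = 0 -> augspan (fun=> True) x.
Proof.
pose q (m : M) : quotmod augspanp := qmod_pi augspanp m.
have qD : {morph q : x y / x + y} by move=> y z; rewrite /q -qmod_piD.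
have qZ r : {morph q : x / r *: x >-> aug r *: x}.
  move=> y; rewrite /q -qmod_piZ; apply/qmod_piP/asboolP.
  suff : augspan (fun=> True) ((r - gr_const G (aug r)) *: y) by rewrite scalerBl.
  by apply: augspan_kernel; rewrite rmorphB /= augmentation_const subrr.
move=> x0; have := bc_liftE qD qZ 1 x; rewrite x0 scale1r.
have -> : bc_lift (f := aug) q 0 = 0.
  by rewrite -[LHS]/(linear_pack (bc_lift_linear qD qZ) 0) raddf0.
move=> /esym qx; have : q x = q 0 by rewrite qx /q raddf0.
by move=> /qmod_piP/asboolP; rewrite subr0.
Qed.
End Kernel.

Variable P : complex R.
Local Notation Q := (bc_complex aug P).

Definition bc_tot (x : tot P) : restr aug (tot Q) := (fun i => bc_tens aug 1 (x i)) : tot Q.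

Fact bc_tot_linear : linear bc_tot.
Proof.
move=> a x y; apply: totP => i; rewrite [RHS]totDE /bc_tot totDE totZE bc_tensDr; congr (_ + _).
by rewrite bc_tensZr mul1r -[RHS]/(aug a *: bc_tens aug 1 (x i)) /bc_tens scale1r.
Qed.
HB.instance Definition _ := GRing.isLinear.Build R (tot P) (restr aug (tot Q)) _ bc_tot bc_tot_linear.

Lemma bc_totE x i : (bc_tot x : tot Q) i = bc_tens aug 1 (x i). Proof. by []. Qed.

Lemma bc_tot_diff x : @tot_diff _ Q (bc_tot x) = bc_tot (tot_diff x).
Proof. by apply: totP => i; rewrite tot_diffE !bc_totE tot_diffE /= bc_mapE. Qed.

Lemma bc_tot_parity b x : @parity _ Q b (bc_tot x) = bc_tot (parity b x).
Proof.
apply: totP => i; rewrite bc_totE !parityE bc_totE; case: eqP => // _.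
by rewrite bc_tens0r.
Qed.

Lemma bc_tens_surj (M : lmodType R) (y : base_change aug M) : exists x, bc_tens aug 1 x = y.
Proof.
elim/base_change_ind: y => [s m|_ _ [x <-] [y <-]]; last by exists (x + y); rewrite bc_tensDr.
by exists (gr_const G s *: m); rewrite bc_tensZr mul1r /= augmentation_const.
Qed.

Variable n : nat.
Hypothesis Pn : forall i : int, (n < `|i|)%N -> forall x : P i, x = 0.

Lemma bc_tot_pair : aug_pair bc_tot.
Proof.
split=> [y|x x0].
  have /dep_choice[x xP] i : exists x, bc_tens aug 1 x = (y : tot Q) i by apply: bc_tens_surj.
  by exists x; apply: (@totP _ Q) => i; apply: xP.
rewrite (tot_sum_inj Pn x); apply: big_ind => [|u w|j _]; [exact: AugSpan0|exact: augspanD|].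
apply: (@augspan_linear _ _ _ _ _ (fun=> True)) => //; apply: bc_tens_kernel.
exact: (congr1 (fun z : tot Q => z _) x0).
Qed.
End BaseChangeTot.

Section ParityRank.
Variables (p : nat) (p_pr : prime p) (R : nzRingType).
Variable iota : {rmorphism powser (padic_int p_pr) -> R}.
Variable P : complex R.
Local Notation T := (tot P).
Local Notation ZM := (padic_restr iota).
Variable n : nat.
Hypothesis Pn : forall i : int, (n < `|i|)%N -> forall x : P i, x = 0.
Hypothesis fgP : forall i, coh_fgen iota P i.

Definition coh_rank i := @rk _ (ZM (P i)) (coc P i) (cob P i).

Lemma coh_rank_out i : (n < absz i)%N -> coh_rank i = 0%N.
Proof.
move=> ni; apply: has_rank_rk; first exact/submodule_padic/submodule_cob.
by apply: has_rank0 => x _; rewrite (Pn ni x); apply: submod0; apply: submodule_cob.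
Qed.

Let deg (m : nat) : int := m%:Z - n%:Z.

Local Notation Zb b := (zpart (padic_map iota (@tot_diff _ P)) (padic_map iota (parity (~~ b)))).
Local Notation Bb b := (bpart (padic_map iota (@tot_diff _ P)) (padic_map iota (parity b))).

(** [V k] consists of the cocycles of parity [b] whose components from degree [k - n] on are
    coboundaries. It grows from [Bb b] at [k = 0] to [Zb b] at [k = 2 n + 1], and passing from [k]
    to [k + 1] adds the cohomology in degree [k - n], or nothing if that degree has the other
    parity. *)
Lemma rk_parity b : rk (Zb b) (Bb b) =
  (\sum_(m < n.*2.+1) if odd (absz (deg m)) == b then coh_rank (deg m) else 0)%N.
Proof.
pose V k (x : ZM T) := Zb b x /\ forall m, (k <= m)%N -> cob P (deg m) (x (deg m)).
have sZb := submodule_zpart (padic_map iota (@tot_diff _ P)) (padic_map iota (parity (~~ b))).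
have sV k : submodule (V k).
  split=> [|a x y [Zx cx] [Zy cy]].
    by split=> [|m _]; [apply: submod0 sZb|apply: submod0; apply: submodule_cob].
  split=> [|m km]; first exact: (proj2 sZb).
  by apply: (proj2 (submodule_padic iota (@submodule_cob _ P (deg m)))); [apply: cx|apply: cy].
have B0 : Bb b = V 0%N.
  apply/funext => x; apply/propext; split=> [[y yb ->]|[[xb dx] cx]].
    split; last by move=> m _; exists (y (deg m - 1)).
    split; last exact: tot_diffK.
    by have := parity_diff b y; rewrite /= => <-; rewrite [parity b y]yb raddf0.
  have cob_x i : cob P i (x i).
    have [ni|ni] := leqP (absz i) n; last by rewrite (Pn ni (x i)); apply: submod0; apply: submodule_cob.
    by have [j <-] := tot_degP ni; apply: cx.
  (* Primitives are chosen degree by degree, and as zero in the degrees of parity [b], since [Bb b]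
     asks for a primitive of the opposite parity. *)
  have /dep_choice[y yP] j : exists y : P j, cdiff P j (j + 1) y = x (j + 1) /\ (odd (absz j) == b -> y = 0).
    have xj : odd (absz j) == b -> x (j + 1) = 0.
      move=> jb; have := congr1 (fun z : T => z (j + 1)) (xb : parity (~~ b) x = 0); rewrite parityE.
      have := odd_abszB1 (j + 1); rewrite addrK => /(congr1 negb); rewrite negbK (eqP jb) => <-.
      by rewrite eqxx.
    case: eqP => [/eqP jb|nb]; first by exists 0; rewrite raddf0 xj.
    have := cob_x (j + 1); rewrite /cob addrK => -[y yE]; by exists y.
  exists (y : T).
    by apply: (@totP _ P) => j; rewrite -[LHS]/(parity b y j) parityE; case: eqP => // /eqP jb; apply: (yP j).2.
  apply: (@totP _ P) => i; rewrite -[RHS]/(tot_diff y i) tot_diffE.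
  by have := (yP (i - 1)).1; rewrite subrK.
have ZV : Zb b = V n.*2.+1.
  apply/funext => x; apply/propext; split=> [Zx|[]//]; split=> // m lem.
  have -> : x (deg m) = 0 by apply: Pn; rewrite /deg; lia.
  by apply: submod0; apply: submodule_cob.
rewrite ZV B0; apply: has_rank_rk => //.
elim: n.*2.+1 => [|k IHk].
  by rewrite big_ord0; apply: has_rank0.
rewrite big_ord_recr /= addnC; apply: (has_rank_add _ (Y := V k)) => //.
- by move=> x [Zx cx]; split=> // m km; apply: cx; apply: ltnW.
- by move=> x [Zx cx]; split=> // m km; apply: cx.
have Vk x : V k.+1 x -> cob P (deg k) (x (deg k)) -> V k x.
  move=> [Zx cx] ck; split=> // m; rewrite leq_eqVlt => /orP[/eqP <- //|km].
  exact: cx.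
rewrite /=; case: eqP => kb; last first.
  apply: has_rank0 => x Vx; apply: Vk => //.
  have := congr1 (fun z : T => z (deg k)) (Vx.1.1 : parity (~~ b) x = 0); rewrite parityE.
  have -> : odd (absz (deg k)) == ~~ b by move: kb; case: (odd _); case: (b).
  by move=> ->; apply: submod0; apply: submodule_cob.
pose inj : {linear ZM (P (deg k)) -> ZM T} := padic_map iota (@tot_inj _ _ (deg k)).
have inj_out m (z : P (deg k)) : m != k -> tot_inj z (deg m) = 0.
  by move=> mk; rewrite tot_inj_out // /deg; apply/eqP; move/eqP: mk; lia.
have inj_par (z : P (deg k)) : parity (~~ b) (tot_inj z) = 0.
  apply: totP => i; rewrite parityE; case: eqP => // ib.
  by rewrite tot_inj_out //; apply/eqP => ki; move: ib; rewrite -ki kb; case: (b).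
apply/(has_rank_iso _ (phi := inj) (X := coc P (deg k)) (Y := cob P (deg k))) => //.
- exact/submodule_padic/submodule_coc.
- move=> z dz; split; first split.
  + exact: inj_par.
  + exact: tot_diff_inj.
  + move=> m km; rewrite /inj /= inj_out; last by rewrite gtn_eqF.
    by apply: submod0; apply: submodule_cob.
- move=> z dz; split=> [[_ /(_ k (leqnn k))]|cz]; first by rewrite /inj /= tot_inj_in.
  split; first split.
  + exact: inj_par.
  + exact: tot_diff_inj.
  + move=> m; rewrite /inj /=; have [->|mk] := eqVneq m k; first by rewrite tot_inj_in.
    by rewrite inj_out // => _; apply: submod0; apply: submodule_cob.
- move=> x Vx; exists (x (deg k)); first exact: (tot_diff_cocycle _ Vx.1.2).
  apply: Vk.
    apply: (submodB (sV k.+1)) => //; split; first split.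
    + exact: inj_par.
    + by apply: tot_diff_inj; apply: (tot_diff_cocycle _ Vx.1.2).
    + move=> m km; rewrite /inj /= inj_out; last by rewrite gtn_eqF.
      by apply: submod0; apply: submodule_cob.
  rewrite [X in cob _ _ X](_ : _ = 0); first by apply: submod0; apply: submodule_cob.
  by rewrite -[LHS]/(x (deg k) - tot_inj (x (deg k)) (deg k)) tot_inj_in subrr.
- apply: rk_has_rank; apply: fgen_finrk; last exact: fgP.
  exact/submodule_padic/submodule_cob.
Qed.
End ParityRank.

(** * Lambda invariants *)

Section VectorDimension.
Variables (A : idomainType) (M : lmodType A) (K : fieldType) (fr : {rmorphism A -> K}).
Hypothesis fr_neq0 : forall a, a != 0 -> fr a != 0.
Local Notation KM := (base_change fr M).

Lemma is_basis_has_rank (F : fieldType) (V : lmodType F) n (b : 'I_n -> V) :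
  is_basis b -> has_rank (fun=> True) (fun x : V => x = 0) n.
Proof.
move=> bP; exists 'I_n, b; rewrite card_ord; split=> //; last first.
  move=> x _; have [c [xE _]] := bP x; exists 1, c.
  by rewrite oner_neq0 scale1r {1}xE subrr.
split=> // c c0 i; have [c' [_ cU]] := bP 0.
have E1 : c' = [ffun i => c i].
  by apply: cU; rewrite -[LHS]c0; apply: eq_bigr => j _; rewrite ffunE.
have E2 : c' = [ffun=> 0].
  by apply: cU; rewrite big1 // => j _; rewrite ffunE scale0r.
by have := congr1 (fun f : {ffun 'I_n -> F} => f i) (etrans (esym E1) E2); rewrite !ffunE.
Qed.

Lemma vdim_basis (F : fieldType) (V : lmodType F) n (b : 'I_n -> V) :
  is_basis b -> vdim V = (n%:Z)%:E.
Proof.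
move=> bP; rewrite /vdim; case: pselect => [h|[]]; last by exists n, b.
have [b' b'P] := projT2 (cid h); congr (_%:Z%:E).
have s0 : submodule (fun x : V => x = 0).
  by split=> // a x y -> ->; rewrite scaler0 addr0.
exact: (has_rank_uniq s0 (is_basis_has_rank b'P) (is_basis_has_rank bP)).
Qed.

(** A relation expressing [s x] with [s != 0] through the [e i] gives [x] coordinates, the
    coefficients divided by [s], which do not depend on the relation. They extend to functionals
    [Phi i] on the base change, dual to [b], which proves independence without appealing to
    exactness of localization. *)
Lemma vdim_base_change r : has_rank (fun=> True) (fun x : M => x = 0) r ->
  vdim KM = (r%:Z)%:E.
Proof.
move=> [T [e0 [<- [_ e0I] e0S]]].
pose n := #|T|; pose e (i : 'I_n) := e0 (enum_val i).
have sumE (c : T -> A) : \sum_i c i *: e0 i = \sum_(i < n) c (enum_val i) *: e i.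
  rewrite (reindex_onto enum_val enum_rank) /=; last by move=> s _; rewrite enum_rankK.
  by apply: eq_bigl => i; rewrite enum_valK eqxx.
have eI (c : 'I_n -> A) : \sum_i c i *: e i = 0 -> forall i, c i = 0.
  move=> c0 i; rewrite -[i]enum_valK; apply: (e0I (fun t => c (enum_rank t))).
  by rewrite sumE -[RHS]c0; apply: eq_bigr => j _; rewrite enum_valK.
have /choice[s sP] x : exists s : A * ('I_n -> A), s.1 != 0 /\ s.1 *: x = \sum_i s.2 i *: e i.
  have [a [c [a0 /eqP]]] := e0S x I; rewrite subr_eq0 sumE => /eqP xE.
  by exists (a, fun i => c (enum_val i)).
pose phi i x : K^o := fr ((s x).2 i) / fr ((s x).1).
have phiE a (c : 'I_n -> A) x i : a != 0 -> a *: x = \sum_i c i *: e i ->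
    phi i x = fr (c i) / fr a.
  move=> a0 xE; have [s0 sE] := sP x.
  have : (s x).1 * c i - a * (s x).2 i = 0.
    apply: (eI (fun i => (s x).1 * c i - a * (s x).2 i)).
    under eq_bigr do rewrite scalerBl -!scalerA.
    by rewrite sumrB -!scaler_sumr -xE -sE !scalerA mulrC subrr.
  move=> /eqP; rewrite subr_eq0 => /eqP /(congr1 fr); rewrite !(rmorphM fr) => E.
  apply/eqP; rewrite eqr_div ?fr_neq0 //; apply/eqP.
  by rewrite mulrC -E mulrC.
have phiD i : {morph phi i : x y / x + y}.
  move=> x y; have [x0 xE] := sP x; have [y0 yE] := sP y.
  rewrite (phiE ((s x).1 * (s y).1) (fun i => (s y).1 * (s x).2 i + (s x).1 * (s y).2 i)) ?mulf_neq0 //.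
    rewrite /phi (rmorphD fr) !(rmorphM fr) addf_div ?fr_neq0 //; congr (_ / _).
    by rewrite mulrC [fr (s x).1 * _]mulrC.
  under eq_bigr do rewrite scalerDl -!scalerA.
  by rewrite big_split -!scaler_sumr /= -xE -yE scalerDr !scalerA [(s y).1 * _]mulrC.
have phiZ i a : {morph phi i : x / a *: x >-> fr a *: x}.
  move=> x; have [x0 xE] := sP x.
  rewrite (phiE (s x).1 (fun i => a * (s x).2 i)) // ?(rmorphM fr) -?mulrA //.
  under eq_bigr do rewrite -scalerA.
  by rewrite -scaler_sumr -xE !scalerA mulrC.
pose Phi i : {linear KM -> K^o} := linear_pack (bc_lift_linear (@phiD i) (@phiZ i)).
have PhiE i t m : Phi i (bc_tens fr t m) = t * phi i m := bc_liftE (@phiD i) (@phiZ i) t m.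
have PhiZ i (t : K) (w : KM) : Phi i (t *: w) = t * (Phi i w : K) by rewrite linearZ.
pose b i : KM := bc_tens fr 1 (e i).
have Phib i j : Phi i (b j) = (i == j)%:R.
  rewrite PhiE mul1r (phiE 1 (fun k => (k == j)%:R)) ?oner_neq0 //.
    by rewrite (rmorph1 fr) divr1 rmorph_nat.
  rewrite scale1r (bigD1 j) //= eqxx scale1r big1 ?addr0 // => k /negPf ->.
  by rewrite scale0r.
apply: (vdim_basis (b := b)) => v.
have [c cE] : exists c : 'I_n -> K, v = \sum_i c i *: b i.
  elim/base_change_ind: v => [t m|x y [c ->] [d ->]]; last first.
    exists (fun i => c i + d i); rewrite -big_split.
    by apply: eq_bigr => i _; rewrite scalerDl.
  have [s0 sE] := sP m; exists (fun i => t / fr (s m).1 * fr ((s m).2 i)).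
  have -> : bc_tens fr t m = bc_tens fr (t / fr (s m).1) ((s m).1 *: m).
    by rewrite bc_tensZr divfK // fr_neq0.
  rewrite sE (big_morph _ (bc_tensDr fr (t / fr (s m).1)) (bc_tens0r fr _ _)).
  by apply: eq_bigr => i _; rewrite bc_tensZr /b /bc_tens scale1r.
have coefE (c' : 'I_n -> K) : v = \sum_i c' i *: b i -> forall i, c' i = Phi i v.
  move=> -> i; rewrite linear_sum.
  under eq_bigr do rewrite PhiZ Phib.
  rewrite (bigD1 i) //= eqxx mulr1 big1 ?addr0 // => j ji.
  by rewrite eq_sym (negPf ji) mulr0.
exists [ffun i => c i]; split.
  by rewrite [LHS]cE; apply: eq_bigr => i _; rewrite ffunE.
move=> c' c'E; apply/ffunP => i; rewrite ffunE.
exact: etrans (coefE c cE i) (esym (coefE c' c'E i)).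
Qed.
End VectorDimension.

Section CohomologyLambda.
Variables (p : nat) (p_pr : prime p) (L : nzRingType).
Local Notation Zp := (padic_int p_pr).
Variable psi : {rmorphism powser Zp -> L}.
Local Notation zeta := (padic_to_Lambda psi).

Lemma fin_gen_fgen (M : lmodType Zp) : fin_gen M <-> fgen (fun=> True) (fun x : M => x = 0).
Proof.
split=> [[n [e eP]]|[T [e [_ /gspan_ord eS]]]].
  exists 'I_n, e; split=> // x _; have [c cE] := eP x; exists c.
  by rewrite {1}cE subrr.
exists #|T|, (fun i => e (enum_val i)) => x; have [c /eqP] := eS x I.
by rewrite subr_eq0 => /eqP xE; exists c.
Qed.

Section Comparison.
Variables (D : complex L) (i : int) (N : lmodType Zp).
Variables (X Y : N -> Prop) (phi : {linear restr zeta (cocycle D i) -> N}).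
Hypothesis sY : submodule Y.
Hypotheses (Xphi : forall z, X (phi z)) (phiX : forall x, X x -> exists z, phi z = x).
Hypothesis phiY : forall z : cocycle D i, Y (phi z) <-> cob D i (cocycle_val z).

Let cobz (z : restr zeta (cocycle D i)) := cob D i (cocycle_val z).

Let class : {linear restr zeta (cocycle D i) -> padic_module psi (cohomology D i)} :=
  restr_map zeta (@qmod_pi _ _ (is_coboundary (C := D) (i := i))).

Lemma class_eq0 z : class z = 0 <-> cobz z.
Proof.
rewrite /cobz; have := coh_classP z 0; rewrite subr0 => <-.
by rewrite /coh_class raddf0.
Qed.

Lemma class_surj (c : padic_module psi (cohomology D i)) : exists z, class z = c.
Proof. by exists (coh_repr c); apply: qmod_reprK. Qed.

Lemma submodule_eq0 (M : lmodType Zp) : submodule (fun x : M => x = 0).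
Proof. by split=> // a x y -> ->; rewrite scaler0 addr0. Qed.

(** The cocycles map onto the cohomology by [class] and onto [X] modulo [Y] by [phi], with the same
    kernel. The target [N] is left general because the two complexes of the theorem get their
    [Zp]-structure along different maps. *)
Lemma mu_zero_fgen : mu_zero psi (cohomology D i) <-> fgen X Y.
Proof.
rewrite /mu_zero fin_gen_fgen.
apply: (iff_trans (iff_sym (fgen_iso (phi := class) (X := fun=> True) (Y := cobz) _ (submodule_eq0 _) _ _ _))) => //.
- by move=> z _; apply: class_eq0.
- by move=> c _; have [z <-] := class_surj c; exists z; rewrite // subrr.
apply: (fgen_iso (phi := phi)) => //.
by move=> x /phiX[z <-]; exists z; rewrite // subrr; apply: submod0 sY.
Qed.

Lemma lambda_rank r : has_rank X Y r -> lambda psi (cohomology D i) = (r%:Z)%:E.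
Proof.
move=> rX; apply: vdim_base_change => [a|]; first by rewrite tofrac_eq0.
apply/(has_rank_iso r (phi := class) (X := fun=> True) (Y := cobz) _ (submodule_eq0 _)) => //.
- by move=> z _; apply: class_eq0.
- by move=> c _; have [z <-] := class_surj c; exists z; rewrite // subrr.
apply/(has_rank_iso r (phi := phi) (X' := X) (Y' := Y)) => //.
by move=> x /phiX[z <-]; exists z; rewrite // subrr; apply: submod0 sY.
Qed.
End Comparison.

Lemma signz_odd (i : int) : ((-1) ^ i : int) = if odd (absz i) then -1 else 1.
Proof.
have sgn n : ((-1) ^+ n : int) = if odd n then -1 else 1.
  by rewrite -signr_odd; case: (odd n).
by case: i => k; rewrite /exprz //= sgn; case: ifP.
Qed.

Lemma lambda_complex_sum (D : complex L) (r : int -> nat) n :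
  (forall i, lambda psi (cohomology D i) = ((r i)%:Z)%:E) ->
  (forall i, (n < absz i)%N -> r i = 0%N) ->
  let s b := (\sum_(m < n.*2.+1) if odd (absz (m%:Z - n%:Z)%R) == b then r (m%:Z - n%:Z)%R else 0)%N in
  lambda_complex psi D = ((s false)%:Z - (s true)%:Z)%:E.
Proof.
move=> rE r0 s; rewrite /lambda_complex.
pose deg (m : nat) : int := m%:Z - n%:Z.
have deg_inj : injective deg by move=> j k; rewrite /deg; lia.
transitivity (\big[+%R/(0 : \bar int)%R]_(i \in [set: int])
    (((-1) ^ i)%:E * lambda psi (cohomology D i))%E); first by [].
rewrite (fsbigE [seq deg m | m <- index_iota 0 n.*2.+1]) //; first last.
- move=> i _ ir; rewrite rE r0 ?mule0 //; rewrite ltnNge; apply: contra ir => ni.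
  apply/mapP; exists (absz (i + n%:Z)); last by rewrite /deg; lia.
  by rewrite mem_index_iota; lia.
- by rewrite map_inj_uniq // iota_uniq.
under eq_bigl do rewrite in_setT.
rewrite big_map big_mkord.
under eq_bigr do rewrite rE signz_odd -EFinM.
rewrite sumEFin; congr (_%:E); rewrite /s !(big_morph Posz PoszD (erefl _)) -sumrB.
apply: eq_bigr => m _; rewrite -/(deg m).
by case: (odd _) => /=; rewrite ?mulN1r ?mul1r ?sub0r ?subr0.
Qed.
End CohomologyLambda.

(** * From annihilators to the equivalence and the formula *)

Section Killing.
Variables (p : nat) (p_pr : prime p) (R : nzRingType).
Variable iota : {rmorphism powser (padic_int p_pr) -> R}.
Hypothesis iotaA : finite_free_algebra iota.
Variable P : complex R.
Hypothesis sP : strictly_perfect P.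

(** One annihilator for each of the finitely many nonzero degrees; [p] is prime and does not divide
    their product. *)
Lemma fgen_kills : (forall i, coh_fgen iota P i) -> exists2 g, ~ pdvd g & kills P (iota g).
Proof.
move=> fgP; have [_ [n Pn]] := sP.
have /choice[g gP] i : exists g, ~ pdvd g /\ forall x, coc P i x -> cob P i (iota g *: x).
  have [|||g ng gP] := @fgen_killed _ p_pr (restr iota (P i)) (coc P i) (cob P i) _ _ _ (fgP i).
  - exact/submodule_restr/submodule_coc.
  - exact/submodule_restr/submodule_cob.
  - exact: cob_coc.
  - by exists g.
exists (\prod_(j < n.*2.+1) g (tot_deg j)).
  by apply: (big_ind (fun x => ~ pdvd x)) => [|a b|j _]; [exact: not_pdvd1|exact: not_pdvd_mul|case: (gP (tot_deg j))].
apply/killsP => i z dz.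
have [ni|ni] := leqP (absz i) n; last first.
  by exists 0; rewrite (Pn i ni z) scaler0 raddf0.
have [j jE] := tot_degP ni.
rewrite (bigD1 j) //= jE mulrC rmorphM -scalerA.
by apply: (submodZ (@submodule_cob _ P i)); apply: (gP i).2.
Qed.

Lemma kills_fgen g : ~ pdvd g -> kills P (iota g) -> forall i, coh_fgen iota P i.
Proof.
move=> ng /killsP kg i; have [Pfp _] := sP.
have dP j : dual_basis (restr iota (P j)).
  by have [fP prP] := Pfp j; apply: dual_basis_restr.
apply: (killed_coh_fgen ng iotaA.1 (dP i) (dP (i + 1))) => z zZ.
exact: kg.
Qed.

Lemma kills_homotopy g : kills P (iota g) -> exists k (h : {linear tot P -> tot P}),
  forall x, iota (g ^+ k) *: x = tot_diff (h x) + h (tot_diff x).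
Proof.
move=> kg; have [Pfp [n Pn]] := sP.
have [k [h hP]] := kills_nullhomotopic Pn (fun i => (Pfp i).2) (iotaA.1 g) kg.
by exists k, h => x; rewrite rmorphXn.
Qed.
End Killing.

Section MuComparison.
Variables (p : nat) (p_pr : prime p) (L : nzRingType).
Variable psi : {rmorphism powser (padic_int p_pr) -> L}.
Local Notation zeta := (padic_to_Lambda psi).

Section Restricted.
Variables (G : finGroupType) (C : complex (group_ring L G)) (i : int).
Local Notation iota := (@gr_const L G \o psi).
Local Notation D := (restr_complex (@gr_const L G) C).

Let val_lin : linear (fun z : restr zeta (cocycle D i) => cocycle_val z : padic_restr iota (C i)).
Proof. by []. Qed.

Let coc_val (x : padic_restr iota (C i)) : coc C i x -> exists z, linear_pack val_lin z = x.
Proof. by move=> /eqP xZ; exists (@Cocycle _ D i x xZ). Qed.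

Lemma mu_zero_restr : mu_zero psi (cohomology D i) <-> coh_fgen iota C i.
Proof.
apply: (mu_zero_fgen (phi := linear_pack val_lin)) => //.
- exact/submodule_padic/submodule_cob.
- by case=> x /= /eqP.
Qed.

Lemma lambda_restr : coh_fgen iota C i ->
  lambda psi (cohomology D i) = ((coh_rank iota C i)%:Z)%:E.
Proof.
move=> fg; apply: (@lambda_rank _ _ _ psi D i (padic_restr iota (C i)) (coc C i) (cob C i) (linear_pack val_lin)) => //.
- exact/submodule_padic/submodule_cob.
- by case=> x /= /eqP.
- by apply/rk_has_rank/fgen_finrk => //; apply/submodule_padic/submodule_cob.
Qed.
End Restricted.

Section Direct.
Variables (D : complex L) (i : int).

Let val_lin : linear (fun z : restr zeta (cocycle D i) => cocycle_val z : padic_restr psi (D i)).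
Proof. by []. Qed.

Let coc_val (x : padic_restr psi (D i)) : coc D i x -> exists z, linear_pack val_lin z = x.
Proof. by move=> /eqP xZ; exists (@Cocycle _ D i x xZ). Qed.

Lemma mu_zero_direct : mu_zero psi (cohomology D i) <-> coh_fgen psi D i.
Proof.
apply: (mu_zero_fgen (phi := linear_pack val_lin)) => //.
- exact/submodule_padic/submodule_cob.
- by case=> x /= /eqP.
Qed.

Lemma lambda_direct : coh_fgen psi D i ->
  lambda psi (cohomology D i) = ((coh_rank psi D i)%:Z)%:E.
Proof.
move=> fg; apply: (@lambda_rank _ _ _ psi D i (padic_restr psi (D i)) (coc D i) (cob D i) (linear_pack val_lin)) => //.
- exact/submodule_padic/submodule_cob.
- by case=> x /= /eqP.
- by apply/rk_has_rank/fgen_finrk => //; apply/submodule_padic/submodule_cob.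
Qed.
End Direct.
End MuComparison.

Theorem theorem2p5 (p : nat) (p_pr : prime p)
    (L : nzRingType) (psi : {rmorphism powser (padic_int p_pr) -> L})
    (psi_bij : bijective psi)
    (G : finGroupType) (pG : (p.-group [set: G])%g)
    (C : complex (group_ring L G)) (C_perfect : perfect C)
    (Cbar : complex L)
    (CbarE : derived_base_change (@augmentation L G) C Cbar) :
  let C_L := restr_complex (@gr_const L G) C in
  ((forall i, mu_zero psi (cohomology C_L i)) <->
   (forall i, mu_zero psi (cohomology Cbar i))) /\
  ((forall i, mu_zero psi (cohomology C_L i)) ->
   lambda_complex psi C_L =
     ((#|G|%:Z)%:E * lambda_complex psi Cbar)%E).
Proof.
move=> C_L; have [P [q [r [sP qP rP]]]] := CbarE.
pose Q := bc_complex (@augmentation L G) P.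
have sQ : strictly_perfect Q := strictly_perfect_bc_complex _ sP.
pose iota : {rmorphism powser (padic_int p_pr) -> group_ring L G} := @gr_const L G \o psi.
have psiA := finite_free_psi psi_bij.
have iotaA : finite_free_algebra iota := finite_free_iota psi_bij G.
have [Pfp [n Pn]] := sP; have [Qfp [n' Qn]] := sQ.
have fX : fin_gen (tot P) := tot_fin_gen Pn (fun i => (Pfp i).1).
have prX : projective (tot P) := tot_projective Pn (fun i => (Pfp i).2).
have dX := dual_basis_restr iotaA fX prX.
have dXb : dual_basis (restr psi (tot Q)).
  apply: (dual_basis_restr psiA); first exact: (tot_fin_gen Qn (fun i => (Qfp i).1)).
  exact: (tot_projective Qn (fun i => (Qfp i).2)).
have piP := bc_tot_pair Pn.
have piD x : @tot_diff _ Q (bc_tot x) = bc_tot (tot_diff x) := bc_tot_diff x.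
have muC : (forall i, mu_zero psi (cohomology C_L i)) <-> forall i, coh_fgen iota P i.
  split=> h i; first exact: (quasi_iso_fgen iota i qP).2 ((mu_zero_restr psi C i).1 (h i)).
  exact: (mu_zero_restr psi C i).2 ((quasi_iso_fgen iota i qP).1 (h i)).
have muD : (forall i, mu_zero psi (cohomology Cbar i)) <-> forall i, coh_fgen psi Q i.
  split=> h i; first exact: (quasi_iso_fgen psi i rP).2 ((mu_zero_direct psi Cbar i).1 (h i)).
  exact: (mu_zero_direct psi Cbar i).2 ((quasi_iso_fgen psi i rP).1 (h i)).
have PQ : (forall i, coh_fgen iota P i) -> forall i, coh_fgen psi Q i.
  move=> /(fgen_kills sP)[g ng /(kills_homotopy iotaA sP)[k [h hP]]].
  have [hb hbP] := aug_pair_descend (bc_tot (P := P)) h piP.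
  apply: (kills_fgen psiA sQ (not_pdvd_exp (k := k) ng)) => z dz; exists (hb z).
  (* The lift [x] of the cocycle [z] need not be a cocycle, but the image of [h (d x)] is [hb]
     applied to the boundary of [z], hence zero. *)
  have [x xz] := piP.1 z; move: dz; rewrite -xz => dz.
  have d0 : bc_tot (tot_diff x) = 0 := etrans (esym (piD x)) dz.
  have e0 : bc_tot (h (tot_diff x)) = 0 :=
    etrans (esym (hbP _)) (etrans (congr1 hb d0) (raddf0 hb)).
  rewrite -[LHS]pi_scale [LHS](congr1 (bc_tot (P := P)) (hP x)) raddfD.
  by rewrite [X in _ + X = _]e0 addr0 [RHS](congr1 (@tot_diff _ Q) (hbP x)) -[LHS]piD.
have QP : (forall i, coh_fgen psi Q i) -> forall i, coh_fgen iota P i.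
  move=> /(fgen_kills sQ)[g ng /(kills_homotopy psiA sQ)[k [hb hbP]]].
  have [g' ng' kg'] := mu_lift pG iotaA.1 prX dX piP (@tot_diffK _ P) piD (not_pdvd_exp (k := k) ng) hbP.
  exact: (kills_fgen iotaA sP ng').
split; first by rewrite muC muD; split.
move=> /muC fgP; have fgQ := PQ fgP.
have [g ng /(kills_homotopy iotaA sP)[k [h0 h0P]]] := fgen_kills sP fgP.
(* Making the homotopy square to zero squares the scalar, so that the folded data belong to
   [g ^+ k * g ^+ k]. *)
have [h hP] := folded_exists (iotaA.1 (g ^+ k)) h0P.
have [hb hbP] := aug_pair_descend (bc_tot (P := P)) h piP.
have ngk : ~ pdvd (g ^+ k * g ^+ k) by apply: not_pdvd_mul; apply: not_pdvd_exp.
have fold : folded (fun x => iota (g ^+ k * g ^+ k) *: x) (@tot_diff _ P) h (parity false) (parity true).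
  by rewrite (rmorphM iota); apply: (hP false).
have := euler_folded pG iotaA psiA piP fX prX dXb ngk fold piD hbP
  (fun x => bc_tot_parity false x) (fun x => bc_tot_parity true x).
have P0 := rk_parity Pn fgP false; have P1 := rk_parity Pn fgP true.
have Q0 := rk_parity Qn fgQ false; have Q1 := rk_parity Qn fgQ true.
rewrite P0 P1 Q0 Q1 => eul.
have lamP i : lambda psi (cohomology C_L i) = ((coh_rank iota P i)%:Z)%:E.
  rewrite lambda_restr; last exact: (quasi_iso_fgen iota i qP).1 (fgP i).
  by rewrite /coh_rank (quasi_iso_rank iota i qP).
have lamQ i : lambda psi (cohomology Cbar i) = ((coh_rank psi Q i)%:Z)%:E.
  rewrite lambda_direct; last exact: (quasi_iso_fgen psi i rP).1 (fgQ i).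
  by rewrite /coh_rank (quasi_iso_rank psi i rP).
rewrite (lambda_complex_sum lamP (coh_rank_out iota Pn)).
rewrite (lambda_complex_sum lamQ (coh_rank_out psi Qn)) -EFinM; congr (_%:E).
move: eul; set a := (\sum_(m < _) _)%N; set b := (\sum_(m < _) _)%N.
set c := (\sum_(m < _) _)%N; set e := (\sum_(m < _) _)%N.
lia.
Qed.
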